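(* Let $p$ be a prime and let $\varepsilon > 0$. For each positive integer $n$, let $C_n$ be a deterministic $n\times n$ alternating matrix over $\mathbb{Z}_p$, and let $X_n$ be a random $C_n$-symmetric $n \times n$ matrix over $\mathbb{Z}_p$ whose entries on and above the diagonal are independent and $\varepsilon$-balanced. Assume that $$\lim_{n\to\infty} \operatorname{rank}(C_n \bmod p) = \infty.$$ Then for any finite abelian $p$-group $G$, $$\lim_{n\to\infty} \mathbb{P}[\operatorname{coker}(X_n) \cong G] = \frac{1}{|\operatorname{Aut}(G)|} \prod_{k=1}^\infty (1 - p^{-k}).$$
   Context: $\mathbb{Z}_p$ is the ring of $p$-adic integers. An $n\times n$ matrix $C$ over a commutative ring $R$ is alternating if $C^{\intercal} = -C$ and all its diagonal entries are $0$. For an alternating $n\times n$ matrix $C$ over $R$, an $n\times n$ matrix $X$ over $R$ is called $C$-symmetric if $X - X^{\intercal} = C$. A random variable $N$ valued in a ring $R$ is $\varepsilon$-balanced if for every maximal ideal $\mathfrak{p}$ of $R$ and every residue class $r \in R/\mathfrak{p}$ one has $\mathbb{P}[N \equiv r \pmod{\mathfrak{p}}] \leq 1-\varepsilon$. For an $n\times n$ matrix $M$ over $R$, $\operatorname{coker}(M) = R^n/M(R^n)$. $C_n \bmod p$ is the reduction of $C_n$ to a matrix over $\mathbb{F}_p$, and its rank is the rank over $\mathbb{F}_p$. The matrices $X_n$ for different $n$ need not be related to each other. *)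

(* Defs.v *)
From HB Require Import structures.
From mathcomp Require Import all_boot all_order all_algebra all_fingroup.
From mathcomp Require Import pgroup.
From mathcomp Require Import all_classical all_reals all_analysis.

Set Implicit Arguments.
Unset Strict Implicit.
Unset Printing Implicit Defensive.

Import Order.TTheory GRing.Theory Num.Theory.
Import numFieldNormedType.Exports.

Local Open Scope classical_set_scope.
Local Open Scope ring_scope.

(* The product ring of all the Z/p^(k+1), k : nat. Since 'Z_n is Z/n only for
   n > 1, it has this meaning (and [padic p] below is the ring of p-adic
   integers) for p > 1, in particular for p prime; for p <= 1 all the factors
   are Z/2. *)
Definition padic_seq (p : nat) : Type := forall k : nat, 'Z_(p ^ k.+1).

HB.instance Definition _ (p : nat) := gen_eqMixin (padic_seq p).
HB.instance Definition _ (p : nat) := gen_choiceMixin (padic_seq p).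

Section PadicSeq.
Variable p : nat.
Implicit Types x y z : padic_seq p.

Definition padic_seq_zero : padic_seq p := fun=> 0.
Definition padic_seq_one : padic_seq p := fun=> 1.
Definition padic_seq_opp x : padic_seq p := fun k => - x k.
Definition padic_seq_add x y : padic_seq p := fun k => x k + y k.
Definition padic_seq_mul x y : padic_seq p := fun k => x k * y k.

Lemma padic_seq_addA : associative padic_seq_add.
Proof. by move=> x y z; apply: functional_extensionality_dep => k; exact: addrA. Qed.
Lemma padic_seq_addC : commutative padic_seq_add.
Proof. by move=> x y; apply: functional_extensionality_dep => k; exact: addrC. Qed.
Lemma padic_seq_add0 : left_id padic_seq_zero padic_seq_add.
Proof. by move=> x; apply: functional_extensionality_dep => k; exact: add0r. Qed.
Lemma padic_seq_addN : left_inverse padic_seq_zero padic_seq_opp padic_seq_add.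
Proof. by move=> x; apply: functional_extensionality_dep => k; exact: addNr. Qed.

HB.instance Definition _ := GRing.isZmodule.Build (padic_seq p)
  padic_seq_addA padic_seq_addC padic_seq_add0 padic_seq_addN.

Lemma padic_seq_mulA : associative padic_seq_mul.
Proof. by move=> x y z; apply: functional_extensionality_dep => k; exact: mulrA. Qed.
Lemma padic_seq_mulC : commutative padic_seq_mul.
Proof. by move=> x y; apply: functional_extensionality_dep => k; exact: mulrC. Qed.
Lemma padic_seq_mul1 : left_id padic_seq_one padic_seq_mul.
Proof. by move=> x; apply: functional_extensionality_dep => k; exact: mul1r. Qed.
Lemma padic_seq_mulDl : left_distributive padic_seq_mul +%R.
Proof. by move=> x y z; apply: functional_extensionality_dep => k; exact: mulrDl. Qed.
Lemma padic_seq_one_neq0 : padic_seq_one != 0.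
Proof. by apply/eqP => /(congr1 (fun x : padic_seq p => x 0%N)). Qed.

HB.instance Definition _ := GRing.Zmodule_isComNzRing.Build (padic_seq p)
  padic_seq_mulA padic_seq_mulC padic_seq_mul1 padic_seq_mulDl
  padic_seq_one_neq0.

(* x (k+1) reduces to x k under the projection Z/p^(k+2) -> Z/p^(k+1). *)
Definition padic_coherent : {pred padic_seq p} :=
  fun x => `[< forall k, inZp (x k.+1) = x k >].

Lemma padic_modulus_dvd k :
  ((Zp_trunc (p ^ k.+1)).+2 %| (Zp_trunc (p ^ k.+2)).+2)%N.
Proof.
case: p => [|[|q]]; rewrite ?exp0n ?exp1n //.
by rewrite !Zp_cast ?(ltn_exp2l 0) // dvdn_exp2l.
Qed.

Lemma padic_coherent_subring : subring_closed padic_coherent.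
Proof.
split=> [|x y /asboolP xP /asboolP yP|x y /asboolP xP /asboolP yP];
    apply/asboolP => k; apply: val_inj => /=;
    rewrite (modn_dvdm _ (padic_modulus_dvd k)) //; rewrite -(xP k) -(yP k) /=.
- rewrite -modnDmr (modn_dvdm _ (padic_modulus_dvd k)) modnDmr modnDml modnDmr.
  apply/eqP; rewrite eqn_modDl -(eqn_modDr (y k.+1)) subnK; last first.
    exact/ltnW/ltn_ord.
  rewrite -modnDmr subnK; last by rewrite ltnW // ltn_mod.
  by rewrite modnn; exact: padic_modulus_dvd.
- by rewrite modnMm.
Qed.

HB.instance Definition _ := GRing.isSubringClosed.Build (padic_seq p)
  padic_coherent padic_coherent_subring.

End PadicSeq.

(* The ring of p-adic integers, as the inverse limit of the Z/p^(k+1). *)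
Record padic (p : nat) : Type := Padic {
  padic_val : padic_seq p;
  padic_valP : padic_val \in @padic_coherent p }.

HB.instance Definition _ (p : nat) := [isSub for @padic_val p].
HB.instance Definition _ (p : nat) := [Choice of padic p by <:].
HB.instance Definition _ (p : nat) :=
  [SubChoice_isSubComNzRing of padic p by <:].

(* The residue balls a + p^(k+1) Z_p form a countable basis of the p-adic
   topology, so they generate the Borel sigma-algebra. *)
Definition padic_ball (p : nat) : set (set (padic p)) :=
  [set B | exists k (a : 'Z_(p ^ k.+1)), B = [set x : padic p | padic_val x k = a]].

HB.instance Definition _ (p : nat) := isPointed.Build (padic p) 0.
HB.instance Definition _ (p : nat) :=
  Measurable.copy (padic p) (g_sigma_algebraType (@padic_ball p)).

(* Reduction Z_p -> F_p; for p prime, 'F_p is Z/p. *)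
Definition padic_modp (p : nat) (x : padic p) : 'F_p :=
  (nat_of_ord (padic_val x 0%N))%:R.

Definition alternating_mx (A : pzRingType) (n : nat) (C : 'M[A]_n) : Prop :=
  C^T = - C /\ forall i, C i i = 0.

Definition symmetric_mx_for (A : pzRingType) (n : nat) (C X : 'M[A]_n) : Prop :=
  X - X^T = C.

Definition maximal_ideal (A : comNzRingType) (I : idealr A) : Prop :=
  forall J : idealr A, {subset I <= J} -> {subset J <= I}.

Definition balanced d (T : measurableType d) (R : realType)
    (P : probability T R) (A : comNzRingType) (eps : R) (N : T -> A) : Prop :=
  forall (I : idealr A), maximal_ideal I -> forall r : {ideal_quot I},
    (P [set w | \pi_({ideal_quot I})%qT (N w) = r] <= (1 - eps)%:E)%E.

(* Mutual independence of the subfamily of (X i) indexed by D. *)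
Definition mutually_independent d (T : measurableType d) (R : realType)
    (P : probability T R) (I : finType) (D : {pred I})
    d' (U : measurableType d') (X : I -> T -> U) : Prop :=
  forall (J : {set I}) (B : I -> set U), {subset J <= D} ->
    (forall i, measurable (B i)) ->
    P (\bigcap_(i in [set` J]) (X i @^-1` B i)) =
      (\prod_(i in J) P (X i @^-1` B i))%E.

Section Cokernel.
Variables (A : comNzRingType) (n : nat) (M : 'M[A]_n).

Definition mx_image : {pred 'cV[A]_n} :=
  fun y => `[< exists v : 'cV[A]_n, y = M *m v >].

Lemma mx_image_zmod : zmod_closed mx_image.
Proof.
split=> [|_ _ /asboolP[u ->] /asboolP[v ->]]; apply/asboolP.
- by exists 0; rewrite mulmx0.
- by exists (u - v); rewrite mulmxBr.
Qed.

HB.instance Definition _ :=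
  GRing.isZmodClosed.Build 'cV[A]_n mx_image mx_image_zmod.

Definition coker : zmodType := Quotient.quot mx_image.

Definition coker_isog (G : zmodType) : Prop :=
  exists f : {additive coker -> G}, bijective f.

End Cokernel.

(* Main.v *)
Require Import Defs.
From HB Require Import structures.
From mathcomp Require Import all_classical all_reals all_analysis.
From mathcomp Require Import all_boot all_order all_algebra all_fingroup.
From mathcomp Require Import all_solvable all_field all_character complex zify ring lra.

Set Implicit Arguments.
Unset Strict Implicit.
Unset Printing Implicit Defensive.

Import Order.TTheory GRing.Theory Num.Theory FinRing.Theory.
Import numFieldNormedType.Exports.

Local Open Scope ring_scope.

(** The proof computes the moments of the cokernel, that is, its expected numbers
    of surjections to finite abelian [p]-groups, and recovers the law from them.

    Let [p^k] kill [G] and [q = p^(k+1)]. The cokernel of [X] is isomorphic to [G]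
    if and only if that of [X] mod [q] is ([coker_iso_reduce], [coker_iso_lift]),
    and the entries of [X] mod [q] on and above the diagonal have a product law
    ([mass_upper_entries]). What remains is a statement on finite sums,
    [iso_prob_near].

    Moments. Let [H] be killed by [q]. A surjection from the cokernel to [H] is a
    map [F] from the [n] indices to [H] that generates [H] and is killed by the
    matrix. Expanding the second condition in characters gives a sum over maps
    [u] from the indices to [W = H x H^], where [H^] is the dual of [H]. The
    weight of [u] is a root of unity, the phase, whose exponent is a quadratic
    expression in [u] with the coefficients of [C], times one Fourier coefficient
    for each entry; the arguments of these are the values of the hyperbolic form
    of [W] at the pairs [u_i], [u_j], and of its quadratic form at the [u_i]
    ([sur_moment_fourier]). As the entries are balanced, a Fourier coefficient at
    a nonzero argument has modulus at most a constant less than [1]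
    ([balance_gap]). So the weight is tiny unless the frequent values of [u]
    generate an isotropic subgroup of [W], and up to an error [o(|H|^n)] only the
    maps into Lagrangian subgroups [L], those of order [|H|] on which the
    quadratic form vanishes, contribute, with their phase ([sum_wt_lagrangian]).
    For [L = H x 0] the phase is [1], and the contribution is about [|H|^n]. For
    any other [L] that projects onto [H], the phases sum to at most
    [|H|^n p^(-r/2)], where [r] is the rank of [C] mod [p], by Weyl differencing
    ([quad_sum_le], [card_annihilator_le]). As [r] tends to infinity, every
    moment tends to [1] ([real_moment_near1]).

    From moments to probabilities. Let [A] be a finite abelian [p]-group. A
    surjection from [A] to [G] is an isomorphism when the [p]-torsion of its
    kernel, of order [p^r] say, is trivial. The indicator of [r = 0] lies between
    consecutive truncations of an alternating sum over [j] whose terms are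
    multiples of the number of surjections from [F_p^r] to [F_p^j]
    ([bonferroni_sign]). The sum of these numbers over all surjections from [A]
    to [G] is the average number of surjections from [A] to the extensions of [G]
    by [F_p^j], where the average runs over the cocycles ([sum_surs_ext],
    [card_cocycle]). For [A] the cokernel, the number for each extension has
    expectation tending to [1], so that the expected number of isomorphisms from
    the cokernel to [G] is asymptotically between consecutive truncations of a
    series which, by an identity of Euler, sums to [prod (1 - p^-k)]
    ([euler_sum_lim]). This number is [|Aut G|] times the probability of an
    isomorphism. *)

(** * Finite abelian groups and their characters *)

(** The joins of the finite and the additive structure, by which pairs and maps
    form finite abelian groups. *)
HB.instance Definition _ (A B : finZmodType) := Finite.on (A * B)%type.
HB.instance Definition _ (I : finType) (B : finZmodType) :=
  Finite.on {ffun I -> B}.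

Section Hom.
Variables (A B : finZmodType).

Definition is_hom (f : {ffun A -> B}) :=
  [forall x, forall y, f (x + y) == f x + f y].

(** A subtype of the finite functions, so that homomorphisms form a finite abelian
    group and can be counted. *)
Record zhom := Zhom { zhom_fun :> {ffun A -> B}; zhomP : is_hom zhom_fun }.

HB.instance Definition _ := [isSub for zhom_fun].
HB.instance Definition _ := [Finite of zhom by <:].

Lemma is_homP (f : {ffun A -> B}) :
  reflect (forall x y, f (x + y) = f x + f y) (is_hom f).
Proof.
apply: (iffP forallP) => [fP x y|fP x]; last by apply/forallP=> y; apply/eqP.
by have /forallP/(_ y)/eqP := fP x.
Qed.

Lemma is_hom_zmod : zmod_closed is_hom.
Proof.
split=> [|f g /is_homP fP /is_homP gP]; apply/is_homP=> x y; rewrite !ffunE ?addr0 //.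
by rewrite fP gP opprD addrACA.
Qed.

HB.instance Definition _ := GRing.isZmodClosed.Build {ffun A -> B} is_hom is_hom_zmod.
HB.instance Definition _ := [SubChoice_isSubZmodule of zhom by <:].

Lemma zhomD (f : zhom) x y : f (x + y) = f x + f y.
Proof. exact: (is_homP _ (zhomP f)). Qed.

Lemma zhom0 (f : zhom) : f 0 = 0.
Proof. by apply: (addrI (f 0)); rewrite -zhomD !addr0. Qed.

Lemma zhomN (f : zhom) x : f (- x) = - f x.
Proof. by apply: (addrI (f x)); rewrite -zhomD !subrr zhom0. Qed.

Lemma zhomMn (f : zhom) x n : f (x *+ n) = f x *+ n.
Proof. by elim: n => [|n IH]; rewrite ?mulr0n ?zhom0 // !mulrS zhomD IH. Qed.

Lemma zhom_sum (f : zhom) I (r : seq I) P (F : I -> A) :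
  f (\sum_(i <- r | P i) F i) = \sum_(i <- r | P i) f (F i).
Proof. by apply: (big_morph f (zhomD f) (zhom0 f)). Qed.

Lemma zhom_addE (f g : zhom) x : (f + g) x = f x + g x.
Proof. by rewrite /= ffunE. Qed.

Lemma zhom_zeroE x : (0 : zhom) x = 0.
Proof. by rewrite /= ffunE. Qed.

Lemma zhom_eqP (f g : zhom) : (forall x, f x = g x) -> f = g.
Proof. by move=> fg; apply: val_inj; apply/ffunP. Qed.

End Hom.

Section ZetaPow.
Variables (F : fieldType) (q : nat) (z : F).
Hypotheses (q_gt1 : (1 < q)%N) (prim_z : q.-primitive_root z).

Definition zpow (a : 'Z_q) : F := z ^+ (a : nat).

Lemma zpow_nat n : zpow n%:R = z ^+ n.
Proof. by rewrite /zpow val_Zp_nat // prim_expr_mod. Qed.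

Lemma zpow0 : zpow 0 = 1.
Proof. by []. Qed.

Lemma zpowD a b : zpow (a + b) = zpow a * zpow b.
Proof.
by rewrite -[a in LHS]natr_Zp -[b in LHS]natr_Zp -natrD zpow_nat exprD.
Qed.

Lemma zpowN a : zpow (- a) = (zpow a)^-1.
Proof.
have h : zpow a * zpow (- a) = 1 by rewrite -zpowD subrr zpow0.
by apply/esym/(mulr1_eq h).
Qed.

Lemma zpow_sum I (r : seq I) P (E : I -> 'Z_q) :
  zpow (\sum_(i <- r | P i) E i) = \prod_(i <- r | P i) zpow (E i).
Proof. exact: (big_morph zpow zpowD zpow0). Qed.

Lemma zpow_eq1 a : (zpow a == 1) = (a == 0).
Proof.
rewrite -[1]zpow0 /zpow (eq_prim_root_expr prim_z) eqn_mod_dvd // subn0.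
apply/idP/eqP => [|->]; last exact: dvdn0.
case: (posnP (a : nat)) => [a0 _|a_gt0]; first exact/val_inj.
move/(dvdn_leq a_gt0) => h; have := ltn_ord a; rewrite [X in (_ < X)%N]Zp_cast //.
by rewrite ltnNge h.
Qed.

Lemma zpow_neq0 a : zpow a != 0.
Proof.
apply/eqP => h; have: zpow a * zpow (- a) = 1 by rewrite -zpowD subrr zpow0.
by move/eqP; rewrite h mul0r eq_sym oner_eq0.
Qed.

Lemma zpow_inj : injective zpow.
Proof.
move=> a b ab; apply/eqP; rewrite -subr_eq0 -zpow_eq1 zpowD zpowN ab.
by rewrite divff ?zpow_neq0.
Qed.

(** Translating the summation variable multiplies a character sum by the value
    of the character, hence a nontrivial character sums to zero. *)
Lemma char_sum (W : finZmodType) (H : {group W}) (chi : W -> 'Z_q) :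
  {in H &, forall u v, chi (u + v) = chi u + chi v} ->
  \sum_(h in H) zpow (chi h) =
    if [forall h in H, chi h == 0] then #|H|%:R else 0.
Proof.
move=> chiD; case: ifPn => [/forall_inP chi0|].
  by rewrite -sumr_const; apply: eq_bigr => h hH; rewrite (eqP (chi0 h hH)) zpow0.
case/forall_inPn => h0 h0H chih0; set S := \sum_(_ in _) _.
have : zpow (chi h0) * S = S.
  rewrite mulr_sumr [RHS](reindex_inj (addrI h0)) /=; apply: eq_big => [h|h hH].
    by rewrite -zmodMgE groupMl.
  by rewrite -zpowD chiD.
move/eqP; rewrite -subr_eq0 -[X in _ - X]mul1r -mulrBl mulf_eq0 subr_eq0.
by rewrite zpow_eq1 (negPf chih0) => /eqP.
Qed.

End ZetaPow.

(** The polynomial ['X^n - 1] is separable, so it has [n] distinct roots, and a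
    group of [n] roots of unity in a field is cyclic. *)
Lemma numClosed_prim_root (K : numClosedFieldType) n :
  (0 < n)%N -> {z : K | n.-primitive_root z}.
Proof.
pose p : {poly K} := 'X^n - 1; have [r Dp] := closed_field_poly_normal p.
move=> n_gt0; apply/sigW; rewrite (monicP _) ?monicXnsubC // scale1r in Dp.
have rn1 : all n.-unity_root r by apply/allP=> z; rewrite -root_prod_XsubC -Dp.
have sz_r : (n < (size r).+1)%N.
  by rewrite -(size_prod_XsubC r id) -Dp size_XnsubC.
have [|z] := hasP (has_prim_root n_gt0 rn1 _ sz_r); last by exists z.
by rewrite -separable_prod_XsubC -Dp separable_Xn_sub_1 // pnatr_eq0 -lt0n.
Qed.

Section Duality.
Variables (q : nat) (G : finZmodType).
Hypotheses (q_gt1 : (1 < q)%N) (Gq : forall g : G, g *+ q = 0).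

(** The irreducible characters of an abelian group are linear and separate its
    points; their values are powers of one primitive root of unity, whose
    exponents give a homomorphism to [Z/q]. *)
Lemma zhom_sep (g : G) : g != 0 -> exists xi : zhom G 'Z_q, xi g != 0.
Proof.
move=> g_neq0.
have abG : abelian [set: G].
  by apply/centsP => x _ y _; rewrite /commute !zmodMgE addrC.
have : g \notin (\bigcap_(i | 'chi[[set: G]%G]_i \is a linear_char) cfker 'chi_i)%g.
  by rewrite cap_cfker_lin_irr (derG1P abG) inE.
move=> /bigcapP gN; have {gN} [i lin_i gN] : exists2 i : Iirr [set: G]%G, 'chi_i \is a linear_char & g \notin cfker 'chi_i.
  apply/exists_inP; case: exists_inP => // nex; case: gN => i lin_i.
  by apply: contrapT => /negP gN; apply: nex; exists i.
have [z prim_z] := numClosed_prim_root algC (ltnW q_gt1).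
have chiq (x : G) : ('chi_i x) ^+ q = 1.
  by rewrite -lin_charX ?inE // zmodXgE Gq -zmod1gE lin_char1.
pose e x := sval (prim_rootP prim_z (chiq x)).
have eP x : 'chi_i x = z ^+ e x by rewrite /e; case: prim_rootP.
have homP : is_hom [ffun x => (e x)%:R : 'Z_q].
  apply/is_homP => x y; rewrite !ffunE -natrD.
  apply: (zpow_inj q_gt1 prim_z).
  by rewrite !zpow_nat // exprD -!eP -zmodMgE lin_charM ?inE.
exists (Zhom homP); rewrite /= ffunE -(zpow_eq1 q_gt1 prim_z) zpow_nat // -eP.
apply: contraNneq gN => h; rewrite cfkerEchar ?irr_char // inE h lin_char1 // eqxx.
by rewrite inE.
Qed.

End Duality.

Section Pairing.
Variables (q : nat) (U V : finZmodType) (b : U -> V -> 'Z_q).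
Hypothesis q_gt1 : (1 < q)%N.
Hypothesis bDl : forall u u' v, b (u + u') v = b u v + b u' v.
Hypothesis bDr : forall u v v', b u (v + v') = b u v + b u v'.

(** Both sides compute the sum of the values of the character [b u v] over all
    pairs. *)
Lemma pairing_card (H : {group U}) (L : {group V}) :
  (#|L| * #|[set u in H | [forall v in L, (b u v == 0)%R]]| =
   #|H| * #|[set v in L | [forall u in H, (b u v == 0)%R]]|)%N.
Proof.
have [z prim_z] := numClosed_prim_root algC (ltnW q_gt1).
have sumE : forall (u : U), \sum_(v in L) zpow z (b u v) =
    if [forall v in L, b u v == 0] then #|L|%:R else 0.
  by move=> u; apply: (char_sum q_gt1 prim_z) => v v' _ _; exact: bDr.
have sumE' : forall (v : V), \sum_(u in H) zpow z (b u v) =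
    if [forall u in H, b u v == 0] then #|H|%:R else 0.
  by move=> v; apply: (char_sum q_gt1 prim_z (chi := b^~ v)) => u u' _ _; exact: bDl.
apply/eqP; rewrite -(eqr_nat algC) !natrM; apply/eqP.
transitivity (\sum_(u in H) \sum_(v in L) zpow z (b u v)).
  under eq_bigr => u _ do rewrite sumE.
  rewrite -big_mkcondr /= sumr_const mulr_natr; congr (_ *+ _).
  by apply: eq_card => u; rewrite !inE.
rewrite exchange_big /=; under eq_bigr => v _ do rewrite sumE'.
rewrite -big_mkcondr /= sumr_const mulr_natr; congr (_ *+ _).
by apply: eq_card => u; rewrite !inE.
Qed.

End Pairing.

Section DualCard.
Variables (q : nat) (G : finZmodType).
Hypotheses (q_gt1 : (1 < q)%N) (Gq : forall g : G, g *+ q = 0).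

(** Evaluation pairs [G] with its dual, and it is nondegenerate on both sides. *)
Lemma card_zhom_dual : #|{: zhom G 'Z_q}| = #|G|.
Proof.
pose b (g : G) (xi : zhom G 'Z_q) := xi g.
have bDl u u' v : b (u + u') v = b u v + b u' v by exact: zhomD.
have bDr u v v' : b u (v + v') = b u v + b u v' by exact: zhom_addE.
have := pairing_card q_gt1 bDl bDr [set: G]%G [set: (zhom G 'Z_q : finZmodType)]%G.
rewrite !cardsT.
rewrite [X in #|pred_of_set X|](_ : _ = [set 0]); last first.
  apply/setP => g; rewrite !inE /=; apply/forall_inP/eqP => [h|-> xi _]; last first.
    by rewrite /b zhom0.
  by apply: contrapT => /eqP/(zhom_sep q_gt1 Gq)[xi]; rewrite h ?inE.
rewrite [X in (_ = _ * #|pred_of_set X|)%N](_ : _ = [set 0]); last first.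
  apply/setP => xi; rewrite !inE /=; apply/forall_inP/eqP => [h|-> g _]; last first.
    by rewrite /b zhom_zeroE.
  by apply: zhom_eqP => g; rewrite zhom_zeroE; apply/eqP/h; rewrite inE.
by rewrite !cards1 !muln1.
Qed.

End DualCard.

(** * Sums over maps into a quadratic group *)

Lemma gen_ind (W : finZmodType) (S : {set W}) (Q : pred W) :
  Q 0 -> (forall x y, Q x -> Q y -> Q (x + y)) -> {in S, forall x, Q x} ->
  {in <<S>>%g, forall x, Q x}.
Proof.
move=> Q0 QD QS.
have gQ : group_set [set x | Q x].
  by apply/group_setP; split=> [|x y]; rewrite !inE // => /QD h /h.
have : <<S>>%g \subset Group gQ.
  by rewrite gen_subG; apply/subsetP => x /QS; rewrite inE.
by move=> /subsetP h x /h; rewrite inE.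
Qed.

Section Core.
Variables (q g : nat) (W : finZmodType) (beta : W -> W -> 'Z_q).
Hypothesis q_gt1 : (1 < q)%N.
Hypothesis betaDl : forall u u' v, beta (u + u') v = beta u v + beta u' v.
Hypothesis betaDr : forall u v v', beta u (v + v') = beta u v + beta u v'.

Definition polar u v := beta u v + beta v u.

Hypothesis polar_nondeg : forall w, (forall v, polar w v = 0) -> w = 0.
Hypothesis cardW : #|W| = (g ^ 2)%N.

Lemma polarC u v : polar u v = polar v u.
Proof. exact: addrC. Qed.

Lemma polarDl u u' v : polar (u + u') v = polar u v + polar u' v.
Proof. by rewrite /polar betaDl betaDr addrACA. Qed.

Lemma polarDr u v v' : polar u (v + v') = polar u v + polar u v'.
Proof. by rewrite !(polarC u) polarDl. Qed.

Lemma polar0l v : polar 0 v = 0.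
Proof. by apply: (addrI (polar 0 v)); rewrite -polarDl !addr0. Qed.

Definition isotropic (A : {set W}) := [forall u in A, forall v in A, polar u v == 0].

(** By [isotropic_card], [g] is the largest order that an isotropic subgroup can
    have. *)
Definition lagrangian (H : {group W}) :=
  [&& #|H| == g, isotropic H & [forall u in H, beta u u == 0]].

Lemma isotropicP (A : {set W}) :
  reflect {in A &, forall u v, polar u v = 0} (isotropic A).
Proof.
apply: (iffP forall_inP) => [h u v uA vA|h u uA].
  by have /forall_inP/(_ v vA)/eqP := h u uA.
by apply/forall_inP => v vA; apply/eqP/h.
Qed.

Lemma gen_isotropic (A : {set W}) : isotropic A -> isotropic <<A>>%g.
Proof.
move=> /isotropicP isoA.
have h1 : {in A, forall u, {in <<A>>%g, forall v, polar u v == 0}}.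
  move=> u uA; apply: gen_ind => [|x y /eqP x0 /eqP y0|v vA].
  - by rewrite polarC polar0l.
  - by rewrite polarDr x0 y0 addr0.
  - by rewrite isoA.
apply/isotropicP => u v uA vA; apply/eqP; move: u uA; apply: gen_ind => [|x y /eqP x0 /eqP y0|u uA].
- by rewrite polar0l.
- by rewrite polarDl x0 y0 addr0.
- exact: h1.
Qed.

(** The whole group has trivial orthogonal, by nondegeneracy. *)
Lemma card_perp (H : {group W}) :
  (#|H| * #|[set v | [forall u in H, (polar u v == 0)%R]]| = g ^ 2)%N.
Proof.
have := pairing_card q_gt1 polarDl polarDr H [set: W]%G.
rewrite !cardsT [X in #|pred_of_set X|](_ : _ = [set 0]); last first.
  apply/setP => w; rewrite !inE; apply/andP/eqP => [[_ /forall_inP h]|->].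
    by apply: polar_nondeg => v; apply/eqP/h; rewrite inE.
  by split; [exact: group1 | apply/forall_inP => v _; rewrite polar0l].
rewrite cards1 muln1 cardW => ->; congr (_ * _)%N.
by apply: eq_card => v; rewrite !inE.
Qed.

(** An isotropic subgroup lies in its orthogonal. *)
Lemma isotropic_card (H : {group W}) : isotropic H -> (#|H| <= g)%N.
Proof.
move=> /isotropicP isoH; have := card_perp H; set L := finset _ => HL.
have : (#|H| <= #|L|)%N.
  apply/subset_leq_card/subsetP => u uH; rewrite inE.
  by apply/forall_inP => v vH; rewrite isoH.
by move=> h; rewrite -leq_sqr -HL -mulnn leq_pmul2l // cardG_gt0.
Qed.

(** An isotropic subgroup of order [g] is its own orthogonal, by counting. *)
Lemma isotropic_perp (H : {group W}) w : isotropic H -> #|H| = g ->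
  w \notin H -> exists2 h, h \in H & polar h w != 0.
Proof.
move=> /isotropicP isoH cardH wH; have := card_perp H; set L := finset _ => HL.
have g_gt0 : (0 < g)%N by rewrite -cardH cardG_gt0.
have cardL : #|L| = g.
  by apply/eqP; rewrite -(eqn_pmul2l g_gt0) mulnn -HL cardH.
have HsubL : H \subset L.
  by apply/subsetP => u uH; rewrite inE; apply/forall_inP => v vH; rewrite isoH.
have /eqP HeqL : H == L :> {set W} by rewrite eqEcard HsubL cardL cardH leqnn.
move: wH; rewrite HeqL inE => /forall_inPn[h hH hw].
by exists h => //; rewrite -HeqL.
Qed.

Section Fixed.
Variables (n t : nat).
Hypothesis t_gt0 : (0 < t)%N.
Implicit Types (u : {ffun 'I_n -> W}) (H : {group W}).

(** A popular value occurs at so many indices that a defect of it multiplies: two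
    popular values that are not orthogonal make about [t ^ 2] bad pairs. *)
Definition popular u := [set w | (t <= #|[set i | u i == w]|)%N].
Definition maps_into u (A : {set W}) := [forall i, u i \in A].
Definition outside u (A : {set W}) := #|[set i | u i \notin A]|.
Definition bad_pairs u :=
  #|[set ij : 'I_n * 'I_n | (ij.1 != ij.2) && (polar (u ij.1) (u ij.2) != 0)]|.
Definition bad_diag u := #|[set i | beta (u i) (u i) != 0]|.

Lemma outside_eq0 u A : (outside u A == 0%N) = maps_into u A.
Proof.
rewrite cards_eq0; apply/eqP/forallP => [/setP h i|h].
  by have := h i; rewrite !inE => /negbFE.
by apply/setP => i; rewrite !inE h.
Qed.

Lemma popular_sub u (A : {set W}) : maps_into u A -> popular u \subset A.
Proof.
move=> /forallP uA; apply/subsetP => w; rewrite inE => /(leq_trans t_gt0).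
by case/card_gt0P => i; rewrite inE => /eqP <-.
Qed.

(** Values outside [A] are not popular, so each is taken less than [t] times. *)
Lemma outside_popular u (A : {set W}) : popular u \subset A ->
  (outside u A <= #|W| * t)%N.
Proof.
move=> /subsetP sA.
have -> : outside u A = (\sum_(w | w \notin A) #|[set i | u i == w]|)%N.
  rewrite /outside -sum1_card (partition_big u (fun w => w \notin A)) /=; last first.
    by move=> i; rewrite inE.
  apply: eq_bigr => w wA; rewrite -sum1_card; apply: eq_bigl => i.
  by rewrite !inE; case: eqP => [->|]; rewrite ?wA ?andbF.
apply: leq_trans (_ : (\sum_(w : W | w \notin A) t <= _)%N).
  apply: leq_sum => w wA; rewrite leqNgt; apply: contra wA => h.
  by apply: sA; rewrite inE ltnW.
by rewrite sum_nat_const leq_mul2r max_card orbT.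
Qed.

Lemma bad_pairs_popular u w w' : w \in popular u -> w' \in popular u ->
  polar w w' != 0 -> (t * t.-1 <= bad_pairs u)%N.
Proof.
rewrite !inE => wS w'S ww'.
set A := finset _ in wS; set A' := finset _ in w'S.
apply: leq_trans (_ : (\sum_(i in A) #|A' :\ i| <= _)%N).
  apply: leq_trans (_ : (\sum_(i in A) t.-1 <= _)%N).
    by rewrite sum_nat_const leq_mul2r wS orbT.
  apply: leq_sum => i _; rewrite (cardsD1 i A') in w'S.
  have := leq_b1 (i \in A'); lia.
rewrite (eq_bigr (fun i => \sum_(j in A' :\ i) 1)%N); last by move=> i _; rewrite sum1_card.
rewrite pair_big_dep /= sum1_card; apply/subset_leq_card/subsetP => -[i j] /=.
move=> hij; have {hij} : (i \in A) && (j \in A' :\ i) := hij.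
rewrite !inE /= => /andP[/eqP ui /andP[ij /eqP uj]]; by rewrite ui uj ww' eq_sym ij.
Qed.

Lemma bad_pairs_outside u H : popular u \subset H ->
  {in ~: H, forall w, exists2 s, s \in popular u & polar s w != 0} ->
  (outside u H * t <= bad_pairs u)%N.
Proof.
move=> /subsetP sH wit.
apply: (@leq_trans (\sum_(i | u i \notin H) #|[set j | (i != j) && (polar (u i) (u j) != 0)%R]|)%N).
  rewrite /outside -sum_nat_const (eq_bigl (fun i => u i \notin H)); last first.
    by move=> i; rewrite inE.
  apply: leq_sum => i uiH; have [|s sS sw] := wit (u i); first by rewrite inE.
  move: (sS); rewrite inE => /leq_trans; apply.
  apply/subset_leq_card/subsetP => j; rewrite !inE => /eqP uj.
  rewrite uj polarC sw andbT; apply: contraNneq uiH => ->.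
  by rewrite uj; exact: sH.
rewrite (eq_bigr (fun i => \sum_(j in [set j | (i != j) && (polar (u i) (u j) != 0)%R]) 1)%N); last by move=> i _; rewrite sum1_card.
rewrite pair_big_dep /= sum1_card; apply/subset_leq_card/subsetP => -[i j] /=.
move=> hij.
have {hij} : (u i \notin H) && (j \in [set j | (i != j) && (polar (u i) (u j) != 0)%R]) := hij.
by rewrite !inE => /andP[_].
Qed.

(* The weight [wt u] stands for a product of factors, each at most [sg] in modulus
   at a bad pair or index, and equal to the phase [ph u] when there are none. *)
Variables (K : numFieldType) (sg : K) (wt ph : {ffun 'I_n -> W} -> K).
Hypotheses (sg_ge0 : 0 <= sg) (sg_le1 : sg <= 1).
Hypothesis wt_pairs : forall u, `|wt u| <= sg ^+ bad_pairs u.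
Hypothesis wt_diag : forall u, `|wt u| <= sg ^+ bad_diag u.
Hypothesis wt_ph : forall u, bad_pairs u = 0%N -> bad_diag u = 0%N -> wt u = ph u.
Hypothesis ph_le1 : forall u, `|ph u| <= 1.

Definition few_outside u H : K := (outside u H <= #|W| * t)%N%:R.

Definition outside_weight u H : K :=
  if outside u H == 0%N then sg ^+ t else sg ^+ (outside u H * t).

(** The three summands correspond to the three cases in the proof of
    [wt_pointwise], according to the subgroup generated by the popular values. *)
Definition pointwise_bound u : K :=
  sg ^+ (t * t.-1)
  + \sum_(H : {group W} | (#|H| < g)%N) (1 + #|{group W}|%:R) * few_outside u H
  + \sum_(H : {group W} | #|H| == g) outside_weight u H.

Definition lagrangian_part u : K :=
  \sum_(H : {group W} | lagrangian H && maps_into u H) ph u.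

Lemma few_outside_ge0 u H : 0 <= few_outside u H.
Proof. exact: ler0n. Qed.

Lemma outside_weight_ge0 u H : 0 <= outside_weight u H.
Proof. by rewrite /outside_weight; case: ifP => _; apply: exprn_ge0. Qed.

Lemma wt_le1 u : `|wt u| <= 1.
Proof. by apply: le_trans (wt_pairs u) _; apply: exprn_ile1. Qed.

Lemma lagrangian_part_le u : `|lagrangian_part u| <= #|{group W}|%:R.
Proof.
apply: le_trans (ler_norm_sum _ _ _) _.
apply: le_trans (_ : \sum_(H : {group W} | lagrangian H && maps_into u H) 1 <= _).
  exact: ler_sum.
by rewrite sumr_const ler_nat; exact: max_card.
Qed.

Lemma lagrangian_part_eq0 u :
  (forall H, lagrangian H -> maps_into u H -> False) -> lagrangian_part u = 0.
Proof. by move=> h; rewrite /lagrangian_part big_pred0 // => H; apply/andP => -[/h]. Qed.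

Lemma lagrangian_gen u H : #|<<popular u>>%g| = g -> lagrangian H ->
  maps_into u H -> H = <<popular u>>%G.
Proof.
move=> cardH0 /and3P[/eqP cardH _ _] uH; apply/val_inj/esym/eqP => /=.
by rewrite eqEcard gen_subG popular_sub //= cardH cardH0.
Qed.

(** The popular values of [u] generate a subgroup. If it is not isotropic, two
    popular values alone give quadratically many bad pairs. If it has less than
    [g] elements, [u] is one of few maps. If it has [g] elements, it equals its
    orthogonal, so every value outside makes a bad pair with each occurrence of
    some popular value; and if [u] has no value outside, then either the subgroup
    is Lagrangian and the weight is the phase, or the quadratic form
    is nonzero at some popular value, hence at [t] or more indices. *)
Lemma wt_pointwise u : `|wt u - lagrangian_part u| <= pointwise_bound u.
Proof.
have p0 : 0 <= sg ^+ (t * t.-1) by exact: exprn_ge0.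
have s1 : 0 <= \sum_(H : {group W} | (#|H| < g)%N) (1 + #|{group W}|%:R) * few_outside u H.
  by apply: sumr_ge0 => H _; rewrite mulr_ge0 ?few_outside_ge0 ?addr_ge0.
have s2 : 0 <= \sum_(H : {group W} | #|H| == g) outside_weight u H.
  by apply: sumr_ge0 => H _; exact: outside_weight_ge0.
set H0 := <<popular u>>%G.
have popH0 : popular u \subset H0 by exact: subset_gen.
have [iso|] := boolP (isotropic (popular u)); last first.
  case/forall_inPn => w wS /forall_inPn[w' w'S ww'].
  rewrite lagrangian_part_eq0 => [|H /and3P[_ /isotropicP isoH _] uH].
    rewrite subr0; apply: le_trans (wt_pairs u) _.
    apply: le_trans (_ : sg ^+ (t * t.-1) <= _).
      by apply: ler_wiXn2l => //; exact: bad_pairs_popular wS w'S ww'.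
    by rewrite /pointwise_bound -addrA lerDl addr_ge0.
  have /subsetP sH := popular_sub uH.
  by rewrite isoH ?eqxx ?sH in ww'.
have isoH0 : isotropic H0 by exact: gen_isotropic.
have := isotropic_card isoH0; rewrite leq_eqVlt => /orP[/eqP cardH0|ltH0]; last first.
  apply: le_trans (_ : (1 + #|{group W}|%:R) * few_outside u H0 <= _).
    rewrite /few_outside outside_popular // mulr1.
    apply: le_trans (ler_normB _ _) _; apply: lerD; [exact: wt_le1|].
    exact: lagrangian_part_le.
  rewrite /pointwise_bound addrAC; apply: ler_wpDl; first exact: addr_ge0.
  rewrite (bigD1 H0) //= lerDl; apply: sumr_ge0 => H _.
  by rewrite mulr_ge0 ?few_outside_ge0 ?addr_ge0.
have H0w : outside_weight u H0 <= pointwise_bound u.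
  rewrite /pointwise_bound; apply: ler_wpDl; first exact: addr_ge0.
  rewrite (bigD1 H0) ?cardH0 //= lerDl; apply: sumr_ge0 => H _.
  exact: outside_weight_ge0.
have [out0|out_gt0] := posnP (outside u H0).
  have uH0 : maps_into u H0 by rewrite -outside_eq0 out0.
  have [q0|] := boolP [forall s in H0, beta s s == 0].
    have lagH0 : lagrangian H0 by rewrite /lagrangian cardH0 eqxx isoH0 q0.
    rewrite /lagrangian_part (big_pred1 H0) => [|H /=]; last first.
      apply/andP/eqP => [[lagH uH]|-> //]; exact: lagrangian_gen.
    rewrite wt_ph ?subrr ?normr0 ?addr_ge0 //.
      apply: eq_card0 => -[i j]; rewrite !inE /=; apply/negbTE.
      rewrite negb_and negbK; apply/orP; right; rewrite negbK; apply/eqP.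
      by apply: (isotropicP _ isoH0); apply: (forallP uH0).
    apply: eq_card0 => i; rewrite !inE; apply/negbTE; rewrite negbK.
    by apply: (forall_inP q0); apply: (forallP uH0).
  move=> nq0; rewrite lagrangian_part_eq0 => [|H lagH uH]; last first.
    move: nq0; rewrite -(lagrangian_gen cardH0 lagH uH : H = H0).
    by case/and3P: lagH => _ _ ->.
  rewrite subr0; apply: le_trans H0w; rewrite /outside_weight out0 eqxx.
  apply: le_trans (wt_diag u) _; apply: ler_wiXn2l => //.
  have [s sS qs] : exists2 s, s \in popular u & beta s s != 0.
    apply/exists_inP; apply: contraR nq0; rewrite negb_exists_in => /forall_inP h.
    apply/forall_inP => s sH0; suff /andP[] : (s \in H0) && (beta s s == 0) by [].
    move: s sH0; apply: gen_ind => [|x y /andP[xH /eqP x0] /andP[yH /eqP y0]|s sS].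
    - rewrite group1 /=; apply/eqP; apply: (addrI (beta 0 0)).
      by rewrite -betaDl !addr0.
    - rewrite -zmodMgE groupM //= zmodMgE betaDl !betaDr x0 y0 add0r addr0.
      by rewrite -[_ + _]/(polar x y) (isotropicP _ isoH0).
    - by rewrite mem_gen //= -[_ == _]negbK h.
  move: sS; rewrite inE => /leq_trans; apply; apply/subset_leq_card/subsetP => i.
  by rewrite !inE => /eqP ->.
rewrite lagrangian_part_eq0 => [|H lagH uH]; last first.
  move: (uH); rewrite (lagrangian_gen cardH0 lagH uH : H = H0) -outside_eq0.
  by rewrite gtn_eqF.
rewrite subr0; apply: le_trans H0w; rewrite /outside_weight gtn_eqF //.
apply: le_trans (wt_pairs u) _; apply: ler_wiXn2l => //.
apply: bad_pairs_outside => // w; rewrite inE => wH0.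
apply/exists_inP; apply: contraR wH0; rewrite negb_exists_in => /forall_inP h.
apply: contrapT => /negP wH0; have [h0 h0H /negP[]] := isotropic_perp isoH0 cardH0 wH0.
move: h0 h0H; apply: gen_ind => [|x y /eqP x0 /eqP y0|s sS].
- by rewrite polar0l.
- by rewrite polarDl x0 y0 addr0.
- by rewrite -[_ == _]negbK h.
Qed.

(** The exponent is a sum over the indices, so the sum over maps is a product. *)
Lemma sum_pow_outside (H : {group W}) (x : K) :
  \sum_u x ^+ outside u H = (#|H|%:R + x * #|~: H|%:R) ^+ n.
Proof.
have -> : #|H|%:R + x * #|~: H|%:R = \sum_w (if w \in H then 1 else x).
  rewrite (bigID (mem H)) /= (eq_bigr (fun=> 1)) => [|w ->] //.
  rewrite (eq_bigr (fun=> x) (P := fun w => w \notin H)) => [|w /negbTE ->] //.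
  rewrite !sumr_const mulr_natr; congr (_ + _ *+ _).
  by apply: eq_card => w; rewrite !inE.
rewrite -[in RHS](card_ord n) -prodr_const bigA_distr_bigA /=; apply: eq_bigr => u _.
rewrite (bigID (fun i => u i \in H)) /= big1 ?mul1r => [|i ->] //.
rewrite (eq_bigr (fun=> x)) => [|i /negbTE ->] //; rewrite prodr_const.
by congr (_ ^+ _); apply: eq_card => i; rewrite !inE.
Qed.

Lemma g_gt0 : (0 < g)%N.
Proof.
rewrite lt0n; apply/eqP => g0; have : (0 < #|W|)%N by apply/card_gt0P; exists 0.
by rewrite cardW g0.
Qed.

(** Exponential Markov inequality: the number of [u] with at most [m] values
    outside [H] is bounded by the sum of [x ^+ (outside u H - m)], for any
    [0 < x <= 1]. *)
Lemma sum_few_outside (H : {group W}) : (#|H| < g)%N ->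
  \sum_u few_outside u H <=
    (4 * g ^ 2)%:R ^+ (g ^ 2 * t) * (g%:R - 3 / 4) ^+ n.
Proof.
move=> ltH; set X : K := (4 * g ^ 2)%:R.
(* With x = 1 / (4 g^2), the g^2 elements outside H weigh at most 1/4 together,
   while H has at most g - 1 elements. *)
have X_gt0 : 0 < X by rewrite ltr0n muln_gt0 expn_gt0 g_gt0.
apply: le_trans (_ : \sum_u X ^+ (g ^ 2 * t) * X^-1 ^+ outside u H <= _).
  apply: ler_sum => u _; rewrite /few_outside cardW; case: leqP => ho /=; last first.
    by rewrite mulr_ge0 ?exprn_ge0 ?invr_ge0 // ltW.
  rewrite -(subnK ho) exprD -mulrA exprVn divff ?expf_neq0 ?gt_eqF // mulr1.
  by apply: exprn_ege1; rewrite ler1n muln_gt0 expn_gt0 g_gt0.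
rewrite -mulr_sumr sum_pow_outside; apply: ler_wpM2l; first by rewrite exprn_ge0 // ltW.
have hH : #|H|%:R <= g%:R - 1 :> K.
  by rewrite lerBrDr natr1 ler_nat.
apply: lerXn2r; rewrite ?nnegrE.
- by rewrite addr_ge0 // mulr_ge0 // invr_ge0 ltW.
- have : 1 <= g%:R :> K by rewrite ler1n g_gt0.
  by move=> h; rewrite subr_ge0; apply: le_trans h; rewrite ler_pdivrMr ?ltr0n // mul1r ler_nat.
have -> : g%:R - 3 / 4 = g%:R - 1 + 4^-1 :> K.
  by field.
apply: lerD => //; rewrite mulrC ler_pdivrMr // /X natrM mulrA mulVf ?pnatr_eq0 // mul1r.
by rewrite ler_nat -cardW max_card.
Qed.

Lemma sum_outside_weight (H : {group W}) : #|H| = g ->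
  \sum_u outside_weight u H <=
    (g%:R + (g ^ 2)%:R * sg ^+ t) ^+ n - g%:R ^+ n + g%:R ^+ n * sg ^+ t.
Proof.
move=> cardH.
have -> : \sum_u outside_weight u H = \sum_u (sg ^+ t) ^+ outside u H
   - \sum_u 0 ^+ outside u H + (\sum_u 0 ^+ outside u H) * sg ^+ t.
  rewrite mulr_suml -sumrB -big_split /=; apply: eq_bigr => u _.
  rewrite /outside_weight; case: eqP => [->|/eqP nz].
    by rewrite !expr0 subrr add0r mul1r.
  by rewrite [0 ^+ _]expr0n (negPf nz) mul0r subr0 addr0 -exprM mulnC.
rewrite !sum_pow_outside mul0r addr0 cardH; apply: lerD => //; apply: lerB => //.
apply: lerXn2r; rewrite ?nnegrE ?addr_ge0 ?mulr_ge0 ?exprn_ge0 //.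
apply: lerD => //; rewrite mulrC; apply: ler_wpM2r; first exact: exprn_ge0.
by rewrite ler_nat -cardW max_card.
Qed.

Definition core_error : K :=
  (g ^ 2)%:R ^+ n * sg ^+ (t * t.-1)
  + #|{group W}|%:R * ((1 + #|{group W}|%:R)
      * ((4 * g ^ 2)%:R ^+ (g ^ 2 * t) * (g%:R - 3 / 4) ^+ n))
  + #|{group W}|%:R *
    ((g%:R + (g ^ 2)%:R * sg ^+ t) ^+ n - g%:R ^+ n + g%:R ^+ n * sg ^+ t).

Lemma sum_groups_le (Q : pred {group W}) (F : {group W} -> K) (b : K) : 0 <= b ->
  (forall H, Q H -> F H <= b) -> \sum_(H | Q H) F H <= #|{group W}|%:R * b.
Proof.
move=> b0 Fb; apply: le_trans (_ : \sum_(H | Q H) b <= _); first exact: ler_sum.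
by rewrite sumr_const -[leLHS]mulr_natl; apply: ler_wpM2r => //; rewrite ler_nat max_card.
Qed.

(** A map into several Lagrangian subgroups is counted once for each of them; its
    popular values then generate less than [g] elements, and such maps are part of
    the error. *)
Lemma sum_wt_lagrangian (D : {pred {ffun 'I_n -> W}}) :
  `|\sum_(u in D) wt u
    - \sum_(H : {group W} | lagrangian H) \sum_(u in D | maps_into u H) ph u|
  <= core_error.
Proof.
have -> : \sum_(H : {group W} | lagrangian H) \sum_(u in D | maps_into u H) ph u =
    \sum_(u in D) lagrangian_part u.
  rewrite /lagrangian_part (exchange_big_dep (mem D)) /=; last by move=> H u _ /andP[].
  apply: eq_bigr => u uD; apply: eq_bigl => H.
  by rewrite [_ \in D]uD.
rewrite -sumrB; apply: le_trans (ler_norm_sum _ _ _) _.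
apply: le_trans (_ : \sum_u pointwise_bound u <= _).
  rewrite big_mkcond; apply: ler_sum => u _.
  by case: ifP => _; [|apply: le_trans (wt_pointwise u)]; rewrite ?wt_pointwise.
rewrite /pointwise_bound !big_split /= sumr_const card_ffun card_ord cardW.
have g1 : 1 <= g%:R :> K by rewrite ler1n g_gt0.
have g34 : 0 <= g%:R - 3 / 4 :> K.
  by rewrite subr_ge0; apply: le_trans g1; rewrite ler_pdivrMr ?ltr0n // mul1r ler_nat.
apply: lerD; first apply: lerD; first by rewrite -[leLHS]mulr_natl natrX.
- rewrite exchange_big /=; apply: sum_groups_le => [|H ltH].
    by rewrite mulr_ge0 ?addr_ge0 // mulr_ge0 ?exprn_ge0.
  by rewrite -mulr_sumr ler_wpM2l ?addr_ge0 // sum_few_outside.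
- rewrite exchange_big /=; apply: sum_groups_le => [|H /eqP cardH].
    rewrite addr_ge0 ?mulr_ge0 ?exprn_ge0 // subr_ge0.
    by apply: lerXn2r; rewrite ?nnegrE ?addr_ge0 ?mulr_ge0 ?exprn_ge0 // lerDl mulr_ge0 ?exprn_ge0.
  exact: sum_outside_weight.
Qed.

End Fixed.
End Core.

(** * Quadratic exponential sums *)

Section ModP.
Variables (p q : nat).
Hypotheses (p_pr : prime p) (q_gt1 : (1 < q)%N) (pq : (p %| q)%N).

(** The projection from [Z/q] to [F_p], for [p] a prime divisor of [q]. *)
Definition zmodp (x : 'Z_q) : 'F_p := (nat_of_ord x)%:R.

Lemma zmodp_nat m : zmodp m%:R = m%:R.
Proof.
rewrite /zmodp val_Zp_nat // [in RHS](divn_eq m q) natrD natrM.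
have -> : q%:R = 0 :> 'F_p by apply/eqP; rewrite -(dvdn_pcharf (pchar_Fp p_pr)).
by rewrite mulr0 add0r.
Qed.

Lemma zmodpD x y : zmodp (x + y) = zmodp x + zmodp y.
Proof. by rewrite -[x in LHS]natr_Zp -[y in LHS]natr_Zp -natrD zmodp_nat natrD. Qed.

Lemma zmodpM x y : zmodp (x * y) = zmodp x * zmodp y.
Proof. by rewrite -[x in LHS]natr_Zp -[y in LHS]natr_Zp -natrM zmodp_nat natrM. Qed.

Lemma zmodp_sum I (r : seq I) P (E : I -> 'Z_q) :
  zmodp (\sum_(i <- r | P i) E i) = \sum_(i <- r | P i) zmodp (E i).
Proof. exact: (big_morph zmodp zmodpD (zmodp_nat 0)). Qed.

(** If [p] did not divide [s], the order of [c], which divides both [p] and [s],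
    would be [1]. *)
Lemma zmodp_annihilator (s c : 'Z_q) :
  c != 0 -> c *+ p = 0 -> s * c = 0 -> zmodp s = 0.
Proof.
move=> c_neq0 pc sc; apply/eqP; rewrite -(dvdn_pcharf (pchar_Fp p_pr)).
apply: contraR c_neq0; rewrite -prime_coprime // => /eqP co.
have h1 : (#[c]%g %| p)%N by rewrite order_dvdn zmodXgE pc.
have h2 : (#[c]%g %| (s : nat))%N.
  by rewrite order_dvdn zmodXgE -mulr_natl natr_Zp sc.
have : (#[c]%g %| 1)%N by rewrite -co dvdn_gcd h1 h2.
by rewrite dvdn1 order_eq1.
Qed.

End ModP.

Section QuadSum.
Variables (q n : nat) (W : finZmodType) (beta : W -> W -> 'Z_q).
Variable (C : 'M['Z_q]_n).
Hypothesis q_gt1 : (1 < q)%N.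
Hypothesis betaDl : forall u u' v, beta (u + u') v = beta u v + beta u' v.
Hypothesis betaDr : forall u v v', beta u (v + v') = beta u v + beta u v'.
Hypothesis C_anti : forall i j, C i j = - C j i.
Hypothesis C_diag : forall i, C i i = 0.
Implicit Types (u v : {ffun 'I_n -> W}) (H : {group W}).

(** The part of the exponent that comes from [C], when an entry below the diagonal
    is written as the transposed entry plus the corresponding entry of [C]. *)
Definition quad u : 'Z_q := \sum_(i : 'I_n) \sum_(j : 'I_n | (j < i)%N) C i j * beta (u i) (u j).

Lemma maps_intoD u v H : maps_into u H -> maps_into (v + u) H = maps_into v H.
Proof.
move=> /forallP uH; apply/forallP/forallP => h i; have := h i; rewrite ffunE.
  by rewrite -zmodMgE groupMr.
by rewrite -zmodMgE groupMr.
Qed.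

Variable (H : {group W}).
Hypothesis isoH : {in H &, forall x y, polar beta x y = 0}.

(** On an isotropic subgroup [beta] is antisymmetric like [C], so the product of
    the two is symmetric and the cross terms add up to a sum over all pairs. *)
Lemma quadD u v : maps_into u H -> maps_into v H ->
  quad (u + v) = quad u + quad v + \sum_i \sum_j C i j * beta (u i) (v j).
Proof.
move=> /forallP uH /forallP vH.
have -> : \sum_i \sum_j C i j * beta (u i) (v j) =
    \sum_(i : 'I_n) \sum_(j : 'I_n | (j < i)%N) C i j * beta (u i) (v j)
    + \sum_(i : 'I_n) \sum_(j : 'I_n | (j < i)%N) C i j * beta (v i) (u j).
  rewrite [X in _ + X](exchange_big_dep xpredT) //= -big_split /=.
  apply: eq_bigr => i _; rewrite (bigID (fun j : 'I_n => (j < i)%N)) /=; congr (_ + _).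
  rewrite (bigD1 i) ?ltnn //= C_diag mul0r add0r.
  apply: eq_big => [j|j _]; first by rewrite -leqNgt ltn_neqAle eq_sym andbC.
  have /eqP : polar beta (u i) (v j) = 0 by apply: isoH.
  by rewrite addr_eq0 C_anti => /eqP ->; rewrite mulrNN.
rewrite /quad -!big_split /=; apply: eq_bigr => i _; rewrite -!big_split /=.
apply: eq_bigr => j _; rewrite !ffunE betaDl !betaDr; ring.
Qed.

Variables (K : numClosedFieldType) (z : K).
Hypothesis prim_z : q.-primitive_root z.

Lemma norm_zpow (a : 'Z_q) : `|zpow z a| = 1.
Proof.
apply/eqP; rewrite -(pexpr_eq1 (ltnW q_gt1)) ?normr_ge0 // -normrX /zpow.
by rewrite exprAC (prim_expr_order prim_z) expr1n normr1.
Qed.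

Lemma conj_zpow (a : 'Z_q) : (zpow z a)^* = zpow z (- a).
Proof. by rewrite zpowN // invC_norm norm_zpow expr1n invr1 mul1r. Qed.

Definition annihilator (h0 : W) :=
  [set v : {ffun 'I_n -> W} | maps_into v H
     & [forall i, \sum_j C i j * beta h0 (v j) == 0]].

(** Weyl differencing: the difference of the quadratic form at [u + v] and [u]
    is additive in [u], so the squared sum is supported on the [v] for which
    this additive map vanishes. *)
Lemma quad_sum_le h0 : h0 \in H ->
  `|\sum_(u | maps_into u H) zpow z (quad u)| ^+ 2
    <= #|H|%:R ^+ n * #|annihilator h0|%:R.
Proof.
move=> h0H; set S := \sum_(_ | _) _.
rewrite normCK -[leLHS]ger0_norm ?mul_conjC_ge0 //.
have -> : S * S^* = \sum_(v | maps_into v H) zpow z (quad v) *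
    \prod_i \sum_(h in H) zpow z (\sum_j C i j * beta h (v j)).
  have SE u : maps_into u H -> S = \sum_(v | maps_into v H) zpow z (quad (v + u)).
    move=> uH; rewrite /S (reindex_inj (addIr u)) /=.
    by apply: eq_bigl => v; rewrite maps_intoD.
  rewrite [in S^*]/S rmorph_sum mulr_sumr.
  under eq_bigr => u uH do rewrite (SE u uH) mulr_suml.
  rewrite exchange_big /=; apply: eq_bigr => v vH.
  rewrite bigA_distr_big mulr_sumr.
  apply: eq_big => [u|u uH].
    by apply/forallP/ffun_onP => h i; have := h i.
  rewrite addrC quadD // conj_zpow -zpowD // -zpow_sum //.
  rewrite -zpowD //; congr (zpow z _); ring.
apply: le_trans (ler_norm_sum _ _ _) _.
rewrite mulr_natr -sumr_const big_mkcond [leRHS]big_mkcond /=; apply: ler_sum => v _.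
rewrite inE; case: ifP => //= vH; rewrite normrM norm_zpow mul1r normr_prod.
have chiD i : {in H &, forall x y, \sum_j C i j * beta (x + y) (v j) =
   \sum_j C i j * beta x (v j) + \sum_j C i j * beta y (v j)}.
  move=> x y _ _; rewrite -big_split /=; apply: eq_bigr => j _.
  by rewrite betaDl mulrDr.
under eq_bigr => i _ do rewrite (char_sum q_gt1 prim_z (chiD i)).
case: ifPn => [_|].
  have -> : #|H|%:R ^+ n = \prod_(i < n) #|H|%:R :> K by rewrite prodr_const card_ord.
  apply: ler_prod => i _.
  by rewrite normr_ge0 /=; case: ifP => _; rewrite ?normr0 ?ger0_norm.
rewrite negb_forall => /existsP[i hi]; rewrite (bigD1 i) //= ifF ?normr0 ?mul0r //.
by apply/negbTE; apply/forall_inPn; exists h0.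
Qed.

End QuadSum.

Section Annihilator.
Variables (p e n : nat) (W : finZmodType) (psi : W -> 'Z_(p ^ e)).
Hypotheses (p_pr : prime p) (q_gt1 : (1 < p ^ e)%N).
Hypothesis psiD : forall x y, psi (x + y) = psi x + psi y.
Variables (C : 'M['Z_(p ^ e)]_n) (H : {group W}) (h1 : W).
Hypotheses (h1H : h1 \in H) (psih1 : psi h1 != 0).

Lemma psiMn x m : psi (x *+ m) = psi x *+ m.
Proof.
elim: m => [|m IH]; last by rewrite !mulrS psiD IH.
by rewrite !mulr0n; apply: (addrI (psi 0)); rewrite -psiD !addr0.
Qed.

(** Replace [h1] by its last multiple by a power of [p] that [psi] does not kill. *)
Lemma exists_order_p : exists2 h2, h2 \in H & psi h2 != 0 /\ psi h2 *+ p = 0.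
Proof.
have ex : exists k, psi h1 *+ (p ^ k) == 0.
  by exists e; rewrite -mulr_natr pchar_Zp // mulr0.
case: (ex_minnP ex) => -[|k] /eqP hk hmin; first by case/eqP: psih1; rewrite -[LHS]mulr1n -(expn0 p).
exists (h1 *+ p ^ k); first by rewrite -zmodXgE groupX.
rewrite psiMn; split; last by rewrite -mulrnA mulnC -expnS.
by apply/negP => /hmin; rewrite ltnn.
Qed.

(** Modulo [p] the linear conditions have the rank of [C]: moving [v] along
    multiples of an element of order [p] in directions on which [C] mod [p] is
    injective gives disjoint translates of the solution set. *)
Lemma card_annihilator_le :
  (#|[set v : {ffun 'I_n -> W} | maps_into v H
       & [forall i, (\sum_j C i j * psi (v j) == 0)%R]]|
   * p ^ \rank (map_mx (@zmodp p (p ^ e)) C) <= #|H| ^ n)%N.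
Proof.
have [h2 h2H [psih2 psih2p]] := exists_order_p.
set Ker := finset _; set Cp := map_mx _ C.
have pq : (p %| p ^ e)%N.
  by move: q_gt1; case: (e) => [|k] //; rewrite ?expn0 // expnS dvdn_mulr.
rewrite -mxrank_tr; set r := \rank _.
have /submxP[D defD] : (row_base Cp^T <= Cp^T)%MS by rewrite eq_row_base.
pose shift (y : 'rV['F_p]_r) : {ffun 'I_n -> W} :=
  [ffun j => h2 *+ ((y *m D) 0 j : nat)].
pose f (vy : {ffun 'I_n -> W} * 'rV['F_p]_r) := vy.1 + shift vy.2.
have card_y : #|[set: 'rV['F_p]_r]| = (p ^ r)%N.
  by rewrite cardsT card_mx mul1n card_Fp.
rewrite -card_y -cardsX.
have inj_f : {in setX Ker [set: 'rV['F_p]_r] &, injective f}.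
  move=> [v y] [v' y']; rewrite !inE /= !andbT.
  move=> /andP[_ /forallP vK] /andP[_ /forallP v'K] /ffunP ff.
  suff yy : y = y'.
    congr (_, _) => //; apply/ffunP => j; have := ff j.
    by rewrite /f /= yy !ffunE; apply: addIr.
  apply: (row_free_inj (row_base_free Cp^T)); rewrite /= defD !mulmxA.
  apply/rowP => i; rewrite !mxE.
  have Ksum (w : {ffun 'I_n -> W}) (x : 'rV['F_p]_r) : \sum_j C i j * psi (w j) == 0 ->
     \sum_j C i j * psi (f (w, x) j) =
     (\sum_j C i j * ((x *m D) 0 j : nat)%:R) * psi h2.
    move=> /eqP w0; transitivity (\sum_j C i j * psi (w j) +
      (\sum_j C i j * ((x *m D) 0 j : nat)%:R) * psi h2); last by rewrite w0 add0r.
    rewrite mulr_suml -big_split /=.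
    apply: eq_bigr => j _; rewrite !ffunE psiD psiMn mulrDr -mulr_natl; ring.
  have : \sum_j C i j * psi (f (v, y) j) = \sum_j C i j * psi (f (v', y') j).
    by apply: eq_bigr => j _; rewrite ff.
  rewrite !Ksum // => /eqP; rewrite -subr_eq0 -mulrBl => /eqP.
  move/(zmodp_annihilator p_pr psih2 psih2p) => h.
  have zmE (x : 'rV['F_p]_r) : zmodp p (\sum_j C i j * ((x *m D) 0 j : nat)%:R) =
     \sum_j (x *m D) 0 j * Cp^T j i.
    rewrite zmodp_sum //; apply: eq_bigr => j _.
    by rewrite zmodpM // zmodp_nat // mulrC !mxE natr_Zp.
  rewrite -!zmE -[X in zmodp p X = _](subrK (\sum_j C i j * ((y' *m D) 0 j : nat)%:R)).
  by rewrite zmodpD // h add0r.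
rewrite -(card_in_imset inj_f) -[n in (_ ^ n)%N]card_ord -card_ffun_on.
apply/subset_leq_card/subsetP => _ /imsetP[[v y] + ->]; rewrite !inE /= andbT => /andP[/forallP vH _].
by apply/ffun_onP => j; rewrite !ffunE -zmodMgE groupM // -zmodXgE groupX.
Qed.

End Annihilator.

(** * Moments of the cokernel of a random matrix *)

Section Moment.
Variables (p e n : nat) (G : finZmodType).
Local Notation q := (p ^ e)%N.
Local Notation g := #|G|.
Local Notation entries := {ffun 'I_n * 'I_n -> 'Z_q}.
Local Notation dual := (zhom G 'Z_q).
Local Notation W := (G * zhom G 'Z_q)%type.
Hypotheses (p_pr : prime p) (q_gt1 : (1 < q)%N).
Hypothesis Gq : forall x : G, x *+ q = 0.

(** The associated quadratic form is the evaluation of characters on [G x G^], and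
    [polar dual_form] is the hyperbolic form. *)
Definition dual_form (u v : W) : 'Z_q := v.2 u.1.

Lemma dual_formDl u u' v : dual_form (u + u') v = dual_form u v + dual_form u' v.
Proof. exact: zhomD. Qed.

Lemma dual_formDr u v v' : dual_form u (v + v') = dual_form u v + dual_form u v'.
Proof. exact: zhom_addE. Qed.

Lemma dual_form_nondeg w : (forall v, polar dual_form w v = 0) -> w = 0.
Proof.
case: w => x xi h; congr (_, _).
  apply: contrapT => /eqP/(zhom_sep q_gt1 Gq)[eta /eqP[]].
  by have := h (0, eta); rewrite /polar /dual_form /= zhom0 addr0.
apply: zhom_eqP => y; have := h (y, 0).
by rewrite /polar /dual_form /= !zhom_zeroE add0r.
Qed.

Lemma card_dual_pair : #|{: W}| = (g ^ 2)%N.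
Proof. by rewrite card_prod card_zhom_dual // mulnn. Qed.

Variable C : 'M['Z_q]_n.
Hypothesis C_anti : forall i j, C i j = - C j i.
Hypothesis C_diag : forall i, C i i = 0.

(** The [C]-symmetric matrix with the entries [Y] on and above the diagonal, when
    [C] is alternating. *)
Definition symm_mx (Y : {ffun 'I_n * 'I_n -> 'Z_q}) : 'M['Z_q]_n :=
  \matrix_(i, j) if (i <= j)%N then Y (i, j) else Y (j, i) + C i j.

(** A family [F] stands for the homomorphism from [(Z/q)^n] to [G] with values [F]
    at the unit vectors; here it vanishes on the columns of [A], so that it factors
    through the cokernel, and under [generates] it is onto. *)
Definition kills (A : 'M['Z_q]_n) (F : {ffun 'I_n -> G}) :=
  [forall j, \sum_i F i *+ (A i j : nat) == 0].

Definition generates (F : {ffun 'I_n -> G}) :=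
  <<[set F i | i : 'I_n]>>%g == [set: G].

Variables (K : numClosedFieldType) (z : K) (mu : 'I_n * 'I_n -> 'Z_q -> K) (sg : K).
Hypothesis prim_z : q.-primitive_root z.
Hypothesis mu_ge0 : forall ij y, 0 <= mu ij y.
Hypothesis mu_sum1 : forall ij, \sum_y mu ij y = 1.
Hypotheses (sg_ge0 : 0 <= sg) (sg_le1 : sg <= 1).
(* The square is there because [bad_pairs] counts ordered pairs: an entry above
   the diagonal accounts for two of them. *)
Hypothesis mu_bal : forall (i j : 'I_n) a, (i <= j)%N -> a != 0 ->
  `|\sum_y mu (i, j) y * zpow z (a * y)| <= sg ^+ 2.

Definition sur_moment : K :=
  \sum_(Y : entries) (\prod_ij mu ij (Y ij)) *
    #|[set F | generates F & kills (symm_mx Y) F]|%:R.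

(** The coefficient of the entry [ij] in the exponent, as in [symm_mx_pairing]. *)
Definition coef (u : {ffun 'I_n -> W}) (ij : 'I_n * 'I_n) : 'Z_q :=
  if (ij.1 < ij.2)%N then polar dual_form (u ij.1) (u ij.2)
  else if ij.1 == ij.2 then dual_form (u ij.1) (u ij.1) else 0.

Definition weight (u : {ffun 'I_n -> W}) : K :=
  zpow z (quad dual_form C u) *
  \prod_ij \sum_y mu ij y * zpow z (coef u ij * y).

Lemma sum_dual (x : G) :
  \sum_(xi : dual) zpow z (xi x) = (x == 0)%:R * g%:R.
Proof.
have h : {in [set: (dual : finZmodType)]%G &, forall xi eta : dual, (xi + eta) x = xi x + eta x}.
  by move=> xi eta _ _; exact: zhom_addE.
rewrite -(card_zhom_dual q_gt1 Gq).
transitivity (\sum_(xi in [set: (dual : finZmodType)]%G) zpow z (xi x)).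
  by apply: eq_bigl => xi; rewrite inE.
rewrite (char_sum q_gt1 prim_z h) cardsT; case: eqP => [->|/eqP x0].
  by rewrite mul1r ifT //; apply/forall_inP => xi _; rewrite zhom0.
rewrite mul0r ifF //; apply/negbTE/forall_inPn.
by have [xi hxi] := zhom_sep q_gt1 Gq x0; exists xi; rewrite ?inE.
Qed.

(** Orthogonality of characters, applied to each column of the matrix. *)
Lemma kills_fourier (A : 'M['Z_q]_n) (F : {ffun 'I_n -> G}) :
  (kills A F)%:R * g%:R ^+ n = \sum_(Xi : {ffun 'I_n -> dual})
     zpow z (\sum_j \sum_i Xi j (F i) * A i j).
Proof.
have -> : (kills A F)%:R * g%:R ^+ n =
    \prod_j \sum_(xi : dual) zpow z (xi (\sum_i F i *+ (A i j : nat))).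
  under eq_bigr => j _ do rewrite sum_dual.
  rewrite big_split /= prodr_const card_ord; congr (_ * _).
  have [/forallP FA|] := boolP (kills A F); first by rewrite big1 // => j _; rewrite FA.
  by rewrite negb_forall => /existsP[j hj]; rewrite (bigD1 j) //= (negPf hj) mul0r.
rewrite bigA_distr_bigA /=; apply: eq_bigr => Xi _; rewrite -zpow_sum //.
congr (zpow z _); apply: eq_bigr => j _; rewrite zhom_sum; apply: eq_bigr => i _.
by rewrite zhomMn -mulr_natr natr_Zp.
Qed.

(** The entries at [(i, j)] and [(j, i)] share the random part, so their
    coefficients add up to the polar form; the rest is due to [C]. *)
Lemma symm_mx_pairing (u : {ffun 'I_n -> W}) Y :
  \sum_j \sum_i dual_form (u i) (u j) * symm_mx Y i j =
  quad dual_form C u + \sum_ij coef u ij * Y ij.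
Proof.
have -> : \sum_ij coef u ij * Y ij = \sum_i \sum_j coef u (i, j) * Y (i, j).
  by rewrite pair_big /=; apply: eq_bigr => -[].
rewrite exchange_big /= /quad.
have -> : \sum_i \sum_j coef u (i, j) * Y (i, j) =
   \sum_(i : 'I_n) \sum_(j : 'I_n | (j < i)%N) dual_form (u i) (u j) * Y (j, i)
   + \sum_(i : 'I_n) \sum_(j : 'I_n | ~~ (j < i)%N) dual_form (u i) (u j) * Y (i, j).
  rewrite [X in X + _](exchange_big_dep xpredT) //= -big_split /=.
  apply: eq_bigr => i _; rewrite (bigID (fun j : 'I_n => (i < j)%N)) /=.
  rewrite [\sum_(j < n | ~~ (j < i)%N) _](bigID (fun j : 'I_n => (i < j)%N)) /=.
  rewrite addrA; congr (_ + _).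
    rewrite [X in _ + X](eq_bigl (fun j : 'I_n => (i < j)%N)) => [|j]; last first.
      by case: (ltngtP i j).
    rewrite -big_split /=; apply: eq_bigr => j ij.
    by rewrite /coef /= ij /polar mulrDl addrC.
  rewrite (bigD1 i) ?ltnn //= [RHS](bigD1 i) ?ltnn //= big1 => [|j]; last first.
    by rewrite /coef /= eq_sym => /andP[/negPf -> /negPf ->]; rewrite mul0r.
  rewrite big1 => [|j]; last first.
    case/andP => /andP[h1 h2] /eqP[]; apply/val_inj => /=.
    by move: h1 h2; case: ltngtP.
  by rewrite /coef /= ltnn eqxx.
rewrite addrA -big_split -big_split /=; apply: eq_bigr => i _.
rewrite (bigID (fun j : 'I_n => (j < i)%N)) /=; congr (_ + _).
  rewrite -big_split /=; apply: eq_bigr => j ji.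
  by rewrite mxE leqNgt ji /= mulrDr addrC [C i j * _]mulrC.
by apply: eq_bigr => j ji; rewrite mxE leqNgt ji.
Qed.

Lemma sum_prob_zpow (u : {ffun 'I_n -> W}) :
  \sum_(Y : entries) (\prod_ij mu ij (Y ij)) *
     zpow z (\sum_j \sum_i dual_form (u i) (u j) * symm_mx Y i j) = weight u.
Proof.
rewrite /weight bigA_distr_bigA mulr_sumr; apply: eq_bigr => Y _ /=.
by rewrite symm_mx_pairing zpowD // big_split /= -zpow_sum // mulrCA.
Qed.

Definition first_comp (u : {ffun 'I_n -> W}) : {ffun 'I_n -> G} := [ffun i => (u i).1].

Lemma sur_moment_fourier :
  sur_moment * g%:R ^+ n = \sum_(u | generates (first_comp u)) weight u.
Proof.
transitivity (\sum_(F | generates F) \sum_(Xi : {ffun 'I_n -> dual})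
   weight [ffun i => (F i, Xi i)]).
  transitivity (\sum_(Y : entries) \sum_(F | generates F) \sum_(Xi : {ffun 'I_n -> dual})
     (\prod_ij mu ij (Y ij)) * zpow z (\sum_j \sum_i Xi j (F i) * symm_mx Y i j)).
    rewrite mulr_suml; apply: eq_bigr => Y _; rewrite -mulrA.
    rewrite (eq_bigr (fun F => (\prod_ij mu ij (Y ij)) *
      ((kills (symm_mx Y) F)%:R * g%:R ^+ n))) => [|F _]; last first.
      by rewrite kills_fourier mulr_sumr.
    rewrite -mulr_sumr -mulr_suml; congr (_ * (_ * _)).
    rewrite -natr_sum; congr _%:R; rewrite -sum1_card.
    rewrite big_mkcond [RHS]big_mkcond /=; apply: eq_bigr => F _.
    by rewrite inE; case: (generates F); case: kills.
  rewrite exchange_big /=; apply: eq_bigr => F _.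
  rewrite exchange_big /=; apply: eq_bigr => Xi _.
  rewrite -sum_prob_zpow; apply: eq_bigr => Y _; congr (_ * zpow z _).
  by apply: eq_bigr => j _; apply: eq_bigr => i _; rewrite !ffunE.
rewrite pair_big_dep /=.
pose h (FX : {ffun 'I_n -> G} * {ffun 'I_n -> dual}) : {ffun 'I_n -> W} :=
  [ffun i => (FX.1 i, FX.2 i)].
pose h' (u : {ffun 'I_n -> W}) := ([ffun i => (u i).1], [ffun i => (u i).2]).
rewrite [RHS](reindex h) /=; last first.
  apply: onW_bij; exists h' => [[F Xi]|u].
    by rewrite /h /h' /=; congr (_, _); apply/ffunP => i; rewrite !ffunE.
  by rewrite /h /h'; apply/ffunP => i; rewrite !ffunE /= -surjective_pairing.
apply: eq_bigl => -[F Xi] /=; rewrite andbT; congr generates.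
by apply/ffunP => i; rewrite !ffunE.
Qed.

Lemma norm_phase (a : 'Z_q) : `|zpow z a| = 1.
Proof. exact: norm_zpow. Qed.

Lemma norm_factor_le1 ij a : `|\sum_y mu ij y * zpow z (a * y)| <= 1.
Proof.
rewrite -(mu_sum1 ij); apply: le_trans (ler_norm_sum _ _ _) _.
by apply: ler_sum => y _; rewrite normrM norm_phase mulr1 ger0_norm.
Qed.

Definition active u := [set ij | coef u ij != 0].

Lemma active_le u ij : ij \in active u -> (ij.1 <= ij.2)%N.
Proof.
rewrite inE /coef; case: ltnP => [/ltnW //|_].
by case: (ij.1 =P ij.2) => [->|_]; rewrite ?leqnn ?eqxx.
Qed.

Lemma norm_weight_le u : `|weight u| <= sg ^+ (2 * #|active u|).
Proof.
rewrite normrM norm_phase mul1r normr_prod exprM -prodr_const.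
rewrite [leRHS]big_mkcond /=; apply: ler_prod => -[i j] _; rewrite normr_ge0 /=.
case: ifPn => [hij|_]; last exact: norm_factor_le1.
by apply: mu_bal; [exact: (active_le hij) | move: hij; rewrite inE].
Qed.

Lemma bad_pairs_active u : (bad_pairs dual_form u <= 2 * #|active u|)%N.
Proof.
pose P := [set ij in active u | (ij.1 < ij.2)%N].
pose sw (ij : 'I_n * 'I_n) := (ij.2, ij.1).
apply: (@leq_trans #|P :|: sw @: P|).
  apply/subset_leq_card/subsetP => -[i j]; rewrite !inE /= => /andP[ij uij].
  have [lt|lt|/val_inj eq] := ltngtP (i : nat) (j : nat).
  - by rewrite /coef /= lt uij.
  - apply/orP; right; apply/imsetP; exists (j, i) => //.
    by rewrite !inE /= /coef /= lt polarC uij.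
  - by rewrite eq eqxx in ij.
have PA : (#|P| <= #|active u|)%N.
  by apply/subset_leq_card/subsetP => ij; rewrite inE => /andP[].
apply: leq_trans (_ : (#|P| + #|sw @: P| <= _)%N); first by rewrite cardsU leq_subr.
by rewrite mul2n -addnn; apply: leq_add => //; apply: leq_trans (leq_imset_card _ _) PA.
Qed.

Lemma bad_diag_active u : (bad_diag dual_form u <= 2 * #|active u|)%N.
Proof.
apply: (@leq_trans #|active u|); last by rewrite leq_pmull.
have inj : injective (fun i : 'I_n => (i, i)) by move=> i j [].
rewrite /bad_diag -(card_imset _ inj); apply/subset_leq_card/subsetP => _ /imsetP[i + ->].
by rewrite !inE /coef /= ltnn eqxx.
Qed.

Lemma weight_pairs u : `|weight u| <= sg ^+ bad_pairs dual_form u.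
Proof.
by apply: le_trans (norm_weight_le u) _; apply: ler_wiXn2l => //; exact: bad_pairs_active.
Qed.

Lemma weight_diag u : `|weight u| <= sg ^+ bad_diag dual_form u.
Proof.
by apply: le_trans (norm_weight_le u) _; apply: ler_wiXn2l => //; exact: bad_diag_active.
Qed.

Lemma weight_phase u : bad_pairs dual_form u = 0%N -> bad_diag dual_form u = 0%N ->
  weight u = zpow z (quad dual_form C u).
Proof.
move=> /eqP; rewrite cards_eq0 => /eqP/setP h1 /eqP; rewrite cards_eq0 => /eqP/setP h2.
rewrite /weight big1 ?mulr1 // => -[i j] _; rewrite -[RHS](mu_sum1 (i, j)).
apply: eq_bigr => y _; suff -> : coef u (i, j) = 0 by rewrite mul0r zpow0 mulr1.
rewrite /coef /=; case: ltnP => [ij|_].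
  have := h1 (i, j); rewrite !inE /= => /negbT; rewrite negb_and negbK.
  by rewrite -val_eqE ltn_eqF //= negbK => /eqP.
case: (i =P j) => // _; have := h2 i; rewrite !inE => /negbT; rewrite negbK; exact/eqP.
Qed.

Local Notation r := (\rank (map_mx (@zmodp p q) C)).
Local Notation phase u := (zpow z (quad dual_form C u)).

(** Differencing at [h0] leaves the linear conditions given by [dual_form h0],
    which is nonzero on [H] because of [h1]. *)
Lemma quad_sum_rank (H : {group (W : finZmodType)}) : isotropic dual_form H -> #|H| = g ->
  (exists h0 h1, [/\ h0 \in H, h1 \in H & dual_form h0 h1 != 0]) ->
  `|\sum_(u | maps_into u H) phase u| <= g%:R ^+ n * 2^-1 ^+ (r./2).
Proof.
move=> /isotropicP isoH cardH [h0 [h1 [h0H h1H h01]]].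
rewrite -(ler_pXn2r (ltn0Sn 1)) ?nnegrE ?mulr_ge0 ?exprn_ge0 ?invr_ge0 //.
have := quad_sum_le q_gt1 dual_formDl dual_formDr C_anti C_diag isoH prim_z h0H.
move/le_trans; apply.
have := card_annihilator_le p_pr q_gt1 (dual_formDr h0) C h1H h01.
rewrite cardH -/(annihilator dual_form C H h0) => hc.
rewrite exprMn [_ ^+ n ^+ 2]expr2 -mulrA; apply: ler_wpM2l; first by rewrite exprn_ge0.
rewrite -exprM exprVn ler_pdivlMr ?exprn_gt0 // -!natrX -natrM ler_nat.
apply: leq_trans hc; rewrite leq_mul2l; apply/orP; right.
apply: (@leq_trans (2 ^ r)); last first.
  by case: (r) => // k; rewrite leq_exp2r // prime_gt1.
by rewrite leq_exp2l // -[leqRHS]odd_double_half -muln2 leq_addl.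
Qed.

Local Notation groupW := {group (W : finZmodType)}.

Lemma fst_group_set : group_set [set u : (W : finZmodType) | u.2 == 0].
Proof.
apply/group_setP; split=> [|u v]; rewrite !inE // => /eqP u0 /eqP v0.
by rewrite -[(u * v)%g.2]/(u.2 + v.2) u0 v0 addr0.
Qed.

Definition fst_group : groupW := Group fst_group_set.

Lemma card_fst_group : #|fst_group| = g.
Proof.
rewrite -cardsT -(card_imset _ (_ : injective (fun x : G => (x, 0 : dual)))); last by move=> x y [].
apply: eq_card => -[x xi]; rewrite inE /=; apply/eqP/imsetP => [->|[y _ [_ ->]] //].
by exists x.
Qed.

Lemma dual_form_fst_group u v : v \in fst_group -> dual_form u v = 0.
Proof. by rewrite inE => /eqP v0; rewrite /dual_form v0 zhom_zeroE. Qed.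

Lemma lagrangian_fst_group : lagrangian g dual_form fst_group.
Proof.
apply/and3P; split; first by rewrite card_fst_group.
  by apply/isotropicP => u v uH vH; rewrite /polar !dual_form_fst_group ?addr0.
by apply/forall_inP => u uH; rewrite dual_form_fst_group.
Qed.

Definition generating : {pred {ffun 'I_n -> W}} := [pred u | generates (first_comp u)].

Definition projects_onto (H : groupW) := [forall x : G, exists u in H, u.1 == x].

Lemma generating_projects u (H : groupW) : u \in generating -> maps_into u H -> projects_onto H.
Proof.
rewrite !inE /generates => /eqP genu /forallP uH; apply/forallP => x.
suff : x \in <<[set first_comp u i | i : 'I_n]>>%g.
  move: x; apply: gen_ind => [|x y /existsP[v /andP[vH /eqP <-]] /existsP[w /andP[wH /eqP <-]]|x].
  - by apply/exists_inP; exists 0; rewrite ?group1.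
  - by apply/exists_inP; exists (v + w); [exact: (groupM vH wH)|exact/eqP].
  - by move=> /imsetP[i _ ->]; apply/exists_inP; exists (u i); rewrite ?uH // ffunE.
by rewrite genu inE.
Qed.

(** A map whose first components do not generate [G] has them in a proper subgroup,
    whose preimage in [H] misses at least one element. *)
Lemma card_non_generating (H : groupW) : projects_onto H -> #|H| = g ->
  (#|[set u | maps_into u H && (u \notin generating)]| <= #|{group G}| * g.-1 ^ n)%N.
Proof.
move=> /forallP projH cardH.
pose part (L : {group G}) := [set u in H | u.1 \in L].
apply: (@leq_trans (\sum_(L : {group G} | L != [set: G] :> {set G})
    \sum_(u : {ffun 'I_n -> W} | maps_into u (part L)) 1)).
  rewrite (exchange_big_dep xpredT) //= -sum1_card big_mkcond /=; apply: leq_sum => u _.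
  rewrite inE; case: ifP => // /andP[/forallP uH ngen].
  rewrite sum1_card; apply/card_gt0P.
  exists <<[set first_comp u i | i : 'I_n]>>%G; rewrite unfold_in /=.
  move: ngen; rewrite inE /generates => ->; apply/forallP => i; rewrite inE uH /=.
  by apply: mem_gen; apply/imsetP; exists i; rewrite ?ffunE.
apply: (@leq_trans (\sum_(L : {group G}) g.-1 ^ n)); last by rewrite sum_nat_const.
rewrite big_mkcond /=; apply: leq_sum => L _; case: ifP => // Lproper.
rewrite sum1_card.
apply: (@leq_trans (#|part L| ^ n)).
  have := @card_ffun_on 'I_n _ (mem (part L)); rewrite card_ord => <-.
  apply/subset_leq_card/subsetP => u.
  by rewrite unfold_in => /forallP h; apply/ffun_onP.
have ltL : (#|part L| < g)%N.
  rewrite -cardH; apply: proper_card; apply/properP; split.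
    by apply/subsetP => u; rewrite inE => /andP[].
  have [x xL] : exists x : G, x \notin L.
    apply/existsP; move: Lproper; rewrite -subTset => /subsetPn[x _ xL].
    by apply/existsP; exists x.
  have /exists_inP[u uH /eqP ux] := projH x.
  by exists u; rewrite // inE ux (negPf xL) andbF.
by case: (n) => // m; rewrite leq_exp2r // -ltnS prednK // -cardsT cardG_gt0.
Qed.

Lemma generating_sum_le (H : groupW) : projects_onto H -> #|H| = g ->
  `|\sum_(u in generating | maps_into u H) phase u - \sum_(u | maps_into u H) phase u|
   <= #|{group G}|%:R * g.-1%:R ^+ n.
Proof.
move=> projH cardH; rewrite [X in _ - X](bigID (mem generating)) /=.
rewrite [X in _ - (X + _)](eq_bigl (fun u => (u \in generating) && maps_into u H)); last by move=> u; rewrite andbC.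
rewrite opprD addNKr normrN; apply: le_trans (ler_norm_sum _ _ _) _.
rewrite (eq_bigr (fun=> 1)) => [|u _]; last exact: norm_phase.
rewrite sumr_const -natrX -natrM ler_nat.
apply: leq_trans (card_non_generating projH cardH).
by apply/subset_leq_card/subsetP => u; rewrite inE.
Qed.

Definition phase_error : K :=
  #|{group G}|%:R * g.-1%:R ^+ n + g%:R ^+ n * 2^-1 ^+ (r./2).

Lemma phase_error_ge0 : 0 <= phase_error.
Proof. by rewrite addr_ge0 ?mulr_ge0 ?exprn_ge0 ?invr_ge0. Qed.

(** If [H] does not project onto [G], it contains no generating map. Otherwise, and
    unless [H] is [G x 0], some element of [H] has a nonzero character as second
    component, and some element of [H] projects to a point where this character
    does not vanish. *)
Lemma lagrangian_phase_le (H : groupW) : lagrangian g dual_form H ->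
  `|\sum_(u in generating | maps_into u H) phase u - (H == fst_group)%:R * g%:R ^+ n|
   <= phase_error.
Proof.
case/and3P=> /eqP cardH isoH _.
have [projH|nproj] := boolP (projects_onto H); last first.
  rewrite big_pred0 => [|u]; last first.
    by apply/andP => -[uD /(generating_projects uD)]; apply/negP.
  case: eqP => [HE|_]; last by rewrite mul0r subrr normr0 phase_error_ge0.
  case/negP: nproj; rewrite HE; apply/forallP => x; apply/exists_inP.
  by exists (x, 0); rewrite ?inE.
have [HE|neqH] := eqVneq H fst_group.
  have -> : 1%:R * g%:R ^+ n = \sum_(u | maps_into u H) phase u.
    rewrite mul1r (eq_bigr (fun=> 1)) => [|u /forallP uH].
      have := @card_ffun_on 'I_n _ (mem H); rewrite card_ord cardH => hc.
      by rewrite sumr_const -natrX -hc; congr _%:R.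
    rewrite /quad big1 ?zpow0 // => i _; rewrite big1 // => j _.
    by rewrite dual_form_fst_group ?mulr0 // -HE; exact: uH.
  apply: le_trans (generating_sum_le projH cardH) _.
  by rewrite lerDl mulr_ge0 ?exprn_ge0 ?invr_ge0.
rewrite mul0r subr0.
rewrite -[X in `|X|](subrK (\sum_(u | maps_into u H) phase u)).
apply: le_trans (ler_normD _ _) _; apply: lerD; first exact: generating_sum_le.
apply: quad_sum_rank => //; apply: contrapT => nex; case/eqP: neqH.
apply/val_inj/eqP; rewrite eqEcard cardH card_fst_group leqnn andbT.
apply/subsetP => -[x xi] hH; rewrite inE /=; apply/eqP/zhom_eqP => y.
have /exists_inP[v vH /eqP vy] := forallP projH y.
apply: contrapT => hne; apply: nex; exists v, (x, xi); split => //.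
by rewrite /dual_form /= vy; apply/eqP => h; apply: hne; rewrite h zhom_zeroE.
Qed.

(** The Lagrangian subgroup [G x 0] gives the main term, all others go into the
    error. *)
Lemma sur_moment_le t : (0 < t)%N ->
  `|sur_moment - 1| * g%:R ^+ n <=
     core_error g (W : finZmodType) n t sg + #|{: groupW}|%:R * phase_error.
Proof.
move=> t_gt0.
have gn0 : 0 <= g%:R ^+ n :> K by exact: exprn_ge0.
rewrite -[X in _ * X](ger0_norm gn0) -normrM mulrBl mul1r sur_moment_fourier.
have hL := lagrangian_fst_group.
have core := sum_wt_lagrangian q_gt1 dual_formDl dual_formDr dual_form_nondeg card_dual_pair t_gt0 sg_ge0 sg_le1 weight_pairs weight_diag weight_phase.
have {}core := core (fun u => eq_ind_r (fun x => x <= 1) (lexx _) (norm_phase _)) generating.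
set M := \sum_(H | lagrangian _ _ _) _ in core.
rewrite -[X in `|X - _|](subrK M) -addrA; apply: le_trans (ler_normD _ _) _.
apply: lerD; first exact: core.
have -> : M - g%:R ^+ n = \sum_(H : groupW | lagrangian g dual_form H)
   (\sum_(u in generating | maps_into u H) phase u - (H == fst_group)%:R * g%:R ^+ n).
  rewrite sumrB; congr (_ - _).
  by rewrite (bigD1 fst_group) //= eqxx mul1r big1 ?addr0 // => H /andP[_ /negPf ->]; rewrite mul0r.
apply: le_trans (ler_norm_sum _ _ _) _; apply: sum_groups_le; first exact: phase_error_ge0.
by move=> H; exact: lagrangian_phase_le.
Qed.

End Moment.

(** * Quotients, kernels and torsion *)

Section Quot.
Variables (A : finZmodType) (I : {group A}).

Definition group_pred : {pred A} := fun x => x \in I.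

Lemma group_pred_zmod : zmod_closed group_pred.
Proof.
split=> [|x y]; rewrite !unfold_in; first exact: group1.
by move=> xI yI; exact: (groupM xI (groupVr yI)).
Qed.

HB.instance Definition _ := GRing.isZmodClosed.Build A group_pred group_pred_zmod.

Definition quot : Type := Quotient.quot group_pred.
HB.instance Definition _ := GRing.Zmodule.copy quot (Quotient.quot group_pred).

Lemma quot_reprK : cancel (fun y : quot => generic_quotient.repr (y : Quotient.quot group_pred))
  (fun x : A => \pi_(Quotient.quot group_pred)%qT x : quot).
Proof. exact: reprK. Qed.

HB.instance Definition _ : isCountable quot := CanIsCountable quot_reprK.
HB.instance Definition _ : isFinite quot := CanIsFinite quot_reprK.

Definition to_quot (x : A) : quot := \pi_(Quotient.quot group_pred)%qT x.

Lemma to_quot_hom : is_hom [ffun x => to_quot x].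
Proof. by apply/is_homP => x y; rewrite !ffunE /to_quot raddfD. Qed.

(** The projection is sealed together with its two characteristic properties, which
    keeps the quotient type from unfolding. *)
Lemma quot_hom_subproof : {h : zhom A quot |
  (forall y, exists x, h x = y) & (forall x, (h x == 0) = (x \in I))}.
Proof.
exists (Zhom to_quot_hom) => [y|x].
  by exists (generic_quotient.repr (y : Quotient.quot group_pred)); rewrite /= ffunE /to_quot reprK.
rewrite -(zhom0 (Zhom to_quot_hom)) /= !ffunE /to_quot.
by have := Quotient.idealrBE group_pred x 0; rewrite subr0 => <-.
Qed.

Definition quot_hom : zhom A quot := s2val quot_hom_subproof.

Lemma quot_hom_surj y : exists x, quot_hom x = y.
Proof. exact: (s2valP quot_hom_subproof). Qed.

Lemma quot_hom_eq0 x : (quot_hom x == 0) = (x \in I).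
Proof. exact: (s2valP' quot_hom_subproof). Qed.

End Quot.

Section Surjections.
Variables (A B : finZmodType).

Definition surs : {set zhom A B} := [set f : zhom A B | [forall b, exists a, f a == b]].

Lemma sursP (f : zhom A B) : reflect (forall b, exists a, f a = b) (f \in surs).
Proof.
rewrite inE; apply: (iffP forallP) => h b.
  by have /existsP[a /eqP] := h b; exists a.
by have [a fa] := h b; apply/existsP; exists a; apply/eqP.
Qed.

Definition hom_kernel (f : zhom A B) : {pred A} := fun x => f x == 0.

Lemma hom_kernel_zmod f : zmod_closed (hom_kernel f).
Proof.
split=> [|x y]; rewrite !unfold_in ?zhom0 // zhomD zhomN.
by move=> /eqP -> /eqP ->; rewrite subrr.
Qed.

HB.instance Definition _ f :=
  GRing.isZmodClosed.Build A (hom_kernel f) (hom_kernel_zmod f).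

(** A type, so that homomorphisms and torsion of the kernel make sense. *)
Record kernel (f : zhom A B) := Kernel { kernel_val : A; _ : kernel_val \in hom_kernel f }.

HB.instance Definition _ f := [isSub for @kernel_val f].
HB.instance Definition _ f := [Finite of kernel f by <:].
HB.instance Definition _ f := [SubChoice_isSubZmodule of kernel f by <:].

Lemma kernelP f (k : kernel f) : f (kernel_val k) = 0.
Proof. by case: k => k /= /eqP. Qed.

Lemma kernel_eqP f (k k' : kernel f) : kernel_val k = kernel_val k' -> k = k'.
Proof. exact: val_inj. Qed.

Lemma kernelD f (k k' : kernel f) :
  kernel_val (k + k') = kernel_val k + kernel_val k'.
Proof. by []. Qed.

Lemma card_kernel f : f \in surs -> (#|B| * #|{: kernel f}| = #|A|)%N.
Proof.
move=> /sursP surf; rewrite -[#|A|]sum1_card (partition_big f xpredT) //=.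
rewrite -sum_nat_const; apply: eq_bigr => b _; have [a fa] := surf b.
rewrite sum1_card -(card_imset _ (_ : injective (fun k : kernel f => a + kernel_val k))); last first.
  by move=> k k' /addrI/kernel_eqP.
apply: eq_card => x; rewrite [RHS]unfold_in /=; apply/imsetP/eqP => [[k _ ->]|fx].
  by rewrite zhomD fa kernelP addr0.
have kx : x - a \in hom_kernel f by rewrite unfold_in zhomD zhomN fx fa subrr.
by exists (Kernel kx); rewrite //= addrC subrK.
Qed.

End Surjections.

Section Torsion.
Variables (p : nat) (A : finZmodType).
Hypothesis p_pr : prime p.

Definition torsion : {set A} := [set x | x *+ p == 0].

Lemma Fp_exp (x : 'F_p) : x *+ p = 0.
Proof.
suff p0 : p%:R = 0 :> 'F_p by rewrite -mulr_natr p0 mulr0.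
by apply/eqP; rewrite -(dvdn_pcharf (pchar_Fp p_pr)).
Qed.

(** A homomorphism to [F_p] factors through [A/pA], whose order is that of its
    dual and also that of the [p]-torsion of [A]. *)
Lemma card_zhom_Fp : #|{: zhom A 'F_p}| = #|torsion|.
Proof.
have gI : group_set [set x *+ p | x : A].
  apply/group_setP; split; first by apply/imsetP; exists 0; rewrite ?mul0rn.
  move=> _ _ /imsetP[x _ ->] /imsetP[y _ ->]; apply/imsetP; exists (x + y) => //.
  by rewrite mulrnDl.
pose I := Group gI.
pose pi := quot_hom I.
have pq : (1 < pdiv p)%N by rewrite pdiv_id ?prime_gt1.
have expQ (y : quot I) : y *+ pdiv p = 0.
  have [x <-] := quot_hom_surj y; rewrite pdiv_id // -zhomMn; apply/eqP.
  by rewrite quot_hom_eq0; apply/imsetP; exists x.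
have cardQ : (#|{: quot I}| * #|I| = #|A|)%N.
  rewrite -[RHS](card_kernel (f := pi)); last by apply/sursP; exact: quot_hom_surj.
  congr (_ * _)%N; rewrite -[RHS](card_imset _ (@kernel_eqP _ _ _)).
  apply: eq_card => x; apply/idP/imsetP => [xI|[k _ ->]].
    have kx : x \in hom_kernel pi by rewrite unfold_in quot_hom_eq0.
    by exists (Kernel kx).
  by rewrite -quot_hom_eq0 kernelP.
have cardT : (#|I| * #|torsion| = #|A|)%N.
  rewrite -[#|A|]sum1_card (partition_big (fun x : A => x *+ p) (mem I)) /=; last first.
    by move=> x _; apply/imsetP; exists x.
  rewrite -sum_nat_const; apply: eq_bigr => _ /imsetP[a _ ->].
  rewrite sum1_card -[LHS](card_imset _ (addrI a)); apply: eq_card => x.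
  transitivity (x *+ p == a *+ p); last by [].
  apply/imsetP/eqP => [[k + ->]|hx].
    by rewrite inE mulrnDl => /eqP ->; rewrite addr0.
  by exists (x - a); rewrite ?inE ?mulrnBl ?hx ?subrr // addrC subrK.
have I_gt0 : (0 < #|I|)%N by exact: cardG_gt0.
apply/eqP; rewrite -(eqn_pmul2l I_gt0) cardT -cardQ mulnC eqn_pmul2r //.
rewrite -(card_zhom_dual pq expQ); apply/eqP.
pose h (f : zhom (quot I) 'F_p) : {ffun A -> 'F_p} := [ffun x => f (pi x)].
have hP f : is_hom (h f) by apply/is_homP => x y; rewrite !ffunE !zhomD.
rewrite -[RHS](card_imset _ (_ : injective (fun f => Zhom (hP f)))); last first.
  move=> f f' /(congr1 (@zhom_fun _ _)) /= /ffunP ff; apply: zhom_eqP => y.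
  by have [x <-] := quot_hom_surj y; have := ff x; rewrite !ffunE.
apply: eq_card => f; rewrite [LHS]inE; apply: esym; apply/imsetP.
have fI x : pi x = 0 -> f x = 0.
  move/eqP; rewrite quot_hom_eq0 => /imsetP[y _ ->].
  by rewrite zhomMn Fp_exp.
pose s (y : quot I) : A := odflt 0 [pick x | pi x == y].
have sK y : pi (s y) = y.
  rewrite /s; case: pickP => [x /eqP //|nx]; have [x xy] := quot_hom_surj y.
  by have := nx x; rewrite xy eqxx.
have fs x y : pi x = pi y -> f x = f y.
  move=> xy; apply/eqP; rewrite -subr_eq0 -zhomN -zhomD; apply/eqP/fI.
  by rewrite zhomD zhomN xy subrr.
have gP : is_hom [ffun y => f (s y)].
  apply/is_homP => y y'; rewrite !ffunE -zhomD; apply: fs.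
  by rewrite zhomD !sK.
exists (Zhom gP) => //; apply: zhom_eqP => x /=; rewrite !ffunE; apply: fs.
by rewrite sK.
Qed.

End Torsion.

(** * Surjections to elementary abelian groups *)

Section Products.
Variables (K E E' : finZmodType).

Lemma pair_hom_proof (f : zhom K E) (f' : zhom K E') :
  is_hom [ffun x => (f x, f' x)].
Proof. by apply/is_homP => x y; rewrite !ffunE !zhomD. Qed.

Definition pair_hom f f' : zhom K (E * E')%type := Zhom (pair_hom_proof f f').

Lemma pair_homE f f' x : pair_hom f f' x = (f x, f' x).
Proof. by rewrite /= ffunE. Qed.

Lemma fst_hom_proof (h : zhom K (E * E')%type) : is_hom [ffun x => (h x).1].
Proof. by apply/is_homP => x y; rewrite !ffunE zhomD. Qed.
Lemma snd_hom_proof (h : zhom K (E * E')%type) : is_hom [ffun x => (h x).2].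
Proof. by apply/is_homP => x y; rewrite !ffunE zhomD. Qed.

Lemma pair_hom_bij : bijective (fun ff => pair_hom ff.1 ff.2).
Proof.
exists (fun h => (Zhom (fst_hom_proof h), Zhom (snd_hom_proof h))) => [[f f']|h].
  by congr (_, _); apply: zhom_eqP => x; rewrite /= !ffunE.
by apply: zhom_eqP => x; rewrite pair_homE /= !ffunE -surjective_pairing.
Qed.

Lemma card_zhom_prod :
  #|{: zhom K (E * E')%type}| = (#|{: zhom K E}| * #|{: zhom K E'}|)%N.
Proof. by rewrite -card_prod (bij_eq_card pair_hom_bij). Qed.

End Products.

Section SurjProduct.
Variables (p : nat) (K E : finZmodType).
Hypothesis p_pr : prime p.

Definition factors (f : zhom K E) (l : zhom K 'F_p) :=
  [exists m : zhom E 'F_p, [forall x, l x == m (f x)]].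

Lemma pair_hom_surj (f : zhom K E) (l : zhom K 'F_p) :
  (pair_hom f l \in surs K (E * 'F_p)%type) = (f \in surs K E) && ~~ factors f l.
Proof.
apply/sursP/andP => [surfl|[/sursP surf nfac]].
  split; first by apply/sursP => e; have [a] := surfl (e, 0); rewrite pair_homE => -[<- _]; exists a.
  apply/negP => /existsP[m /forallP lm]; have [a] := surfl (0, 1).
  rewrite pair_homE => -[fa la]; move: (lm a); rewrite fa la zhom0.
  by rewrite oner_eq0.
have [k fk lk] : exists2 k, f k = 0 & l k != 0.
  apply: contrapT => nk; case/negP: nfac.
  have lk k : f k = 0 -> l k = 0.
    by move=> fk; apply: contrapT => /eqP lk; apply: nk; exists k.
  pose s e := odflt 0 [pick x | f x == e].
  have sK e : f (s e) = e.
    rewrite /s; case: pickP => [x /eqP //|nx]; have [x xy] := surf e.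
    by have := nx x; rewrite xy eqxx.
  have ls x y : f x = f y -> l x = l y.
    move=> xy; apply/eqP; rewrite -subr_eq0 -zhomN -zhomD; apply/eqP/lk.
    by rewrite zhomD zhomN xy subrr.
  have mP : is_hom [ffun e => l (s e)].
    by apply/is_homP => e e'; rewrite !ffunE -zhomD; apply: ls; rewrite zhomD !sK.
  apply/existsP; exists (Zhom mP); apply/forallP => x; rewrite /= ffunE; apply/eqP.
  by apply: ls; rewrite sK.
move=> [e c]; have [a fa] := surf e.
exists (a + k *+ ((c - l a) / l k : 'F_p)); rewrite pair_homE !zhomD !zhomMn fk mul0rn addr0 fa.
congr (_, _); rewrite -mulr_natr natr_Zp mulrC divfK //.
by rewrite addrC subrK.
Qed.

(** A surjection to [E * F_p] is a surjection to [E] with a functional that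
    does not factor through it. *)
Lemma card_surs_prod :
  #|surs K (E * 'F_p)%type| =
  (#|surs K E| * (#|{: zhom K 'F_p}| - #|{: zhom E 'F_p}|))%N.
Proof.
rewrite -(on_card_preimset (f := fun fl => pair_hom fl.1 fl.2)); last first.
  by apply: onW_bij; exact: pair_hom_bij.
rewrite -sum1_card (eq_bigl (fun fl : zhom K E * zhom K 'F_p => (fl.1 \in surs K E) && ~~ factors fl.1 fl.2)); last first.
  by move=> [f l]; rewrite inE pair_hom_surj.
rewrite -(pair_big_dep (fun f => f \in surs K E) (fun f l => ~~ factors f l) (fun _ _ => 1%N)) /=.
rewrite -sum_nat_const; apply: eq_bigr => f /sursP surf.
rewrite sum1_card.
have -> : #|{: zhom E 'F_p}| = #|[set l | factors f l]|.
  have compP (m : zhom E 'F_p) : is_hom [ffun x => m (f x)].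
    by apply/is_homP => x y; rewrite !ffunE !zhomD.
  have inj : injective (fun m => Zhom (compP m)).
    move=> m m' /(congr1 (@zhom_fun _ _)) /= /ffunP mm; apply: zhom_eqP => e.
    by have [x <-] := surf e; have := mm x; rewrite !ffunE.
  rewrite -(card_imset _ inj); apply: eq_card => l; rewrite [RHS]inE.
  apply/imsetP/existsP => [[m _ ->]|[m /forallP lm]]; exists m => //.
    by apply/forallP => x; rewrite /= ffunE.
  by apply: zhom_eqP => x; rewrite /= ffunE; apply/eqP.
rewrite -(cardsC [set l | factors f l]) addKn; apply: eq_card => l.
by rewrite !inE.
Qed.

End SurjProduct.

(** The group [F_p^j], built one factor at a time to match [card_surs_prod]. *)
Fixpoint elem (p j : nat) : finZmodType :=
  if j is j'.+1 then (elem p j' * 'F_p)%type : finZmodType else 'I_1.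

Section Elem.
Variables (p : nat) (K : finZmodType).
Hypothesis p_pr : prime p.

Lemma card_elem j : #|elem p j| = (p ^ j)%N.
Proof. by elim: j => [|j IH] /=; rewrite ?card_ord // card_prod IH card_Fp // expnSr. Qed.

Lemma elem_exp j (x : elem p j) : x *+ p = 0.
Proof.
elim: j x => [|j IH] x /=; first by apply/val_inj; rewrite !ord1.
case: x => x c; have MnE m : (x, c) *+ m = (x *+ m, c *+ m).
  by elim: m => [|m IHm]; rewrite ?mulr0n // !mulrS IHm.
by rewrite MnE IH Fp_exp.
Qed.

Lemma card_zhom_elem j : #|{: zhom K (elem p j)}| = (#|{: zhom K 'F_p}| ^ j)%N.
Proof.
elim: j => [|j IH] /=; last by rewrite card_zhom_prod IH expnSr.
rewrite expn0; apply/eqP/fintype1P; exists 0 => f; apply: zhom_eqP => x.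
by rewrite [LHS]ord1 [RHS]ord1.
Qed.

Lemma card_elem_zhom j : #|{: zhom (elem p j) 'F_p}| = (p ^ j)%N.
Proof.
rewrite (card_zhom_dual (q := pdiv p)) ?card_elem // ?pdiv_id ?prime_gt1 //.
exact: elem_exp.
Qed.

Lemma card_surs_elem j : #|surs K (elem p j)| =
  (\prod_(i < j) (#|{: zhom K 'F_p}| - p ^ i))%N.
Proof.
elim: j => [|j IH] /=; last by rewrite card_surs_prod // IH card_elem_zhom big_ord_recr.
rewrite big_ord0; apply/eqP; rewrite (@eq_card1 _ 0) // => f; rewrite !inE.
have -> : f = 0 by apply: zhom_eqP => x; rewrite [LHS]ord1 [RHS]ord1.
by rewrite eqxx; apply/forallP => b; apply/existsP; exists 0; rewrite [b]ord1 zhom0.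
Qed.

End Elem.

(** * Extensions by cocycles *)

Section Cocycles.
Variables (G E : finZmodType).

(** Normalized symmetric 2-cocycles: those for which the twisted addition below is
    commutative with neutral element [(0, 0)]. *)
Definition is_cocycle (f : {ffun G * G -> E}) :=
  [&& [forall x, f (0, x) == 0],
      [forall x, forall y, f (x, y) == f (y, x)] &
      [forall x, forall y, forall z,
         f (x, y) + f (x + y, z) == f (y, z) + f (x, y + z)]].

Lemma is_cocycleP (f : {ffun G * G -> E}) :
  reflect [/\ forall x, f (0, x) = 0, forall x y, f (x, y) = f (y, x) &
    forall x y z, f (x, y) + f (x + y, z) = f (y, z) + f (x, y + z)]
  (is_cocycle f).
Proof.
apply: (iffP and3P) => [] [h1 h2 h3]; split.
- by move=> x; apply/eqP/(forallP h1).
- by move=> x y; apply/eqP; have /forallP := forallP h2 x; apply.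
- by move=> x y z; apply/eqP; have /forallP/(_ y)/forallP := forallP h3 x; apply.
- by apply/forallP => x; apply/eqP.
- by apply/forallP => x; apply/forallP => y; apply/eqP.
- by apply/forallP => x; apply/forallP => y; apply/forallP => z; apply/eqP.
Qed.

Record cocycle := Cocycle {
  cocycle_fun :> {ffun G * G -> E};
  cocycleP : is_cocycle cocycle_fun }.

HB.instance Definition _ := [isSub for cocycle_fun].
HB.instance Definition _ := [Finite of cocycle by <:].

(** A copy of the product, to carry the addition twisted by the cocycle. *)
Definition ext of cocycle : Type := (G * E)%type.
HB.instance Definition _ f := Finite.copy (ext f) (G * E)%type.

Section Ext.
Variable f : cocycle.

Let f0x x : f (0, x) = 0. Proof. by have [] := is_cocycleP _ (cocycleP f). Qed.
Let fC x y : f (x, y) = f (y, x). Proof. by have [] := is_cocycleP _ (cocycleP f). Qed.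
Let fA x y z : f (x, y) + f (x + y, z) = f (y, z) + f (x, y + z).
Proof. by have [] := is_cocycleP _ (cocycleP f). Qed.

Local Notation ext := (ext f).

Definition ext_add (u v : ext) : ext := (u.1 + v.1, u.2 + v.2 + f (u.1, v.1)).
Definition ext_opp (u : ext) : ext := (- u.1, - u.2 - f (u.1, - u.1)).

Lemma ext_addA : associative ext_add.
Proof.
move=> [x a] [y b] [w c]; rewrite /ext_add /=; congr (_, _); first exact: addrA.
by rewrite !addrA [a + b + f (x, y) + c]addrAC -!addrA -fA.
Qed.

Lemma ext_addC : commutative ext_add.
Proof.
move=> [x a] [y b]; rewrite /ext_add /=; congr (_, _); first exact: addrC.
by rewrite [a + b]addrC fC.
Qed.

Lemma ext_add0 : left_id (0, 0) ext_add.
Proof. by move=> [x a]; rewrite /ext_add /= !add0r f0x addr0. Qed.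

Lemma ext_addN : left_inverse (0, 0) ext_opp ext_add.
Proof.
move=> [x a]; rewrite /ext_add /ext_opp /= addNr; congr (_, _).
by rewrite [f (- x, x)]fC addrAC subrK addNr.
Qed.

HB.instance Definition _ := GRing.isZmodule.Build ext
  ext_addA ext_addC ext_add0 ext_addN.

Lemma ext_addE (u v : ext) : u + v = (u.1 + v.1, u.2 + v.2 + f (u.1, v.1)).
Proof. by []. Qed.

Lemma ext_exp k m : (forall x : G, x *+ k = 0) -> (forall a : E, a *+ m = 0) ->
  forall u : ext, u *+ (k * m) = 0.
Proof.
move=> Gk Em u; rewrite mulrnA.
have fstE n (v : ext) : (v *+ n).1 = v.1 *+ n.
  by elim: n => [|n IH]; rewrite ?mulr0n // !mulrS ext_addE /= IH.
have : (u *+ k).1 = 0 by rewrite fstE Gk.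
case: (u *+ k) => x a /= ->.
have -> n : ((0, a) : ext) *+ n = (0, a *+ n).
  by elim: n => [|n IH]; rewrite ?mulr0n // !mulrS ext_addE IH /= addr0 f0x addr0.
by rewrite Em.
Qed.

End Ext.

Section Lifts.
Variables (A : finZmodType).
Implicit Types (f : cocycle) (phi : zhom A G) (theta : {ffun A -> E}).

(** The maps [theta] for which the pair of [phi] and [theta] is a homomorphism to the
    extension. *)
Definition is_lift f phi theta :=
  [forall a, forall b, theta (a + b) == theta a + theta b + f (phi a, phi b)].

Lemma is_liftP f phi theta :
  reflect (forall a b, theta (a + b) = theta a + theta b + f (phi a, phi b))
    (is_lift f phi theta).
Proof.
apply: (iffP forallP) => [h a b|h a]; last by apply/forallP=> b; apply/eqP.
by have /forallP/(_ b)/eqP := h a.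
Qed.

Definition semi_additive phi theta :=
  [forall a, forall k, (phi k == 0) ==> (theta (a + k) == theta a + theta k)].

Lemma semi_additiveP phi theta :
  reflect (forall a k, phi k = 0 -> theta (a + k) = theta a + theta k)
    (semi_additive phi theta).
Proof.
apply: (iffP forallP) => [h a k fk|h a].
  by have /forallP/(_ k)/implyP := h a; rewrite fk eqxx => /(_ isT)/eqP.
by apply/forallP => k; apply/implyP => /eqP fk; rewrite h.
Qed.

Definition surj_on_kernel phi theta :=
  [forall e, exists k, (phi k == 0) && (theta k == e)].

Lemma surj_section phi : phi \in surs A G -> exists2 s : G -> A,
  s 0 = 0 & forall x, phi (s x) = x.
Proof.
move=> /sursP surphi.
exists (fun x => if x == 0 then 0 else odflt 0 [pick a | phi a == x]).
  by rewrite eqxx.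
move=> x; case: eqP => [->|_]; first exact: zhom0.
case: pickP => [a /eqP //|na]; have [a ax] := surphi x.
by have := na a; rewrite ax eqxx.
Qed.

(** The coboundary of [theta] descends to [G], and then is a cocycle, exactly
    when [theta] is additive along the kernel of [phi]. *)
Lemma semi_additive_cocycle phi theta : phi \in surs A G ->
  semi_additive phi theta -> exists f, is_lift f phi theta.
Proof.
move=> surphi /semi_additiveP semi; have [s s0 sK] := surj_section surphi.
have theta0 : theta 0 = 0.
  by apply: (addrI (theta 0)); rewrite -semi ?zhom0 ?addr0.
pose df a b := theta (a + b) - (theta a + theta b).
have dfk a b k : phi k = 0 -> df (a + k) b = df a b.
  move=> phik; have ake : a + k + b = a + b + k by rewrite addrAC.
  by rewrite /df ake (semi _ k phik) (semi a k phik) [theta a + theta k + _]addrAC opprD addrACA subrr addr0.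
have dfC a b : df a b = df b a by rewrite /df [a + b]addrC [theta a + _]addrC.
have dfE a b a' b' : phi a = phi a' -> phi b = phi b' -> df a b = df a' b'.
  move=> aa bb; rewrite -(subrK a' a) addrC dfk; last by rewrite zhomD zhomN aa subrr.
  by rewrite dfC -(subrK b' b) addrC dfk ?(dfC a') // zhomD zhomN bb subrr.
pose f := [ffun xy : G * G => df (s xy.1) (s xy.2)].
have fE a b : f (phi a, phi b) = df a b by rewrite ffunE; apply: dfE; rewrite sK.
have cocf : is_cocycle f.
  apply/is_cocycleP; split=> [x|x y|x y w].
  - by rewrite ffunE /= s0 /df add0r theta0 add0r subrr.
  - by rewrite !ffunE dfC.
  - have tele (X Y u v : E) : X - u + (Y - (X + v)) = Y - (u + v).
      by rewrite addrC [X + v]addrC opprD [Y + _]addrA subrKA -addrA -opprD [v + u]addrC.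
    rewrite -(sK x) -(sK y) -(sK w) -!zhomD !fE /df tele.
    rewrite [theta (s x) + theta (_ + _)]addrC tele addrA.
    by rewrite [theta (s y) + theta (s w) + _]addrC addrA.
exists (Cocycle cocf); apply/is_liftP => a b /=.
by rewrite fE /df [RHS]addrC subrK.
Qed.

Lemma lift_inj phi theta (f f' : cocycle) : phi \in surs A G ->
  is_lift f phi theta -> is_lift f' phi theta -> f = f'.
Proof.
move=> /sursP surphi /is_liftP lf /is_liftP lf'; apply/val_inj/ffunP => -[x y] /=.
have [a <-] := surphi x; have [b <-] := surphi y.
by apply: (addrI (theta a + theta b)); rewrite -lf -lf'.
Qed.

Lemma lift_semi_additive f phi theta : is_lift f phi theta -> semi_additive phi theta.
Proof.
move=> /is_liftP lf; apply/semi_additiveP => a k phik; rewrite lf phik.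
by have [h1 h2 _] := is_cocycleP _ (cocycleP f); rewrite h2 h1 addr0.
Qed.

(** A map that is additive along the kernel of [phi] is a lift for exactly one
    cocycle. *)
Lemma sum_card_lifts phi (Q : pred {ffun A -> E}) : phi \in surs A G ->
  (\sum_(f : cocycle) #|[set theta | is_lift f phi theta && Q theta]| =
   #|[set theta | semi_additive phi theta && Q theta]|)%N.
Proof.
move=> surphi; under eq_bigr => f _ do rewrite -sum1_card.
rewrite -sum1_card (exchange_big_dep (mem [set theta | semi_additive phi theta && Q theta])) /=; last first.
  by move=> f theta _; rewrite !inE => /andP[/lift_semi_additive -> ->].
apply: eq_bigr => theta; rewrite inE => /andP[semi Qtheta].
have [f lf] := semi_additive_cocycle surphi semi.
rewrite (big_pred1 f) // => f'; rewrite inE Qtheta andbT /=.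
by apply/idP/eqP => [lf'|-> //]; exact: lift_inj surphi lf' lf.
Qed.

Lemma ext_fst_proof f (h : zhom A (ext f)) : is_hom [ffun a => (h a).1].
Proof. by apply/is_homP => a b; rewrite !ffunE zhomD ext_addE. Qed.

Definition ext_fst f (h : zhom A (ext f)) : zhom A G := Zhom (ext_fst_proof h).
Definition ext_snd f (h : zhom A (ext f)) : {ffun A -> E} := [ffun a => (h a).2].

Lemma ext_fstE f (h : zhom A (ext f)) a : ext_fst h a = (h a).1.
Proof. by rewrite /= ffunE. Qed.

Lemma ext_snd_lift f (h : zhom A (ext f)) : is_lift f (ext_fst h) (ext_snd h).
Proof. by apply/is_liftP => a b; rewrite !ext_fstE !ffunE zhomD ext_addE. Qed.

Lemma lift_hom f phi theta : is_lift f phi theta ->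
  exists2 h : zhom A (ext f), ext_fst h = phi & ext_snd h = theta.
Proof.
move=> /is_liftP lf.
have hP : is_hom ([ffun a => (phi a, theta a)] : {ffun A -> ext f}).
  by apply/is_homP => a b; rewrite !ffunE ext_addE /= zhomD lf.
exists (Zhom hP); first by apply: zhom_eqP => a; rewrite ext_fstE /= ffunE.
by apply/ffunP => a; rewrite [LHS]ffunE /= ffunE.
Qed.

Lemma ext_hom_inj f (h h' : zhom A (ext f)) :
  ext_fst h = ext_fst h' -> ext_snd h = ext_snd h' -> h = h'.
Proof.
move=> h1 h2; apply: zhom_eqP => a.
rewrite [LHS]surjective_pairing [RHS]surjective_pairing -!ext_fstE h1.
by have /ffunP/(_ a) := h2; rewrite !ffunE => ->.
Qed.

Lemma card_lifts f phi : #|[set theta | is_lift f phi theta]| =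
  #|[set h : zhom A (ext f) | ext_fst h == phi]|.
Proof.
rewrite -[RHS](card_in_imset (f := @ext_snd f)) => [|h h']; last first.
  by rewrite !inE => /eqP h1 /eqP h2; apply: ext_hom_inj; rewrite h1 h2.
apply: eq_card => theta; apply/idP/imsetP => [|[h + ->]]; rewrite !inE.
  by move=> /lift_hom[h h1 h2]; exists h; rewrite ?inE ?h1 ?h2.
by move=> /eqP <-; exact: ext_snd_lift.
Qed.

(** Onto: lift the first component to [A], then correct the second one by an
    element of the kernel. *)
Lemma ext_surj f (h : zhom A (ext f)) :
  (h \in surs A (ext f)) = (ext_fst h \in surs A G) &&
    surj_on_kernel (ext_fst h) (ext_snd h).
Proof.
have /semi_additiveP semi := lift_semi_additive (ext_snd_lift h).
apply/sursP/andP => [surh|[/sursP sur1 /forallP sur2] [x e]].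
  split; first by apply/sursP => x; have [a ha] := surh (x, 0); exists a; rewrite ext_fstE ha.
  apply/forallP => e; have [a ha] := surh (0, e); apply/existsP; exists a.
  by rewrite ext_fstE ffunE ha !eqxx.
have [a ax] := sur1 x; have /existsP[k /andP[/eqP k0 /eqP ke]] := sur2 (e - ext_snd h a).
exists (a + k); rewrite [LHS]surjective_pairing -ext_fstE zhomD ax k0 addr0.
congr (_, _); have := semi a k k0; rewrite ke [RHS]addrC subrK => <-.
by rewrite ffunE.
Qed.

Lemma card_surs_ext f : #|surs A (ext f)| =
  (\sum_(phi in surs A G)
    #|[set theta | is_lift f phi theta && surj_on_kernel phi theta]|)%N.
Proof.
rewrite -sum1_card (partition_big (@ext_fst f) (mem (surs A G))) /=; last first.
  by move=> h; rewrite ext_surj => /andP[].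
apply: eq_bigr => phi surphi; rewrite sum1_card.
rewrite -(card_in_imset (f := @ext_snd f)) => [|h h']; last first.
  move=> /andP[_ /eqP h1] /andP[_ /eqP h2]; apply: ext_hom_inj.
  by rewrite h1 h2.
apply: eq_card => theta; apply/imsetP/idP => [[h /andP[surh /eqP hphi] ->]|].
  by rewrite inE -hphi ext_snd_lift; move: surh; rewrite ext_surj => /andP[].
rewrite inE => /andP[/lift_hom[h h1 h2] surk]; exists h => //.
by apply/andP; rewrite ext_surj h1 h2 surk eqxx andbT.
Qed.

(** A map additive along the kernel of [phi] amounts to a homomorphism on the
    kernel and the values at representatives of the nonzero elements of [G]. *)
Lemma card_semi_additive phi (Q : pred {ffun A -> E}) (Q' : {set zhom (kernel phi) E}) :
  phi \in surs A G ->
  (forall theta (l : zhom (kernel phi) E), semi_additive phi theta ->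
    (forall k, theta (kernel_val k) = l k) -> Q theta = (l \in Q')) ->
  #|[set theta | semi_additive phi theta && Q theta]| = (#|Q'| * #|E| ^ #|G|.-1)%N.
Proof.
move=> surphi QQ'; have [s s0 sK] := surj_section surphi.
pose res a : kernel phi := insubd 0 (a - s (phi a)).
have resE a : kernel_val (res a) = a - s (phi a).
  by rewrite /res val_insubd ifT // unfold_in zhomD zhomN sK subrr.
pose c' (c : {ffun {x : G | x != 0} -> E}) (x : G) := if insub x is Some y then c y else 0.
pose Psi (lc : zhom (kernel phi) E * {ffun {x : G | x != 0} -> E}) : {ffun A -> E} :=
  [ffun a => lc.1 (res a) + c' lc.2 (phi a)].
have c'0 c : c' c 0 = 0 by rewrite /c'; case: insubP => // u; rewrite eqxx.
have res_kernel k : res (kernel_val k) = k.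
  by apply: kernel_eqP; rewrite resE kernelP s0 subr0.
have res_s x : res (s x) = 0 by apply: kernel_eqP; rewrite resE sK subrr.
have Psi_k lc k : Psi lc (kernel_val k) = lc.1 k.
  by rewrite ffunE res_kernel kernelP c'0 addr0.
have Psi_s lc x : Psi lc (s x) = c' lc.2 x by rewrite ffunE res_s zhom0 add0r sK.
have Psi_semi lc : semi_additive phi (Psi lc).
  apply/semi_additiveP => a k phik.
  have kk : k \in hom_kernel phi by rewrite unfold_in phik.
  rewrite -[k]/(kernel_val (Kernel kk)) Psi_k !ffunE zhomD kernelP addr0 addrAC.
  congr (_ + _); rewrite -zhomD; congr (lc.1 _); apply: kernel_eqP.
  by rewrite kernelD !resE zhomD kernelP addr0 addrAC.
have Psi_inj : injective Psi.
  move=> [l c] [l' c'1] /ffunP ee; congr (_, _).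
    by apply: zhom_eqP => k; have := ee (kernel_val k); rewrite !Psi_k.
  apply/ffunP => x; have := ee (s (val x)); rewrite !Psi_s /c' /=.
  by rewrite !valK.
have -> : (#|E| ^ #|G|.-1)%N = #|{: {ffun {x : G | (x != 0)%R} -> E}}|.
  by rewrite card_ffun card_sig; congr (_ ^ _)%N; rewrite -(cardC1 (0 : G)); apply: eq_card.
rewrite -cardsT -cardsX -(card_imset _ Psi_inj); apply: eq_card => theta.
apply/idP/imsetP => [|[[l c] + ->]]; rewrite !inE; last first.
  by rewrite andbT Psi_semi /= => lQ; rewrite (QQ' _ l) // => k; rewrite Psi_k.
move=> /andP[semi Qt]; have /semi_additiveP semi' := semi.
have lP : is_hom [ffun k : kernel phi => theta (kernel_val k)].
  by apply/is_homP => k k'; rewrite !ffunE kernelD semi' // kernelP.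
exists (Zhom lP, [ffun x => theta (s (val x))]).
  rewrite !inE andbT /= -(QQ' theta) // => k; by rewrite /= ffunE.
apply/ffunP => a; rewrite ffunE /= ffunE resE /c'.
have -> : (if insub (phi a) is Some y then [ffun x : {x : G | x != 0} => theta (s (val x))] y else 0) = theta (s (phi a)).
  case: insubP => [y _ <-|]; first by rewrite ffunE.
  rewrite negbK => /eqP ->; rewrite s0; apply: (addrI (theta 0)).
  by rewrite -semi' ?zhom0 // !addr0.
rewrite addrC -semi'; last by rewrite zhomD zhomN sK subrr.
by rewrite addrC subrK.
Qed.

End Lifts.
End Cocycles.

(** * Counting cocycles *)

Section Free.
Variables (q : nat) (I : finType) (M : finZmodType).
Hypotheses (q_gt1 : (1 < q)%N) (Mq : forall x : M, x *+ q = 0).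
Local Notation V := {ffun I -> 'Z_q}.

Lemma mulrn_Zp (x : M) (a : nat) : x *+ ((a%:R : 'Z_q) : nat) = x *+ a.
Proof.
by rewrite val_Zp_nat // [in RHS](divn_eq a q) mulrnDr mulnC mulrnA Mq mul0rn add0r.
Qed.

Lemma free_hom_proof (m : {ffun I -> M}) :
  is_hom [ffun v : V => \sum_i m i *+ (v i : nat)].
Proof.
apply/is_homP => v w; rewrite !ffunE -big_split /=; apply: eq_bigr => i _.
by rewrite ffunE -[v i]natr_Zp -[w i]natr_Zp -natrD !mulrn_Zp mulrnDr.
Qed.

Definition free_hom (m : {ffun I -> M}) : zhom V M := Zhom (free_hom_proof m).

Definition unit_vec (i : I) : V := [ffun j => (j == i)%:R].

Lemma free_hom_unit m i : free_hom m (unit_vec i) = m i.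
Proof.
rewrite /= ffunE (bigD1 i) //= ffunE eqxx big1 ?addr0 => [|j /negPf ji].
  by rewrite -{2}[m i]mulr1n -(mulrn_Zp _ 1).
by rewrite ffunE ji mulr0n.
Qed.

Lemma free_decomp (v : V) : v = \sum_i unit_vec i *+ (v i : nat).
Proof.
have MnE (w : V) m j : (w *+ m) j = w j *+ m.
  by elim: m => [|m IH]; rewrite ?mulr0n ?ffunE // !mulrS ffunE IH.
apply/ffunP => j; rewrite sum_ffunE (bigD1 j) //= MnE ffunE eqxx big1 => [|i].
  by rewrite addr0 -[LHS]natr_Zp.
by rewrite eq_sym MnE ffunE => /negPf ->; rewrite mul0rn.
Qed.

Lemma free_hom_ext (h h' : zhom V M) :
  (forall i, h (unit_vec i) = h' (unit_vec i)) -> h = h'.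
Proof.
move=> hh; apply: zhom_eqP => v; rewrite (free_decomp v) !zhom_sum.
by apply: eq_bigr => i _; rewrite !zhomMn hh.
Qed.

Lemma free_hom_bij : bijective free_hom.
Proof.
exists (fun h : zhom V M => [ffun i => h (unit_vec i)]) => [m|h].
  by apply/ffunP => i; rewrite ffunE free_hom_unit.
by apply: free_hom_ext => i; rewrite free_hom_unit ffunE.
Qed.

Lemma card_free_hom : #|{: zhom V M}| = (#|M| ^ #|I|)%N.
Proof. by rewrite -card_ffun (bij_eq_card free_hom_bij). Qed.

End Free.

Section FreeLifts.
Variables (q : nat) (I : finType) (G E : finZmodType) (f : cocycle G E).
Hypotheses (q_gt1 : (1 < q)%N) (extq : forall u : ext f, u *+ q = 0).
Local Notation V := {ffun I -> 'Z_q}.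

(** A homomorphism from a free module is given by its values at the unit vectors,
    whose second components are arbitrary. *)
Lemma card_free_lifts (phi : zhom V G) :
  #|[set theta | is_lift f phi theta]| = (#|E| ^ #|I|)%N.
Proof.
pose m (c : {ffun I -> E}) : {ffun I -> ext f} := [ffun i => (phi (unit_vec q i), c i)].
rewrite card_lifts -card_ffun.
have inj : injective (fun c => free_hom q_gt1 extq (m c)).
  move=> c c' /(bij_inj (free_hom_bij I q_gt1 extq)) /ffunP cc; apply/ffunP => i.
  by have := cc i; rewrite !ffunE => -[].
rewrite -[RHS](card_imset _ inj); apply: eq_card => h; rewrite inE.
apply/eqP/imsetP => [hphi|[c _ ->]].
  exists [ffun i => (h (unit_vec q i)).2] => //; apply: free_hom_ext => // i.
  rewrite free_hom_unit // !ffunE [LHS]surjective_pairing; congr (_, _).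
  by rewrite -ext_fstE hphi.
apply: free_hom_ext => // i.
by rewrite ext_fstE free_hom_unit // ffunE.
Qed.

End FreeLifts.

Lemma prime_expS_gt1 p k : prime p -> (1 < p ^ k.+1)%N.
Proof. by move=> p_pr; rewrite -(expn0 p) ltn_exp2l ?prime_gt1. Qed.

Lemma mulrn_expS_eq0 (G : finZmodType) p k : (forall x : G, x *+ (p ^ k) = 0) ->
  forall x : G, x *+ (p ^ k.+1) = 0.
Proof. by move=> Gk x; rewrite expnSr mulrnA Gk mul0rn. Qed.

Section CountCocycles.
Variables (p k : nat) (G : finZmodType).
Hypotheses (p_pr : prime p) (Gk : forall x : G, x *+ (p ^ k) = 0).
Local Notation q := (p ^ k.+1)%N.
Local Notation V := {ffun G -> 'Z_q}.
Local Notation q_gt1 := (prime_expS_gt1 k p_pr).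
Local Notation Gq := (mulrn_expS_eq0 Gk).

Definition cover : zhom V G := free_hom q_gt1 Gq [ffun x => x].

Lemma cover_surj : cover \in surs V G.
Proof. by apply/sursP => x; exists (unit_vec q x); rewrite free_hom_unit ffunE. Qed.

Lemma Fp_exp_q (x : 'F_p) : x *+ q = 0.
Proof. by rewrite expnS mulrnA Fp_exp // mul0rn. Qed.

Lemma ffun_mulrn (v : V) m x : (v *+ m) x = v x *+ m.
Proof. by elim: m => [|m IH]; rewrite ?mulr0n ?ffunE // !mulrS ffunE IH. Qed.

(** The kernel of a map from a free [Z/q]-module to [G] contains the whole
    [p]-torsion, as [q] is [p] times an exponent of [G]. *)
Lemma torsion_cover (v : V) : v *+ p = 0 -> cover v = 0.
Proof.
move=> vp; have [w ->] : exists w : V, v = w *+ (p ^ k).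
  exists [ffun x => (v x %/ p ^ k)%:R]; apply/ffunP => x; rewrite ffun_mulrn ffunE.
  rewrite -mulrnA divnK ?natr_Zp //.
  have : v x *+ p = 0 by rewrite -ffun_mulrn vp ffunE.
  rewrite -[v x in LHS]natr_Zp -mulrnA => /(congr1 val); rewrite /= val_Zp_nat ?q_gt1 //.
  move/eqP; rewrite -/(dvdn _ _); move: (nat_of_ord (v x)) => a.
  by rewrite expnSr dvdn_pmul2r ?prime_gt0.
by rewrite zhomMn Gk.
Qed.

Lemma card_torsion_kernel_cover : #|torsion p (kernel cover)| = (p ^ #|G|)%N.
Proof.
have := card_free_hom G q_gt1 Fp_exp_q; rewrite card_zhom_Fp // card_Fp // => <-.
rewrite -(card_imset _ (@kernel_eqP _ _ _)); apply: eq_card => v.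
have kM (x : kernel cover) m : kernel_val (x *+ m) = kernel_val x *+ m.
  by elim: m => [|m IH]; rewrite ?mulr0n // !mulrS kernelD IH.
apply/imsetP/idP => [[x + ->]|]; rewrite !inE => /eqP h.
  by rewrite -kM h.
have kv : v \in hom_kernel cover by rewrite unfold_in torsion_cover.
by exists (Kernel kv); rewrite ?inE //; apply/eqP/kernel_eqP; rewrite kM.
Qed.

(** Double counting of the maps that are additive along the kernel of a free cover
    of [G]: they are lifts for one cocycle each, every cocycle has equally many, and
    their total number depends only on the torsion of the kernel. *)
Lemma card_cocycle j : #|{: cocycle G (elem p j)}| = (#|elem p j| ^ #|G|.-1)%N.
Proof.
set E := elem p j.
have E_gt0 : (0 < #|E|)%N by rewrite card_elem // expn_gt0 prime_gt0.
have extq (f : cocycle G E) (u : ext f) : u *+ q = 0.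
  by rewrite expnSr; apply: ext_exp => //; exact: elem_exp.
have := sum_card_lifts xpredT cover_surj (E := E).
rewrite (card_semi_additive (Q' := setT) cover_surj) => [|theta l _ _]; last by rewrite inE.
under eq_bigr => f _.
  rewrite (_ : finset _ = [set theta | is_lift f cover theta]); last by apply/setP => theta; rewrite !inE andbT.
  rewrite (card_free_lifts q_gt1 (@extq f)); over.
rewrite sum_nat_const cardsT card_zhom_elem card_zhom_Fp // card_torsion_kernel_cover.
have -> : ((p ^ #|G|) ^ j = #|E| ^ #|G|)%N by rewrite card_elem // -!expnM mulnC.
by rewrite mulnC => /eqP; rewrite eqn_pmul2l ?expn_gt0 ?E_gt0 // => /eqP.
Qed.

(** Summed over the cocycles, the surjections to an extension lying over [phi] are
    the maps that are additive along the kernel of [phi] and map it onto [F_p^j]. *)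
Lemma sum_surs_ext (A : finZmodType) j :
  (\sum_(f : cocycle G (elem p j)) #|surs A (ext f)| =
   (\sum_(phi in surs A G) \prod_(i < j) (#|torsion p (kernel phi)| - p ^ i))
   * (p ^ j) ^ #|G|.-1)%N.
Proof.
rewrite (eq_bigr _ (fun f _ => card_surs_ext A f)).
rewrite exchange_big big_distrl /=; apply: eq_bigr => phi surphi.
rewrite sum_card_lifts // (card_semi_additive (Q' := surs _ _) surphi) => [|theta l _ tl].
  by rewrite card_surs_elem // card_zhom_Fp // card_elem.
apply/forallP/sursP => h e.
  have /existsP[x /andP[/eqP phix /eqP xe]] := h e.
  have kx : x \in hom_kernel phi by rewrite unfold_in phix.
  by exists (Kernel kx); rewrite -tl.
have [x xe] := h e; apply/existsP; exists (kernel_val x).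
by rewrite kernelP eqxx tl xe eqxx.
Qed.

End CountCocycles.

(** * Inclusion-exclusion and Euler's identity *)

Section Bonferroni.
Variables (R : realType) (p : nat).
Hypothesis p_gt1 : (1 < p)%N.

(** This is [p^(j(j-1)/2) / |GL_j(F_p)|]. *)
Definition euler_coef j : R := \prod_(i < j) (p%:R ^+ i.+1 - 1)^-1.

Lemma pX_gt1 i : 1 < p%:R ^+ i.+1 :> R.
Proof. by rewrite exprn_egt1 // ltr1n. Qed.

Lemma euler_coefS j : euler_coef j.+1 * (p%:R ^+ j.+1 - 1) = euler_coef j.
Proof.
rewrite /euler_coef big_ord_recr /= -mulrA mulVf ?mulr1 //.
by rewrite subr_eq0 gt_eqF ?pX_gt1.
Qed.

Lemma euler_coef_gt0 j : 0 < euler_coef j.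
Proof. by apply: prodr_gt0 => i _; rewrite invr_gt0 subr_gt0 pX_gt1. Qed.

Lemma euler_coef_ge0 j : 0 <= euler_coef j.
Proof. by rewrite ltW ?euler_coef_gt0. Qed.

Lemma euler_coef_le j : euler_coef j <= 2 * 2^-1 ^+ j.
Proof.
elim: j => [|[|j] IH]; first by rewrite /euler_coef big_ord0 expr0 mulr1 ler1n.
  rewrite expr1 divff ?pnatr_eq0 // /euler_coef big_ord1 invf_le1 ?subr_gt0 ?pX_gt1 //.
  by rewrite lerBrDr expr1 -(natrD _ 1 1) ler_nat.
have h : euler_coef j.+2 * 2 <= euler_coef j.+1.
  rewrite -(euler_coefS j.+1); apply: ler_wpM2l; first exact: euler_coef_ge0.
  rewrite lerBrDr -natrX -(natrD _ 2 1) ler_nat.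
  apply: leq_trans (_ : 2 ^ 2 <= _)%N => //.
  by apply: leq_trans (_ : p ^ 2 <= _)%N; rewrite ?leq_sqr ?leq_pexp2l // ltnW.
rewrite exprS mulrCA -ler_pdivrMl ?invr_gt0 ?ltr0n // invrK mulrC.
exact: le_trans h IH.
Qed.

Definition bonferroni J (x : R) : R :=
  \sum_(j < J.+1) (-1) ^+ j * euler_coef j * \prod_(i < j) (x - p%:R ^+ i).

(** For [x = p^k] the products are the numbers of surjections from [F_p^k] to
    the [F_p^j]; their alternating sum, weighted by [euler_coef], telescopes. *)
Lemma bonferroniE J x : bonferroni J x =
  (-1) ^+ J * euler_coef J * \prod_(i < J) (x - p%:R ^+ i.+1).
Proof.
rewrite /bonferroni; elim: J => [|J IH].
  by rewrite big_ord1 !big_ord0.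
rewrite big_ord_recr /= IH [X in _ + _ * X]big_ord_recl expr0 -(euler_coefS J).
rewrite [in RHS]big_ord_recr /= [(-1) ^+ J.+1]exprS; under [in X in _ + _ * (_ * X)]eq_bigr => i _ do rewrite /bump /= add1n.
move: (\prod_(i < J) _) (euler_coef _) ((-1) ^+ J) (p%:R ^+ J.+1) => t1 t2 t3 t4; ring.
Qed.

Lemma bonferroni1 J : bonferroni J 1 = 1.
Proof.
rewrite bonferroniE -mulrA mulrCA -{2}[J]card_ord -prodr_const -!big_split /= big1 // => i _.
by rewrite mulN1r opprB mulVf // subr_eq0 gt_eqF ?pX_gt1.
Qed.

(** For [k <= J] one factor of the product in [bonferroniE] vanishes, and otherwise
    all of them are nonnegative. *)
Lemma bonferroni_sign J k : (0 < k)%N -> 0 <= (-1) ^+ J * bonferroni J (p%:R ^+ k).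
Proof.
move=> k_gt0; rewrite bonferroniE !mulrA -expr2 sqrr_sign mul1r.
apply: mulr_ge0; first exact: euler_coef_ge0.
have [kJ|Jk] := leqP k J.
  have i_lt : (k.-1 < J)%N by rewrite prednK.
  by rewrite (bigD1 (Ordinal i_lt)) //= prednK // subrr mul0r.
apply: prodr_ge0 => i _; rewrite subr_ge0 ler_eXn2l ?ltr1n //.
exact: leq_trans (ltn_ord i) (ltnW Jk).
Qed.

Definition euler_sum J (y : R) : R := \sum_(j < J.+1) (-1) ^+ j * euler_coef j * y ^+ j.

(** The functional equation of the Euler series; the truncation leaves one boundary
    term. *)
Lemma euler_sum_scale J y :
  euler_sum J (p%:R * y) = (1 - y) * euler_sum J y + (-1) ^+ J * euler_coef J * y ^+ J.+1.
Proof.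
rewrite /euler_sum; elim: J => [|J IH].
  by rewrite !big_ord1 /euler_coef big_ord0; ring.
rewrite big_ord_recr IH [in RHS]big_ord_recr /= -(euler_coefS J) exprMn !exprS.
move: (\sum_(_ < _) _) (euler_coef _) ((-1) ^+ J) (p%:R ^+ J) (y ^+ J) => t1 t2 t3 t4 t5; ring.
Qed.

Definition euler_prod m : R := \prod_(1 <= k < m.+1) (1 - p%:R ^- k).

Lemma euler_prodS m : euler_prod m.+1 = euler_prod m * (1 - p%:R ^- m.+1).
Proof. by rewrite /euler_prod big_nat_recr. Qed.

Lemma p_gt0 : 0 < p%:R :> R. Proof. by rewrite ltr0n ltnW. Qed.

Lemma pXV_ge0 k : 0 <= (p%:R ^- k : R).
Proof. by rewrite invr_ge0 exprn_ge0 // ltW ?p_gt0. Qed.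

Lemma pXV_le1 k : (p%:R ^- k : R) <= 1.
Proof. by rewrite invf_le1 ?exprn_gt0 ?p_gt0 // exprn_ege1 // ler1n ltnW. Qed.

Lemma pXV_le k : (p%:R ^- k : R) <= 2^-1 ^+ k.
Proof.
rewrite -exprVn; apply: lerXn2r; rewrite ?nnegrE ?invr_ge0 ?ler0n //.
by rewrite lef_pV2 ?posrE ?p_gt0 ?ltr0n // ler_nat.
Qed.

Lemma euler_prod_ge0 m : 0 <= euler_prod m.
Proof. by apply: prodr_ge0 => k _; rewrite subr_ge0 pXV_le1. Qed.

Lemma euler_prod_le1 m : euler_prod m <= 1.
Proof.
elim: m => [|m IH]; first by rewrite /euler_prod big_geq.
by rewrite euler_prodS mulr_ile1 ?euler_prod_ge0 ?subr_ge0 ?pXV_le1 ?gerBl ?pXV_ge0.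
Qed.

Lemma euler_prod_step J m :
  `|euler_sum J 1 - euler_prod m * euler_sum J (p%:R ^- m)|
   <= euler_coef J * (1 - 2^-1 ^+ m).
Proof.
elim: m => [|m IH].
  by rewrite /euler_prod big_geq // mul1r invr1 subrr normr0 expr0 subrr mulr0.
have scale : euler_sum J (p%:R ^- m) = (1 - p%:R ^- m.+1) * euler_sum J (p%:R ^- m.+1)
    + (-1) ^+ J * euler_coef J * (p%:R ^- m.+1) ^+ J.+1.
  rewrite -euler_sum_scale; congr (euler_sum J _).
  by rewrite exprS invfM mulrA divff ?mul1r // gt_eqF ?p_gt0.
set a := euler_sum J 1 in IH *; set b := euler_sum J (p%:R ^- m.+1) in scale *.
set eps := (-1) ^+ J * _ * _ in scale.
have -> : a - euler_prod m.+1 * b = (a - euler_prod m * euler_sum J (p%:R ^- m)) + euler_prod m * eps.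
  rewrite scale euler_prodS; ring.
apply: le_trans (ler_normD _ _) _.
have -> : euler_coef J * (1 - 2^-1 ^+ m.+1) =
    euler_coef J * (1 - 2^-1 ^+ m) + euler_coef J * 2^-1 ^+ m.+1 :> R.
  by rewrite exprS; field.
apply: lerD => //; rewrite normrM (ger0_norm (euler_prod_ge0 m)).
apply: le_trans (_ : 1 * `|eps| <= _); first by rewrite ler_wpM2r ?euler_prod_le1.
rewrite mul1r /eps -mulrA normrMsign normrM [`|euler_coef J|]ger0_norm ?euler_coef_ge0 //.
apply: ler_wpM2l; first exact: euler_coef_ge0.
rewrite ger0_norm ?exprn_ge0 ?pXV_ge0 //; apply: le_trans (pXV_le m.+1).
by rewrite exprS ler_piMr ?pXV_ge0 // exprn_ile1 ?pXV_ge0 ?pXV_le1.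
Qed.

Lemma euler_sum_near1 J m : `|euler_sum J (p%:R ^- m) - 1| <= (2 * J)%:R * 2^-1 ^+ m.
Proof.
rewrite /euler_sum big_ord_recl /= /euler_coef big_ord0 !expr0 !mulr1 addrAC subrr add0r.
apply: le_trans (ler_norm_sum _ _ _) _.
apply: le_trans (_ : \sum_(j < J) 2 * 2^-1 ^+ m <= _); last first.
  by rewrite sumr_const card_ord -[leLHS]mulr_natl natrM mulrA [2 * _]mulrC.
apply: ler_sum => j _; rewrite -mulrA normrMsign normrM.
rewrite -/(euler_coef _) [`|euler_coef _|]ger0_norm ?euler_coef_ge0 // ger0_norm ?exprn_ge0 ?pXV_ge0 //.
apply: ler_pM; rewrite ?exprn_ge0 ?pXV_ge0 ?euler_coef_ge0 //.
  by apply: le_trans (euler_coef_le _) _; rewrite ler_piMr // exprn_ile1 ?invr_ge0 // invf_le1 ?ler1n ?ltr0n.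
apply: le_trans (pXV_le m).
by rewrite /bump /= add1n exprS ler_piMr ?pXV_ge0 // exprn_ile1 ?pXV_ge0 ?pXV_le1.
Qed.

Local Open Scope classical_set_scope.

Lemma euler_prod_cvg : cvgn euler_prod.
Proof.
apply: nonincreasing_is_cvgn.
  by apply/nonincreasing_seqP => m; rewrite euler_prodS ler_piMr ?euler_prod_ge0.
by exists 0 => _ [m _ <-]; exact: euler_prod_ge0.
Qed.

(** The functional equation of the Euler series compares its value at [1] with
    that at [p^-m], which is close to [1]. *)
Lemma euler_sum_lim J : `|euler_sum J 1 - limn euler_prod| <= euler_coef J.
Proof.
have h2 : (fun m => 2^-1 ^+ m : R) @ \oo --> (0 : R).
  by apply: cvg_expr; rewrite ger0_norm ?invr_ge0 // invf_lt1 ?ltr1n ?ltr0n.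
have h3 : (fun m => (2 * J)%:R * 2^-1 ^+ m : R) @ \oo --> (0 : R).
  by rewrite -[X in _ --> X](mulr0 ((2 * J)%:R)); apply: cvgMr.
have h4 : (fun m => euler_sum J (p%:R ^- m)) @ \oo --> (1 : R).
  apply/cvgrPdist_le => e e0; have /cvgr0Pnorm_le/(_ e e0) := h3.
  apply: filterS => m; rewrite distrC; apply: le_trans.
  by apply: le_trans (euler_sum_near1 J m) _; exact: ler_norm.
have h5 : (fun m => `|euler_sum J 1 - euler_prod m * euler_sum J (p%:R ^- m)|) @ \oo -->
    `|euler_sum J 1 - limn euler_prod * 1|.
  apply: cvg_norm; apply: cvgB; first exact: cvg_cst.
  by apply: cvgM => //; exact: euler_prod_cvg.
rewrite mulr1 in h5; rewrite -(cvg_lim _ h5) //.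
apply: limr_le; first by apply/cvg_ex; eexists; exact: h5.
near=> m; apply: le_trans (euler_prod_step J m) _.
by rewrite ler_piMr ?euler_coef_ge0 // gerBl exprn_ge0 // invr_ge0.
Unshelve. all: by end_near.
Qed.

End Bonferroni.

(** * Isomorphisms counted by surjections to extensions *)

Section Isos.
Variables (R : realType) (p k : nat) (A G : finZmodType).
Hypotheses (p_pr : prime p) (Gk : forall x : G, x *+ (p ^ k) = 0).
Hypothesis pA : (p.-nat #|A|)%N.

Definition isos : {set zhom A G} := [set phi in surs A G | injectiveb phi].

(** The [p]-torsion of a finite [p]-group is an elementary abelian group, which
    is trivial only if the group is. *)
Lemma card_torsion_kernel phi : phi \in surs A G ->
  exists2 r, #|torsion p (kernel phi)| = (p ^ r)%N & injectiveb phi = (r == 0%N).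
Proof.
move=> surphi; set K := kernel phi.
have pK : (p.-group [set: (K : finZmodType)])%g.
  rewrite /pgroup cardsT; apply: pnat_dvd pA; rewrite -(card_kernel surphi).
  exact: dvdn_mull.
have gT : group_set (torsion p K : {set (K : finZmodType)}).
  apply/group_setP; split=> [|x y]; rewrite !inE ?mul0rn // => /eqP hx /eqP hy.
  by rewrite zmodMgE mulrnDl hx hy addr0.
have pT : (p.-group (Group gT))%g by apply: pgroupS pK; exact: subsetT.
exists (logn p #|torsion p K|); first exact: (card_pgroup pT).
apply/injectiveP/eqP => [inj|logT].
  rewrite (_ : torsion p K = [set 0]) ?cards1 ?logn1 //; apply/setP => x.
  have -> : x = 0 by apply/kernel_eqP/inj; rewrite kernelP zhom0.
  by rewrite !inE mul0rn eqxx.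
have T1 : #|torsion p K| = 1%N by rewrite (card_pgroup pT) logT.
have K0 (x : K) : x = 0.
  have [K1|ntK] := eqVneq [set: (K : finZmodType)]%g 1%g.
    by have := in_setT x; rewrite K1 inE => /eqP.
  have [_ dvdpK _] := pgroup_pdiv pK ntK.
  have [y _ oy] := Cauchy p_pr dvdpK.
  have yT : y \in torsion p K by rewrite inE -zmodXgE -oy expg_order.
  have y0 : y = 0.
    have /card_le1_eqP T1' : (#|torsion p K| <= 1)%N by rewrite T1.
    by apply: T1' => //; rewrite inE mul0rn.
  by move: oy p_pr; rewrite y0 -zmod1gE order1 => <-.
move=> a b ab; apply/eqP; rewrite -subr_eq0.
have kab : a - b \in hom_kernel phi by rewrite unfold_in zhomD zhomN ab subrr.
by have /(congr1 (@kernel_val _ _ _)) /= -> := K0 (Kernel kab).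
Qed.

(** By [card_cocycle] the denominator is the number of cocycles. *)
Definition ext_estimate j : R :=
  (\sum_(f : cocycle G (elem p j)) #|surs A (ext f)|)%:R / ((p ^ j) ^ #|G|.-1)%:R.

Lemma prod_subn (r j : nat) :
  (\prod_(i < j) (p ^ r - p ^ i))%:R = \prod_(i < j) ((p%:R ^+ r : R) - p%:R ^+ i).
Proof.
have [rj|jr] := ltnP r j.
  by rewrite (bigD1 (Ordinal rj)) //= subnn mul0n [RHS](bigD1 (Ordinal rj)) //= subrr mul0r.
rewrite natr_prod; apply: eq_bigr => i _; rewrite natrB ?natrX // leq_exp2l ?prime_gt1 //.
exact: leq_trans (ltnW (ltn_ord i)) jr.
Qed.

Lemma ext_estimateE j : ext_estimate j =
  \sum_(phi in surs A G) \prod_(i < j) (#|torsion p (kernel phi)|%:R - p%:R ^+ i).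
Proof.
rewrite /ext_estimate (sum_surs_ext G p_pr A) natrM mulfK; last first.
  by rewrite pnatr_eq0 -lt0n !expn_gt0 prime_gt0.
rewrite natr_sum; apply: eq_bigr => phi surphi.
by have [r -> _] := card_torsion_kernel surphi; rewrite prod_subn natrX.
Qed.

Definition iso_estimate J : R :=
  \sum_(j < J.+1) (-1) ^+ j * euler_coef R p j * ext_estimate j.

(** A surjection contributes the value of [bonferroni] at the order of the
    [p]-torsion of its kernel, and to the number of isomorphisms the indicator of
    this order being [1]. *)
Lemma iso_estimate_sign J : 0 <= (-1) ^+ J * (iso_estimate J - #|isos|%:R).
Proof.
have -> : iso_estimate J = \sum_(phi in surs A G) bonferroni p J #|torsion p (kernel phi)|%:R.
  rewrite /iso_estimate /bonferroni exchange_big /=; apply: eq_bigr => j _.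
  by rewrite ext_estimateE mulr_sumr.
have -> : #|isos|%:R = \sum_(phi in surs A G) (injectiveb phi)%:R :> R.
  rewrite -sum1_card natr_sum big_mkcond [RHS]big_mkcond /=; apply: eq_bigr => phi _.
  by rewrite inE; case: (phi \in _) => //=; case: injectiveb.
rewrite -sumrB mulr_sumr; apply: sumr_ge0 => phi surphi.
have [r -> ->] := card_torsion_kernel surphi; rewrite natrX.
case: posnP => [->|r_gt0]; first by rewrite expr0 bonferroni1 ?prime_gt1 // subrr mulr0.
by rewrite subr0 bonferroni_sign ?prime_gt1.
Qed.

End Isos.

(** * Uniform convergence of the moments *)

Section Decay.
Variable R : realType.
Local Open Scope classical_set_scope.
Implicit Types (s a : R).

Lemma cvg_geometric0 s : 0 <= s -> s < 1 -> (fun n => s ^+ n) @ \oo --> (0 : R).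
Proof. by move=> s0 s1; apply: cvg_expr; rewrite ger0_norm. Qed.

Lemma divn_cvg D : (0 < D)%N -> (fun n => (n %/ D)%N) @ \oo --> \oo.
Proof.
move=> D0 S [N _ NS]; exists (N * D)%N => //= n /= ND; apply: NS => /=.
by rewrite leq_divRL.
Qed.

Lemma linear_geometric_cvg s : 0 <= s -> s < 1 ->
  (fun n => n%:R * s ^+ n) @ \oo --> (0 : R).
Proof.
move=> s0 s1; pose u := Num.max s 2^-1.
have half1 : 2^-1 < 1 :> R by rewrite invf_lt1 ?ltr1n.
have u1 : u < 1 by rewrite gt_max s1.
have u0 : 0 < u by rewrite lt_max invr_gt0 ltr0n orbT.
pose w := Num.sqrt u; have w0 : 0 < w by rewrite sqrtr_gt0.
have w1 : w < 1 by rewrite -sqrtr1 ltr_sqrt.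
have [h h0 hE] : exists2 h, 0 < h & w^-1 = 1 + h.
  by exists (w^-1 - 1); rewrite ?subr_gt0 ?invf_gt1 // addrC subrK.
apply: (@squeeze_cvgr _ _ _ _ (fun=> 0) (fun n => h^-1 * w ^+ n)); last 2 first.
- exact: cvg_cst.
- by rewrite -[X in _ --> X](mulr0 h^-1); apply: cvgMr; apply: cvg_geometric0; rewrite ?ltW.
near=> n; rewrite mulr_ge0 ?exprn_ge0 //=.
(* The inequality of Bernoulli. *)
have bern : n%:R * h <= w ^- n.
  rewrite -exprVn hE.
  elim: (n) => [|m IH]; first by rewrite mul0r expr0.
  have m1 : 1 <= (1 + h) ^+ m by rewrite exprn_ege1 // lerDl ltW.
  rewrite exprSr mulrDr mulr1 -natr1 mulrDl mul1r; apply: lerD => //.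
  by rewrite -[leLHS]mul1r ler_wpM2r // ltW.
have su : s ^+ n <= w ^+ n * w ^+ n.
  rewrite -exprMn -expr2 (sqr_sqrtr (ltW u0)); apply: lerXn2r; rewrite ?nnegrE ?(ltW u0) //.
  by rewrite le_max lexx.
apply: le_trans (_ : n%:R * (w ^+ n * w ^+ n) <= _); first exact: ler_wpM2l.
rewrite mulrA; apply: ler_wpM2r; first by rewrite exprn_ge0 // ltW.
by rewrite -ler_pdivlMr ?exprn_gt0 // ler_pdivlMl // mulrC.
Unshelve. all: by end_near.
Qed.

(** The next three lemmas give the decay of the terms of the error when the
    popularity threshold is a fixed small proportion [1/D] of [n]. *)
Lemma quadratic_decay D a s : (0 < D)%N -> 1 <= a -> 0 <= s -> s < 1 ->
  (fun n => a ^+ n * s ^+ ((n %/ D) * (n %/ D).-1)) @ \oo --> (0 : R).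
Proof.
move=> D0 a1 s0 s1.
have half1 : 2^-1 < 1 :> R by rewrite invf_lt1 ?ltr1n.
have tD := divn_cvg D0.
apply: (@squeeze_cvgr _ _ _ _ (fun=> 0) (fun n => 2^-1 ^+ (n %/ D))); last 2 first.
- exact: cvg_cst.
- by apply: (cvg_comp _ _ tD (cvg_geometric0 _ half1)); rewrite invr_ge0.
have a0 : 0 <= a by apply: le_trans a1.
have small : \forall t \near \oo, a ^+ (2 * D) * s ^+ t <= 2^-1.
  have : (fun t => a ^+ (2 * D) * s ^+ t) @ \oo --> (0 : R).
    by rewrite -[X in _ --> X](mulr0 (a ^+ (2 * D))); apply: cvgMr; exact: cvg_geometric0.
  by move=> /cvgr_le h; apply: h; rewrite invr_gt0 ltr0n.
have [N _ Nsmall] := small.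
have large : \forall n \near \oo, (N.+1 <= n %/ D)%N.
  exact: (tD _ (nbhs_infty_gt N)).
near=> n; have Nt : (N.+1 <= n %/ D)%N by near: n.
rewrite mulr_ge0 ?exprn_ge0 //=.
set t := (n %/ D)%N in Nt *; have t0 : (0 < t)%N by apply: leq_trans Nt.
have nt : (n <= 2 * D * t)%N.
  have := ltn_ceil n D0; rewrite -/t => h; apply: ltnW; apply: leq_trans h _.
  by rewrite mulnC -mulnA mulnCA leq_mul2l orbC mul2n -addnn -addn1 leq_add2l t0.
apply: le_trans (_ : (a ^+ (2 * D) * s ^+ t.-1) ^+ t <= _).
  rewrite exprMn -!exprM [(t.-1 * t)%N]mulnC; apply: ler_wpM2r; first exact: exprn_ge0.
  by rewrite ler_weXn2l.
apply: lerXn2r; rewrite ?nnegrE ?mulr_ge0 ?exprn_ge0 ?invr_ge0 //.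
by apply: Nsmall => /=; rewrite -ltnS prednK.
Unshelve. all: by end_near.
Qed.

Lemma power_decay D a s : (0 < D)%N -> 0 <= a -> 0 <= s -> s < 1 -> a * s ^+ D <= 1 ->
  (fun n => a ^+ (n %/ (2 * D)) * s ^+ n) @ \oo --> (0 : R).
Proof.
move=> D0 a0 s0 s1 aD; have D20 : (0 < 2 * D)%N by rewrite muln_gt0.
apply: (@squeeze_cvgr _ _ _ _ (fun=> 0) (fun n => s ^+ (n %/ (2 * D)))); last 2 first.
- exact: cvg_cst.
- exact: (cvg_comp _ _ (divn_cvg D20) (cvg_geometric0 s0 s1)).
near=> n; rewrite mulr_ge0 ?exprn_ge0 //=; set t := (n %/ _)%N.
have nt : (D * t + t <= n)%N.
  apply: leq_trans (leq_trunc_div n (2 * D)); rewrite -/t mulnCA mul2n -addnn.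
  by rewrite [(t * D)%N]mulnC leq_add2l leq_pmull.
have {}nt : (D * t <= n)%N && (t <= n - D * t)%N by lia.
case/andP: nt => nt1 nt2; rewrite -(subnKC nt1) exprD mulrA exprM -exprMn.
apply: le_trans (_ : 1 * s ^+ (n - D * t) <= _).
  by apply: ler_wpM2r; rewrite ?exprn_ge0 // exprn_ile1 // mulr_ge0 ?exprn_ge0.
by rewrite mul1r ler_wiXn2l // ltW.
Unshelve. all: by end_near.
Qed.

Lemma compound_decay D a s : (0 < D)%N -> 0 <= a -> 0 <= s -> s < 1 ->
  (fun n => (1 + a * s ^+ (n %/ D)) ^+ n - 1) @ \oo --> (0 : R).
Proof.
move=> D0 a0 s0 s1; have tD := divn_cvg D0.
apply: (@squeeze_cvgr _ _ _ _ (fun=> 0)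
  (fun n => expR (a * D%:R * ((n %/ D)%:R * s ^+ (n %/ D) + s ^+ (n %/ D))) - 1)); last 2 first.
- exact: cvg_cst.
- rewrite -[X in _ --> X](subrr 1); apply: cvgB; last exact: cvg_cst.
  rewrite -[X in _ --> X]expR0; apply: continuous_cvg; first exact: continuous_expR.
  rewrite -[X in _ --> X](mulr0 (a * D%:R)); apply: cvgMr.
  rewrite -[X in _ --> X](addr0 0); apply: cvgD.
    exact: (cvg_comp _ _ tD (linear_geometric_cvg s0 s1)).
  exact: (cvg_comp _ _ tD (cvg_geometric0 s0 s1)).
near=> n; set t := (n %/ D)%N; apply/andP; split.
  by rewrite subr_ge0 exprn_ege1 // lerDl mulr_ge0 ?exprn_ge0.
apply: lerB => //; apply: le_trans (_ : expR (a * s ^+ t) ^+ n <= _).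
  apply: lerXn2r; rewrite ?nnegrE ?expR_ge0 ?addr_ge0 ?mulr_ge0 ?exprn_ge0 //.
  exact: expR_ge1Dx.
rewrite -expRM_natr ler_expR -!mulrA; apply: ler_wpM2l => //.
rewrite mulrDr [_ * (t%:R * _)]mulrA -mulrDl mulrC; apply: ler_wpM2r; first exact: exprn_ge0.
rewrite -natrM -natrD ler_nat; have := ltn_ceil n D0; rewrite -/t; lia.
Unshelve. all: by end_near.
Qed.

End Decay.

Section ErrorTerm.
Variables (R : realType) (W : finZmodType) (g NG : nat) (s : R).
Hypotheses (g_gt0 : (0 < g)%N) (s_ge0 : 0 <= s) (s_lt1 : s < 1).
Local Notation NW := #|{group W}|.

(** The proportion [1/D] has to be so small that the number of choices for the
    exceptional values, exponential in [n / D], does not make up for the loss of a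
    factor [(g - 3/4) / g] at each index. Every other term then decays for any
    fixed [D]. *)
Lemma error_term_small (eta : R) : 0 < eta ->
  exists D N, (0 < D)%N /\ forall n r, (N <= n)%N -> (N <= r)%N ->
    (0 < n %/ D)%N /\
    core_error g W n (n %/ D) s
      + NW%:R * (NG%:R * g.-1%:R ^+ n + g%:R ^+ n * 2^-1 ^+ r./2) <= eta * g%:R ^+ n.
Proof.
move=> eta_gt0.
have g0 : 0 < g%:R :> R by rewrite ltr0n.
have g1 : 1 <= g%:R :> R by rewrite ler1n.
pose A : R := (4 * g ^ 2)%:R ^+ (g ^ 2).
pose rho : R := (g%:R - 3 / 4) / g%:R.
have rho0 : 0 <= rho.
  rewrite divr_ge0 ?(ltW g0) // subr_ge0; apply: le_trans g1.
  by rewrite ler_pdivrMr ?ltr0n // mul1r ler_nat.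
have rho1 : rho < 1 by rewrite ltr_pdivrMr // mul1r gtrBl divr_gt0.
have A0 : 0 <= A by exact: exprn_ge0.
have [D' D'0 AD'] : exists2 D', (0 < D')%N & A * rho ^+ D' <= 1.
  have : ((fun m => A * rho ^+ m) @ \oo --> (0 : R))%classic.
    by rewrite -[X in (_ --> X)%classic](mulr0 A); apply: cvgMr; exact: cvg_geometric0.
  move=> /cvgr_le/(_ 1 ltr01) [N _ h]; exists N.+1 => //.
  by apply: h => /=.
pose D := (2 * D')%N; have D0 : (0 < D)%N by rewrite muln_gt0.
pose rho' : R := g.-1%:R / g%:R.
have rho'0 : 0 <= rho' by rewrite divr_ge0.
have rho'1 : rho' < 1 by rewrite ltr_pdivrMr // mul1r ltr_nat prednK.
pose F n : R := g%:R ^+ n * s ^+ (n %/ D * (n %/ D).-1)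
  + NW%:R * (1 + NW%:R) * (A ^+ (n %/ D) * rho ^+ n)
  + NW%:R * ((1 + g%:R * s ^+ (n %/ D)) ^+ n - 1 + s ^+ (n %/ D))
  + NW%:R * NG%:R * rho' ^+ n.
have cvgF : (F @ \oo --> (0 : R))%classic.
  rewrite -[X in (_ --> X)%classic](addr0 0); apply: cvgD; last first.
    by rewrite -[X in (_ --> X)%classic](mulr0 (NW%:R * NG%:R)); apply: cvgMr; exact: cvg_geometric0.
  rewrite -[X in (_ --> X)%classic](addr0 0); apply: cvgD; last first.
    rewrite -[X in (_ --> X)%classic](mulr0 NW%:R); apply: cvgMr.
    rewrite -[X in (_ --> X)%classic](addr0 0); apply: cvgD; first exact: compound_decay.
    exact: (cvg_comp _ _ (divn_cvg D0) (cvg_geometric0 s_ge0 s_lt1)).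
  rewrite -[X in (_ --> X)%classic](addr0 0); apply: cvgD; first exact: quadratic_decay.
  by rewrite -[X in (_ --> X)%classic](mulr0 (NW%:R * (1 + NW%:R))); apply: cvgMr; exact: power_decay.
have cvgH : ((fun r => NW%:R * 2^-1 ^+ r./2) @ \oo --> (0 : R))%classic.
  rewrite -[X in (_ --> X)%classic](mulr0 NW%:R); apply: cvgMr.
  have half1 : 2^-1 < 1 :> R by rewrite invf_lt1 ?ltr1n.
  have h0 : 0 <= 2^-1 :> R by rewrite invr_ge0.
  have := cvg_comp _ _ (divn_cvg (isT : (0 < 2)%N)) (cvg_geometric0 h0 half1).
  by apply: cvg_trans; apply: near_eq_cvg; near=> r; rewrite /= divn2.
have eta2 : 0 < eta / 2 by rewrite divr_gt0.
move: cvgF => /cvgr_le/(_ _ eta2)[N1 _ HF].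
move: cvgH => /cvgr_le/(_ _ eta2)[N2 _ HH].
exists D, (maxn D (maxn N1 N2)); split=> // n r; rewrite !geq_max => /and3P[Dn N1n _] /and3P[_ _ N2r].
split; first by rewrite divn_gt0.
have hF := HF n N1n; have hH := HH r N2r.
apply: le_trans (_ : (F n + NW%:R * 2^-1 ^+ r./2) * g%:R ^+ n <= _); last first.
  by apply: ler_wpM2r; rewrite ?exprn_ge0 // (splitr eta); exact: lerD.
rewrite le_eqVlt; apply/orP; left; apply/eqP.
have gn : g%:R ^+ n != 0 :> R by rewrite expf_neq0 // gt_eqF.
rewrite /core_error /F.
have -> : (g ^ 2)%:R ^+ n = g%:R ^+ n * g%:R ^+ n :> R by rewrite natrX -exprM mulnC exprM expr2.
have -> : (4 * g ^ 2)%:R ^+ (g ^ 2 * (n %/ D)) = A ^+ (n %/ D) :> R by rewrite exprM.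
have -> : (g%:R - 3 / 4) ^+ n = rho ^+ n * g%:R ^+ n :> R by rewrite -exprMn divfK // gt_eqF.
have -> : g.-1%:R ^+ n = rho' ^+ n * g%:R ^+ n :> R by rewrite -exprMn divfK // gt_eqF.
have -> : (g%:R + (g ^ 2)%:R * s ^+ (n %/ D)) ^+ n = (1 + g%:R * s ^+ (n %/ D)) ^+ n * g%:R ^+ n :> R.
  by rewrite -exprMn; congr (_ ^+ _); rewrite natrX; ring.
move: (g%:R ^+ n) (s ^+ _) (s ^+ _) (A ^+ _) (rho ^+ n) (rho' ^+ n) ((1 + _) ^+ n) (2^-1 ^+ _) => x1 x2 x3 x4 x5 x6 x7 x8.
ring.
Unshelve. all: by end_near.
Qed.

End ErrorTerm.

Section BalanceGap.
Variables (R : realType) (p e : nat).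
Local Notation q := (p ^ e)%N.
Local Notation K := R[i]%C.
Local Notation toC := (real_complex R).
Hypotheses (p_pr : prime p) (q_gt1 : (1 < q)%N).
Variables (z : K) (eps : R).
Hypotheses (prim_z : q.-primitive_root z) (eps_gt0 : 0 < eps).

(** A residue that is nonzero mod [p] is prime to [q]. *)
Lemma zmodp_unit_mul (a s : 'Z_q) : a != 0 -> zmodp p s != 0 -> a * s != 0.
Proof.
move=> a_neq0; apply: contraNneq => as0.
have e_gt0 : (0 < e)%N by move: q_gt1; case: (e).
rewrite -(dvdn_pcharf (pchar_Fp p_pr)).
apply: contraR a_neq0; rewrite -prime_coprime // => co.
have h1 : (#[a]%g %| q)%N by rewrite order_dvdn zmodXgE -mulr_natr pchar_Zp // mulr0.
have h2 : (#[a]%g %| (s : nat))%N.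
  by rewrite order_dvdn zmodXgE -mulr_natr natr_Zp as0.
have : (#[a]%g %| 1)%N.
  by rewrite -(eqP (_ : coprime q s)) ?dvdn_gcd ?h1 // coprimeXl.
by rewrite dvdn1 order_eq1.
Qed.

(** Both sides are twice the variance of [f]; the left one is written with two
    independent copies. *)
Lemma variance (m : 'Z_q -> K) (f : 'Z_q -> K) :
  \sum_y m y = 1 -> (forall y, (m y)^* = m y) -> (forall y, f y * (f y)^* = 1) ->
  \sum_x \sum_y m x * m y * `|f x - f y| ^+ 2 = 2 - 2 * `|\sum_y m y * f y| ^+ 2.
Proof.
move=> m1 mR f1.
have -> : \sum_x \sum_y m x * m y * `|f x - f y| ^+ 2 =
   \sum_x \sum_y (m x * m y * 2) - \sum_x \sum_y (m x * f x) * (m y * f y)^*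
   - \sum_x \sum_y (m y * f y) * (m x * f x)^*.
  rewrite -!sumrB; apply: eq_bigr => x _; rewrite -!sumrB; apply: eq_bigr => y _.
  rewrite normCK rmorphB !rmorphM /= !mR.
  transitivity (m x * m y * (f x * (f x)^* + f y * (f y)^* - f x * (f y)^* - f y * (f x)^*)).
    ring.
  by rewrite !f1; ring.
set S := \sum_y m y * f y.
have -> : \sum_x \sum_y m x * m y * 2 = 2.
  transitivity (\sum_x m x * 2); last by rewrite -mulr_suml m1 mul1r.
  apply: eq_bigr => x _; rewrite -mulr_suml -mulr_sumr m1; ring.
have -> : \sum_x \sum_y m x * f x * (m y * f y)^* = S * S^*.
  rewrite rmorph_sum mulr_suml; apply: eq_bigr => x _.
  by rewrite mulr_sumr.
have -> : \sum_x \sum_y m y * f y * (m x * f x)^* = S * S^*.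
  rewrite rmorph_sum mulr_sumr; apply: eq_bigr => x _.
  by rewrite mulr_suml.
rewrite normCK; ring.
Qed.

Lemma root_gap : exists2 kappa : R, 0 < kappa &
  forall b : 'Z_q, b != 0 -> toC kappa <= `|1 - zpow z b| ^+ 2.
Proof.
pose D (b : 'Z_q) : R := complex.Re (`|1 - zpow z b| ^+ 2).
have DE b : toC (D b) = `|1 - zpow z b| ^+ 2.
  by rewrite RRe_real // realX // normr_real.
exists (\big[Num.min/1]_(b : 'Z_q | b != 0) D b).
  elim/big_ind: _ => [//|x y x0 y0|b b0]; first by rewrite lt_min x0.
  rewrite -(@ltcR R) DE exprn_gt0 // normr_gt0 subr_eq0 eq_sym.
  by rewrite zpow_eq1.
move=> b b0; rewrite -DE lecR (bigD1 b) //= ge_min lexx //.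
Qed.

(** Two independent copies of an [eps]-balanced variable differ mod [p] with
    probability at least [eps], so multiplication by a nonzero [a] keeps their
    images under the character apart. *)
Lemma balance_gap : exists s : R, [/\ 0 <= s, s < 1 &
  forall m : 'Z_q -> R, (forall y, 0 <= m y) -> \sum_y m y = 1 ->
    (forall r : 'F_p, \sum_(y | zmodp p y == r) m y <= 1 - eps) ->
    forall a, a != 0 -> `|\sum_y toC (m y) * zpow z (a * y)| <= (toC s) ^+ 2].
Proof.
have pq : (p %| q)%N by move: q_gt1; case: (e) => // k _; rewrite expnS dvdn_mulr.
have [kappa kappa0 hkappa] := root_gap.
pose delta := Num.min (kappa * eps / 2) 2^-1.
have d0 : 0 < delta by rewrite lt_min divr_gt0 ?mulr_gt0 ?invr_gt0 ?ltr0n.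
have d1 : delta <= 2^-1 by rewrite ge_min lexx orbT.
have half1 : 2^-1 < 1 :> R by rewrite invf_lt1 ?ltr1n.
have dd0 : 0 < 1 - delta by rewrite subr_gt0; apply: le_lt_trans half1.
exists (Num.sqrt (Num.sqrt (1 - delta))); split; first exact: sqrtr_ge0.
  by rewrite -[X in _ < X]sqrtr1 ltr_sqrt // -[X in _ < X]sqrtr1 ltr_sqrt // gtrBl.
move=> m m0 m1 mbal a a0.
have sqE x : 0 <= x -> toC (Num.sqrt x) ^+ 2 = toC x.
  by move=> x0; rewrite -[X in _ = toC X](sqr_sqrtr x0) rmorphXn.
rewrite sqE ?sqrtr_ge0 // -(ler_pXn2r (ltn0Sn 1)) ?nnegrE ?normr_ge0 ?ler0c ?sqrtr_ge0 //.
rewrite sqE ?(ltW dd0) //.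
have conjm y : (toC (m y))^* = toC (m y) by apply: CrealP; rewrite realE ler0c m0.
have zn y : zpow z (a * y) * (zpow z (a * y))^* = 1.
  by rewrite -normCK (norm_zpow q_gt1 prim_z) expr1n.
have m1C : \sum_y toC (m y) = 1 by rewrite -rmorph_sum m1.
have := variance m1C conjm zn; set S := `|_| ^+ 2 => var.
have lower : toC (kappa * eps) <= 2 - 2 * S.
  rewrite -var; apply: le_trans (_ : \sum_x \sum_(y | zmodp p y != zmodp p x) toC (m x * m y * kappa) <= _).
    rewrite -(eq_bigr _ (fun x _ => rmorph_sum _ _ _ _)) -rmorph_sum lecR.
    apply: le_trans (_ : \sum_x m x * (kappa * eps) <= _); first by rewrite -mulr_suml m1 mul1r.
    apply: ler_sum => x _; rewrite -mulr_suml -mulr_sumr -mulrA; apply: ler_wpM2l => //.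
    rewrite mulrC; apply: ler_wpM2r; first exact: ltW.
    have hs : \sum_(y | zmodp p y == zmodp p x) m y + \sum_(y | zmodp p y != zmodp p x) m y = 1.
      by rewrite -m1 [RHS](bigID (fun y => zmodp p y == zmodp p x)).
    by move: (mbal (zmodp p x)) hs; lra.
  apply: ler_sum => x _; rewrite [leRHS](bigID (fun y => zmodp p y == zmodp p x)) /=.
  apply: ler_wpDl.
    by apply: sumr_ge0 => y _; apply: mulr_ge0; [rewrite mulr_ge0 ?ler0c|apply: exprn_ge0].
  apply: ler_sum => y xy; rewrite !rmorphM /=; apply: ler_wpM2l.
    by rewrite mulr_ge0 ?ler0c.
  have -> : zpow z (a * x) - zpow z (a * y) = zpow z (a * x) * (1 - zpow z (a * (y - x))).
    by rewrite mulrBr mulr1 -zpowD //; congr (_ - zpow z _); ring.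
  rewrite normrM (norm_zpow q_gt1 prim_z) mul1r; apply: hkappa.
  apply: zmodp_unit_mul => //; apply: contra xy => /eqP h.
  apply/eqP; transitivity (zmodp p (y - x + x)); first by rewrite subrK.
  by rewrite zmodpD // h add0r.
have : S <= 1 - toC (kappa * eps / 2).
  have -> : toC (kappa * eps / 2) = toC (kappa * eps) / 2.
    by rewrite [LHS]rmorphM fmorphV rmorph_nat.
  move: lower.
  move: (toC _) S {var} => t S h.
  rewrite -(ler_pM2l (ltr0n _ 2)) mulrBr mulr1 mulrCA divff ?pnatr_eq0 // mulr1.
  by rewrite lerBrDr addrC -lerBrDr.
move=> h; apply: le_trans h _; rewrite -[1]/(toC 1) -rmorphB lecR lerB //.
by rewrite ge_min lexx.
Qed.

End BalanceGap.

(** The error term is real, while the weights that it bounds are complex. *)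
Lemma core_error_rmorph (F F' : numFieldType) (f : {rmorphism F -> F'})
    (W : finZmodType) g n t (s : F) :
  core_error g W n t (f s) = f (core_error g W n t s).
Proof.
rewrite /core_error.
by rewrite !(rmorphD f, rmorphN f, rmorphM f, rmorphXn f, rmorph_nat f, rmorph1 f, fmorphV f).
Qed.

Section UniformMoment.
Variables (R : realType) (p e : nat) (eps : R) (G : finZmodType).
Local Notation q := (p ^ e)%N.
Local Notation K := R[i]%C.
Local Notation toC := (real_complex R).
Hypotheses (p_pr : prime p) (q_gt1 : (1 < q)%N) (eps_gt0 : 0 < eps).
Hypothesis Gq : forall x : G, x *+ q = 0.

Definition balanced_mass (m : 'Z_q -> R) :=
  forall r : 'F_p, \sum_(y | zmodp p y == r) m y <= 1 - eps.

Definition real_moment n (C : 'M['Z_q]_n) (mu : 'I_n * 'I_n -> 'Z_q -> R) : R :=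
  \sum_(Y : {ffun 'I_n * 'I_n -> 'Z_q}) (\prod_ij mu ij (Y ij)) *
    #|[set F : {ffun 'I_n -> G} | generates F & kills (symm_mx C Y) F]|%:R.

Definition admissible n (C : 'M['Z_q]_n) (mu : 'I_n * 'I_n -> 'Z_q -> R) :=
  [/\ (forall i j, C i j = - C j i) /\ (forall i, C i i = 0),
      forall ij y, 0 <= mu ij y, forall ij, \sum_y mu ij y = 1 &
      forall i j : 'I_n, (i <= j)%N -> balanced_mass (mu (i, j))].

(** The bound [N] depends on the law of the entries only through [eps], so it serves
    a sequence of unrelated matrices. *)
Theorem real_moment_near1 (eta : R) : 0 < eta ->
  exists N, forall n (C : 'M['Z_q]_n) (mu : 'I_n * 'I_n -> 'Z_q -> R),
    admissible C mu -> (N <= n)%N -> (N <= \rank (map_mx (@zmodp p q) C))%N ->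
    `|real_moment C mu - 1| <= eta.
Proof.
move=> eta_gt0.
have [z prim_z] := numClosed_prim_root K (ltnW q_gt1).
have [s [s0 s1 sbal]] := balance_gap p_pr q_gt1 prim_z eps_gt0.
have g_gt0 : (0 < #|G|)%N by rewrite -cardsT cardG_gt0.
have [D [N [D0 small]]] := error_term_small (G * zhom G 'Z_q)%type #|{group G}| g_gt0 s0 s1 eta_gt0.
exists N => n C mu [[C_anti C_diag] mu0 mu1 mub] Nn Nr.
have [t0 {}small] := small n _ Nn Nr.
have s0C : 0 <= toC s by rewrite ler0c.
have s1C : toC s <= 1 by rewrite -[1]/(toC 1) lecR ltW.
have mu0C ij y : 0 <= toC (mu ij y) by rewrite ler0c.
have mu1C ij : \sum_y toC (mu ij y) = 1 by rewrite -rmorph_sum mu1.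
have mubC (i j : 'I_n) a : (i <= j)%N -> a != 0 ->
    `|\sum_y toC (mu (i, j) y) * zpow z (a * y)| <= toC s ^+ 2.
  by move=> ij a0; apply: sbal => //; exact: mub.
have := sur_moment_le p_pr q_gt1 Gq C_anti C_diag prim_z mu0C mu1C s0C s1C mubC t0.
have -> : sur_moment G C (fun ij y => toC (mu ij y)) = toC (real_moment C mu).
  rewrite /sur_moment /real_moment rmorph_sum; apply: eq_bigr => Y _.
  by rewrite rmorphM rmorph_prod rmorph_nat.
set err := (X in _ <= X); have -> : err = toC (core_error #|G| (G * zhom G 'Z_q)%type n (n %/ D) s
   + #|{group ((G * zhom G 'Z_q)%type : finZmodType)}|%:R * (#|{group G}|%:R * #|G|.-1%:R ^+ n + #|G|%:R ^+ n * 2^-1 ^+ (\rank (map_mx (@zmodp p q) C))./2)).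
  rewrite /err /phase_error core_error_rmorph; set f := (X in X (core_error _ _ _ _ _)).
  rewrite [RHS](rmorphD f); congr (_ + _).
  by rewrite !(rmorph_nat f, fmorphV f, rmorphD f, rmorphM f, rmorphXn f).
have -> : `|toC (real_moment C mu) - 1| = toC `|real_moment C mu - 1|.
  by rewrite -[1]/(toC 1) -rmorphB normc_def /= expr0n addr0 sqrtr_sqr.
rewrite -(rmorph_nat (real_complex R)) -rmorphXn -rmorphM lecR => h.
by rewrite -(ler_pM2r (_ : 0 < #|G|%:R ^+ n)) ?exprn_gt0 ?ltr0n //; exact: le_trans h small.
Qed.

End UniformMoment.

(** * The cokernel of a matrix over Z/q *)

Section QuotHom.
Variables (A B : finZmodType) (I : {group A}).

Lemma quot_hom_comp_proof (h : zhom (quot I) B) : is_hom [ffun x => h (quot_hom I x)].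
Proof. by apply/is_homP => x y; rewrite !ffunE !zhomD. Qed.

Definition quot_comp (h : zhom (quot I) B) : zhom A B := Zhom (quot_hom_comp_proof h).

Lemma quot_compE h x : quot_comp h x = h (quot_hom I x).
Proof. by rewrite {1}/quot_comp /= [LHS]ffunE. Qed.

Lemma quot_comp_inj : injective quot_comp.
Proof.
move=> h h' hh; apply: zhom_eqP => y; have [x <-] := quot_hom_surj y.
by rewrite -!quot_compE hh.
Qed.

Lemma quot_comp_surj h : (quot_comp h \in surs A B) = (h \in surs (quot I) B).
Proof.
apply/sursP/sursP => surh b; have [x <-] := surh b.
  by exists (quot_hom I x); rewrite quot_compE.
by have [a <-] := quot_hom_surj x; exists a; rewrite quot_compE.
Qed.

Lemma quot_factor (f : zhom A B) : {in I, forall x, f x = 0} ->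
  exists h : zhom (quot I) B, quot_comp h = f.
Proof.
move=> fI; pose s (y : quot I) : A := odflt 0 [pick x | quot_hom I x == y].
have sK y : quot_hom I (s y) = y.
  rewrite /s; case: pickP => [x /eqP //|nx]; have [x xy] := quot_hom_surj y.
  by have := nx x; rewrite xy eqxx.
have fs x y : quot_hom I x = quot_hom I y -> f x = f y.
  move=> xy; apply/eqP; rewrite -subr_eq0 -zhomN -zhomD; apply/eqP/fI.
  by rewrite -quot_hom_eq0 zhomD zhomN xy subrr.
have hP : is_hom [ffun y => f (s y)].
  apply/is_homP => y y'; rewrite !ffunE -zhomD; apply: fs.
  by rewrite zhomD !sK.
exists (Zhom hP); apply: zhom_eqP => x; rewrite quot_compE /= [LHS]ffunE; apply: fs.
by rewrite sK.
Qed.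

End QuotHom.

Section Image.
Variables (p e n : nat).
Local Notation q := (p ^ e)%N.
Variable M : 'M['Z_q]_n.
Hypothesis q_gt1 : (1 < q)%N.
Local Notation V := {ffun 'I_n -> 'Z_q}.

Definition mul_vec (v : V) : V := [ffun i => \sum_j M i j * v j].

Lemma image_group_set :
  @group_set (V : finZmodType) [set mul_vec v | v : V].
Proof.
apply/group_setP; split.
  apply/imsetP; exists 0 => //; apply/ffunP => i; rewrite !ffunE big1 // => j _.
  by rewrite ffunE mulr0.
move=> _ _ /imsetP[v _ ->] /imsetP[w _ ->]; apply/imsetP; exists (v + w) => //.
apply/ffunP => i; rewrite zmodMgE !ffunE -big_split /=; apply: eq_bigr => j _.
by rewrite ffunE mulrDr.
Qed.

Definition image_group : {group (V : finZmodType)} := Group image_group_set.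

Definition mx_coker : finZmodType := quot image_group.

Variable G : finZmodType.
Hypothesis Gq : forall x : G, x *+ q = 0.

Lemma free_homE (F : {ffun 'I_n -> G}) v :
  free_hom q_gt1 Gq F v = \sum_i F i *+ (v i : nat).
Proof. by rewrite /= ffunE. Qed.

Lemma mul_vec_unit i j : mul_vec (unit_vec q j) i = M i j.
Proof.
rewrite ffunE (bigD1 j) //= ffunE eqxx mulr1 big1 ?addr0 // => l /negPf lj.
by rewrite ffunE lj mulr0.
Qed.

Lemma free_hom_column (F : {ffun 'I_n -> G}) j :
  free_hom q_gt1 Gq F (mul_vec (unit_vec q j)) = \sum_i F i *+ (M i j : nat).
Proof. by rewrite free_homE; apply: eq_bigr => i _; rewrite mul_vec_unit. Qed.

Lemma kills_image (F : {ffun 'I_n -> G}) :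
  kills M F <-> {in image_group, forall x, free_hom q_gt1 Gq F x = 0}.
Proof.
split=> [/forallP kF _ /imsetP[v _ ->]|h]; last first.
  by apply/forallP => j; rewrite -free_hom_column h ?imset_f.
have -> : mul_vec v = \sum_j mul_vec (unit_vec q j) *+ (v j : nat).
  apply/ffunP => i; rewrite sum_ffunE [LHS]ffunE; apply: eq_bigr => j _.
  have MnE (w : V) m l : (w *+ m) l = w l *+ m.
    by elim: m => [|m IH]; rewrite ?mulr0n ?ffunE // !mulrS ffunE IH.
  by rewrite MnE mul_vec_unit -mulr_natr natr_Zp.
rewrite zhom_sum big1 // => j _; rewrite zhomMn free_hom_column.
by rewrite (eqP (kF j)) mul0rn.
Qed.

Lemma generates_surj (F : {ffun 'I_n -> G}) :
  generates F = (free_hom q_gt1 Gq F \in surs V G).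
Proof.
apply/eqP/sursP => [genF x|surF].
  have : x \in <<[set F i | i : 'I_n]>>%g by rewrite genF inE.
  move=> h; apply/exists_eqP; move: x h; apply: gen_ind => [|x y /exists_eqP[v <-] /exists_eqP[w <-]|x].
  - by apply/exists_eqP; exists 0; rewrite zhom0.
  - by apply/exists_eqP; exists (v + w); rewrite zhomD.
  - by move=> /imsetP[i _ ->]; apply/exists_eqP; exists (unit_vec q i); rewrite free_hom_unit.
apply/eqP; rewrite eqEsubset subsetT; apply/subsetP => x _; have [v <-] := surF x.
rewrite free_homE; elim/big_ind: _ => [|a b ha hb|i _]; first exact: group1.
  by rewrite -zmodMgE groupM.
by rewrite -zmodXgE groupX // mem_gen // imset_f.
Qed.

(** A homomorphism from the cokernel is one from the free module that vanishes on
    the image, and the latter is given by its values at the unit vectors. *)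
Lemma card_surs_coker :
  #|surs mx_coker G| = #|[set F : {ffun 'I_n -> G} | generates F && kills M F]|.
Proof.
rewrite -(card_imset _ (@quot_comp_inj _ G image_group)).
rewrite -[RHS](card_imset _ (bij_inj (free_hom_bij 'I_n q_gt1 Gq))).
apply: eq_card => f; apply/imsetP/imsetP => [[h hsur ->]|[F + ->]].
  have [F' _ FK] := free_hom_bij 'I_n q_gt1 Gq.
  exists (F' (quot_comp h)); last by rewrite FK.
  rewrite inE generates_surj FK quot_comp_surj hsur /=; apply/kills_image => x xI.
  have /eqP x0 : quot_hom image_group x == 0 by rewrite quot_hom_eq0.
  by rewrite FK quot_compE x0 zhom0.
rewrite inE generates_surj => /andP[surF /kills_image kF].
have [h hF] := quot_factor kF; exists h; last by rewrite hF.
by rewrite -quot_comp_surj hF.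
Qed.

End Image.

(** * The probability of an isomorphism class *)

Section IsoCount.
Variables (A G : finZmodType).

(** The automorphisms of [G] act simply transitively on the isomorphisms to
    [G]. *)
Lemma card_isos : isos A G != set0 -> #|isos A G| = #|Aut [set: G]|.
Proof.
case/set0Pn => f0; rewrite inE => /andP[/sursP surf0 /injectiveP inj0].
pose T (a : {perm G}) : zhom A G := insubd 0 [ffun x => a (f0 x)].
have TE a x : a \in Aut [set: G] -> T a x = a (f0 x).
  move=> aA; rewrite /T [zhom_fun _]val_insubd ifT ?ffunE //.
  apply/is_homP => y w; rewrite !ffunE zhomD.
  by have /morphicP := Aut_morphic aA; apply; rewrite inE.
have injT : {in Aut [set: G] &, injective T}.
  move=> a b aA bA ab; apply/permP => y; have [x <-] := surf0 y.
  by rewrite -!TE // ab.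
rewrite -(card_in_imset injT); apply: eq_card => f; apply/idP/imsetP => [|[a aA ->]].
  rewrite inE => /andP[/sursP surf /injectiveP injf].
  pose s y := odflt 0 [pick x | f0 x == y].
  have sK y : f0 (s y) = y.
    rewrite /s; case: pickP => [x /eqP //|nx]; have [x xy] := surf0 y.
    by have := nx x; rewrite xy eqxx.
  have s0 x : s (f0 x) = x by apply: inj0; rewrite sK.
  have injfs : injective (fun y => f (s y)).
    by move=> y y' /injf ss; rewrite -(sK y) ss sK.
  have aA : perm injfs \in Aut [set: G].
    rewrite inE; apply/andP; split; first by apply/subsetP => x _; rewrite inE.
    apply/morphicP => x y _ _; rewrite !permE !zmodMgE -zhomD; congr (f _).
    by apply: inj0; rewrite zhomD !sK.
  exists (perm injfs) => //; apply: zhom_eqP => x.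
  by rewrite TE // permE s0.
rewrite inE; apply/andP; split.
  apply/sursP => y; have [x hx] := surf0 ((a^-1)%g y); exists x.
  by rewrite TE // hx permKV.
by apply/injectiveP => x y; rewrite !TE // => /perm_inj/inj0.
Qed.

End IsoCount.

Section IsoProbability.
Variables (R : realType) (p k : nat) (eps : R) (G : finZmodType).
Local Notation q := (p ^ k.+1)%N.
Hypotheses (p_pr : prime p) (eps_gt0 : 0 < eps).
Hypothesis Gk : forall x : G, x *+ (p ^ k) = 0.

Let q1 : (1 < q)%N := prime_expS_gt1 k p_pr.

Section Expectation.
Variables (n : nat) (C : 'M['Z_q]_n) (mu : 'I_n * 'I_n -> 'Z_q -> R).
Local Notation entries := {ffun 'I_n * 'I_n -> 'Z_q}.

Definition expect (h : entries -> R) : R :=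
  \sum_(Y : entries) (\prod_ij mu ij (Y ij)) * h Y.

Lemma expectZ c h : expect (fun Y => c * h Y) = c * expect h.
Proof. by rewrite mulr_sumr; apply: eq_bigr => Y _; rewrite mulrCA. Qed.

Lemma expect_sum (I : Type) (r : seq I) (Q : pred I) (h : I -> entries -> R) :
  expect (fun Y => \sum_(i <- r | Q i) h i Y) = \sum_(i <- r | Q i) expect (h i).
Proof. by rewrite exchange_big /=; apply: eq_bigr => Y _; rewrite mulr_sumr. Qed.

Local Notation cokerY Y := (mx_coker (symm_mx C Y)).

Lemma pnat_coker (M : 'M['Z_q]_n) : (p.-nat #|mx_coker M|)%N.
Proof.
apply: (@pnat_dvd _ #|{: {ffun 'I_n -> 'Z_q}}|).
  rewrite -(card_kernel (f := quot_hom (image_group M))) ?dvdn_mulr //.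
  by apply/sursP; exact: quot_hom_surj.
by rewrite card_ffun card_ord Zp_cast ?q1 // -expnM pnatX pnat_id // orbT.
Qed.

Definition iso_prob : R := expect (fun Y => (isos (cokerY Y) G != set0)%:R).

Lemma expect_isos : expect (fun Y => #|isos (cokerY Y) G|%:R) =
  #|Aut [set: G]|%:R * iso_prob.
Proof.
rewrite -expectZ; apply: eq_bigr => Y _; congr (_ * _).
by case: eqVneq => [->|/card_isos ->]; rewrite ?cards0 ?mulr0 ?mulr1.
Qed.

Definition moment_estimate j : R := expect (fun Y => ext_estimate R p (cokerY Y) G j).

Lemma ext_q j (f : cocycle G (elem p j)) (u : ext f) : u *+ q = 0.
Proof. by rewrite expnSr; apply: ext_exp => //; exact: elem_exp. Qed.

Lemma moment_estimateE j : moment_estimate j =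
  ((p ^ j) ^ #|G|.-1)%:R^-1 * \sum_(f : cocycle G (elem p j)) real_moment (ext f) C mu.
Proof.
rewrite /real_moment -/(expect _) -expect_sum -expectZ; apply: eq_bigr => Y _.
congr (_ * _); rewrite /ext_estimate mulrC natr_sum; congr (_ * _).
by apply: eq_bigr => f _; rewrite (card_surs_coker _ q1 (@ext_q j f)).
Qed.

Lemma expect_isos_sign J : (forall ij y, 0 <= mu ij y) ->
  0 <= (-1) ^+ J * (\sum_(j < J.+1) (-1) ^+ j * euler_coef R p j * moment_estimate j
     - #|Aut [set: G]|%:R * iso_prob).
Proof.
move=> mu_ge0.
have -> : \sum_(j < J.+1) (-1) ^+ j * euler_coef R p j * moment_estimate j =
    expect (fun Y => iso_estimate R p (cokerY Y) G J).
  by rewrite /iso_estimate expect_sum; apply: eq_bigr => j _; rewrite expectZ.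
rewrite -expect_isos /expect -sumrB mulr_sumr; apply: sumr_ge0 => Y _.
rewrite -mulrBr mulrCA; apply: mulr_ge0; first by apply: prodr_ge0.
exact: iso_estimate_sign (pnat_coker _) J.
Qed.

End Expectation.

Local Notation L := (limn (euler_prod R p)).

Lemma moment_estimate_near1 j (eta : R) : 0 < eta ->
  exists N, forall n (C : 'M['Z_q]_n) (mu : 'I_n * 'I_n -> 'Z_q -> R),
    admissible eps C mu -> (N <= n)%N -> (N <= \rank (map_mx (@zmodp p q) C))%N ->
    `|moment_estimate C mu j - 1| <= eta.
Proof.
move=> eta_gt0.
have [Nf NfP] := fin_all_exists (fun f : cocycle G (elem p j) =>
  real_moment_near1 p_pr q1 eps_gt0 (@ext_q j f) eta_gt0).
exists (\max_f Nf f)%N => n C mu adm Nn Nr.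
have c0 : 0 < ((p ^ j) ^ #|G|.-1)%:R :> R by rewrite ltr0n !expn_gt0 prime_gt0.
rewrite moment_estimateE -(ler_pM2l c0) -[X in X * `|_|](ger0_norm (ltW c0)) -normrM.
rewrite mulrBr mulr1 mulrA divff ?gt_eqF // mul1r.
have cardE : ((p ^ j) ^ #|G|.-1)%N = #|{: cocycle G (elem p j)}|.
  by rewrite (card_cocycle p_pr Gk) card_elem.
rewrite {}cardE in c0 *.
have -> : #|{: cocycle G (elem p j)}|%:R = \sum_(f : cocycle G (elem p j)) 1 :> R.
  by rewrite sumr_const.
rewrite -sumrB mulr_suml; apply: le_trans (ler_norm_sum _ _ _) _.
apply: ler_sum => f _; rewrite mul1r; apply: NfP => //.
  by apply: leq_trans Nn; exact: leq_bigmax.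
by apply: leq_trans Nr; exact: leq_bigmax.
Qed.

Lemma alternating_estimate J (eta : R) : 0 < eta ->
  exists N, forall n (C : 'M['Z_q]_n) (mu : 'I_n * 'I_n -> 'Z_q -> R),
    admissible eps C mu -> (N <= n)%N -> (N <= \rank (map_mx (@zmodp p q) C))%N ->
    `|\sum_(j < J.+1) (-1) ^+ j * euler_coef R p j * moment_estimate C mu j
      - euler_sum p J 1| <= eta.
Proof.
move=> eta_gt0; pose c : R := \sum_(j < J.+1) euler_coef R p j.
have p1 := prime_gt1 p_pr.
have c0 : 0 < c.
  rewrite /c big_ord_recl; apply: ltr_pwDl; first exact: euler_coef_gt0.
  by apply: sumr_ge0 => j _; exact: euler_coef_ge0.
have [Nj NjP] := fin_all_exists (fun j : 'I_J.+1 => moment_estimate_near1 j (divr_gt0 eta_gt0 c0)).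
exists (\max_j Nj j)%N => n C mu adm Nn Nr.
rewrite /euler_sum -sumrB; apply: le_trans (ler_norm_sum _ _ _) _.
have -> : eta = \sum_(j < J.+1) euler_coef R p j * (eta / c).
  by rewrite -mulr_suml -/c mulrC divfK ?gt_eqF.
apply: ler_sum => j _; rewrite expr1n -mulrBr -mulrA normrMsign normrM.
rewrite ger0_norm ?euler_coef_ge0 //; apply: ler_wpM2l; first exact: euler_coef_ge0.
apply: NjP => //; first by apply: leq_trans Nn; exact: (leq_bigmax j).
by apply: leq_trans Nr; exact: (leq_bigmax j).
Qed.

(** Consecutive truncations of the alternating sum bound the expected number of
    isomorphisms on both sides; asymptotically each of them is within an Euler
    coefficient of the infinite product, and these coefficients tend to [0]. *)
Theorem iso_prob_near (eta : R) : 0 < eta ->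
  exists N, forall n (C : 'M['Z_q]_n) (mu : 'I_n * 'I_n -> 'Z_q -> R),
    admissible eps C mu -> (N <= n)%N -> (N <= \rank (map_mx (@zmodp p q) C))%N ->
    `|iso_prob C mu - #|Aut [set: G]|%:R^-1 * L| <= eta.
Proof.
move=> eta_gt0; have p1 := prime_gt1 p_pr.
have eta2 : 0 < eta / 2 by rewrite divr_gt0.
have coef_small : exists J, forall i, (J <= i)%N -> euler_coef R p i <= eta / 2.
  have h : ((fun i => 2 * 2^-1 ^+ i) @ \oo --> (0 : R))%classic.
    rewrite -[X in (_ --> X)%classic](mulr0 2); apply: cvgMr.
    by apply: cvg_expr; rewrite ger0_norm ?invr_ge0 // invf_lt1 ?ltr1n.
  move: h => /cvgr_le/(_ _ eta2)[J _ hJ]; exists J => i Ji.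
  by apply: le_trans (euler_coef_le R p1 i) _; exact: hJ.
have [J0 J0P] := coef_small; pose J := J0.*2.
have JJ : (J0 <= J)%N by rewrite /J -addnn leq_addr.
have [N1 N1P] := alternating_estimate J eta2.
have [N2 N2P] := alternating_estimate J.+1 eta2.
exists (maxn N1 N2) => n C mu adm; rewrite !geq_max => /andP[N1n N2n] /andP[N1r N2r].
have h1 := N1P n C mu adm N1n N1r; have h2 := N2P n C mu adm N2n N2r.
have [_ mu0 _ _] := adm.
have s1 := expect_isos_sign C J mu0; have s2 := expect_isos_sign C J.+1 mu0.
have e1 := euler_sum_lim R p1 J; have e2 := euler_sum_lim R p1 J.+1.
have c1 := J0P J JJ; have c2 := J0P J.+1 (leqW JJ).
have signJ : (-1) ^+ J = 1 :> R by rewrite -signr_odd odd_double expr0.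
rewrite exprS signJ mulr1 in s2; rewrite signJ in s1.
have aut_gt0 : 1 <= #|Aut [set: G]|%:R :> R by rewrite ler1n cardG_gt0.
have aut0 : 0 < #|Aut [set: G]|%:R :> R by apply: lt_le_trans aut_gt0.
have key : `|#|Aut [set: G]|%:R * iso_prob C mu - L| <= eta.
  move: h1 h2 s1 s2 e1 e2 c1 c2; rewrite !ler_norml.
  move: (\sum_(j < J.+1) _) (\sum_(j < J.+2) _) (#|Aut _|%:R * _) (euler_sum _ _ _) (euler_sum _ _ _) (L) (euler_coef _ _ _) (euler_coef _ _ _) => x1 x2 x3 x4 x5 x6 x7 x8.
  by move=> /andP[? ?] /andP[? ?] ? ? /andP[? ?] /andP[? ?] ? ?; lra.
rewrite -(ler_pM2l aut0) -[X in X * `|_|](ger0_norm (ltW aut0)) -normrM mulrBr mulrA divff ?gt_eqF // mul1r.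
by apply: le_trans key _; rewrite ler_peMl // ltW.
Qed.

End IsoProbability.

(** * The p-adic integers *)

Section Padic.
Variable p : nat.
Hypothesis p_pr : prime p.
Implicit Types x y a b : padic p.

Let q1 i : (1 < p ^ i.+1)%N := prime_expS_gt1 i p_pr.

Definition residue i x : 'Z_(p ^ i.+1) := padic_val x i.

Lemma residueD i x y : residue i (x + y) = residue i x + residue i y.
Proof. by []. Qed.

Lemma residueM i x y : residue i (x * y) = residue i x * residue i y.
Proof. by []. Qed.

Lemma residueN i x : residue i (- x) = - residue i x.
Proof. by []. Qed.

Lemma residue0 i : residue i 0 = 0.
Proof. by []. Qed.

Lemma residue1 i : residue i 1 = 1.
Proof. by []. Qed.

Lemma residueB i x y : residue i (x - y) = residue i x - residue i y.
Proof. by []. Qed.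

Lemma residue_sum i I (r : seq I) P (E : I -> padic p) :
  residue i (\sum_(j <- r | P j) E j) = \sum_(j <- r | P j) residue i (E j).
Proof. exact: (big_morph (residue i) (residueD i) (residue0 i)). Qed.

Lemma residueMn i x m : residue i (x *+ m) = residue i x *+ m.
Proof. by elim: m => [|m IH]; rewrite ?mulr0n ?residue0 // !mulrS residueD IH. Qed.

Lemma residue_nat i m : residue i m%:R = m%:R.
Proof. by rewrite residueMn residue1. Qed.

Lemma residue_eqP x y : (forall i, residue i x = residue i y) -> x = y.
Proof. by move=> xy; apply/val_inj/functional_extensionality_dep => i; exact: xy. Qed.

Lemma residue_coherentS i x : residue i.+1 x = residue i x %[mod p ^ i.+1].
Proof.
case: x => x /= /asboolP/(_ i)/(congr1 val) /=; rewrite [X in (_ %% X)%N]Zp_cast // => xi.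
by rewrite /residue /= -xi modn_mod.
Qed.

Lemma residue_coherent i j x : (i <= j)%N -> residue j x = residue i x %[mod p ^ i.+1].
Proof.
move=> ij; rewrite -(subnK ij); elim: (j - i)%N => [//|m IH].
rewrite addSn -IH -[RHS](@modn_dvdm (p ^ (m + i).+1)) ?dvdn_exp2l ?ltnS ?leq_addl //.
by rewrite -residue_coherentS modn_dvdm ?dvdn_exp2l ?ltnS ?leq_addl.
Qed.

Lemma natZp_eq i m m' : m = m' %[mod p ^ i.+1] -> m%:R = m'%:R :> 'Z_(p ^ i.+1).
Proof. by move=> mm; apply/val_inj; rewrite /= !val_Zp_nat // mm. Qed.

Lemma exists_padic (f : nat -> nat) :
  (forall i, f i.+1 = f i %[mod p ^ i.+1]) ->
  exists x : padic p, forall i, residue i x = (f i)%:R.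
Proof.
move=> fP; have coh : (fun i => (f i)%:R : 'Z_(p ^ i.+1)) \in @padic_coherent p.
  apply/asboolP => i; apply/val_inj; rewrite /= !val_Zp_nat // [X in (_ %% X)%N]Zp_cast //.
  by rewrite modn_dvdm ?fP // dvdn_exp2l.
by exists (Padic coh).
Qed.

(** The residues of the quotient are obtained by dividing those of [a], with a shift
    of the index by [k + 1]. *)
Lemma padic_divisible k a : residue k a = 0 -> exists b, a = b *+ p ^ k.+1.
Proof.
move=> ak; have pk0 : (0 < p ^ k.+1)%N by rewrite expn_gt0 prime_gt0.
have dvd i : (p ^ k.+1 %| residue (i + k.+1) a)%N.
  by rewrite /dvdn (residue_coherent a (_ : k <= _)%N) ?ak ?mod0n // addnS leqW ?leq_addl.
pose f i := (residue (i + k.+1) a %/ p ^ k.+1)%N.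
have fP i : f i.+1 = f i %[mod p ^ i.+1].
  apply/eqP; rewrite -(eqn_pmul2r pk0) !muln_modl !divnK // -expnD.
  by apply/eqP; exact: (residue_coherentS (i + k.+1) a).
have [b bE] := exists_padic fP.
exists b; apply: residue_eqP => i; rewrite residueMn bE -mulrnA divnK //.
rewrite -[LHS]natr_Zp; apply: natZp_eq; apply/esym/residue_coherent.
by rewrite leq_addr.
Qed.

(** All residues of [a] are units, and their inverses are coherent by uniqueness. *)
Lemma padic_unit a : residue 0 a != 0 -> exists b, a * b = 1.
Proof.
move=> a0; have cop i : coprime (p ^ i.+1) (residue i a).
  rewrite coprimeXl // prime_coprime //; apply: contra a0 => dvd.
  have h : (residue i a %% p = residue 0 a %% p)%N := residue_coherent a (leq0n i).
  have : (p %| residue 0 a)%N by rewrite /dvdn -h.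
  rewrite /dvdn modn_small; first by move/eqP => h0; apply/eqP/val_inj.
  by have := ltn_ord (residue 0 a); rewrite [X in (_ < X)%N]Zp_cast.
have unit i : residue i a \is a GRing.unit by rewrite -[residue i a]natr_Zp unitZpE.
pose f i : nat := (residue i a)^-1.
have fP i : f i.+1 = f i %[mod p ^ i.+1].
  set u := residue i.+1 a; set v := residue i a.
  have inv_mod l (w : 'Z_(p ^ l.+1)) : w \is a GRing.unit ->
      (w * (w^-1)%R = 1 %[mod p ^ l.+1])%N.
    move=> wu; have : (w * (w^-1)%R)%N%:R = 1%:R :> 'Z_(p ^ l.+1).
      by rewrite natrM !natr_Zp divrr.
    move/(congr1 (@nat_of_ord _)); rewrite (val_Zp_nat (q1 l)) => ->.
    by rewrite (val_Zp_nat (q1 l)).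
  have h1 := inv_mod _ _ (unit i.+1); have h2 := inv_mod _ _ (unit i).
  rewrite -/u in h1; rewrite -/v in h2.
  have {}h1 : (v * (u^-1)%R = 1 %[mod p ^ i.+1])%N.
    rewrite -modnMml -(residue_coherentS i a) modnMml -/u.
    by rewrite -(@modn_dvdm (p ^ i.+2)) ?dvdn_exp2l // h1 modn_dvdm // dvdn_exp2l.
  apply/eqP; rewrite -[X in X == _ %[mod _]]mul1n -modnMml -h2 modnMml mulnAC -modnMml h1.
  by rewrite modnMml mul1n.
have [b bE] := exists_padic fP.
exists b; apply: residue_eqP => i; rewrite residueM bE natr_Zp residue1.
exact: divrr (unit i).
Qed.

Variables (k n : nat) (G : finZmodType).
Local Notation q := (p ^ k.+1)%N.
Local Notation V := {ffun 'I_n -> 'Z_q}.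
Hypothesis Gk : forall x : G, x *+ (p ^ k) = 0.
Implicit Types X : 'M[padic p]_n.

Let Gq : forall x : G, x *+ q = 0 := mulrn_expS_eq0 Gk.

Definition reduce_mx (X : 'M[padic p]_n) : 'M['Z_q]_n := map_mx (residue k) X.
Definition reduce_vec (v : 'cV[padic p]_n) : V := [ffun i => residue k (v i 0)].

Lemma reduce_vecD u v : reduce_vec (u + v) = reduce_vec u + reduce_vec v.
Proof. by apply/ffunP => i; rewrite !ffunE mxE residueD. Qed.

Lemma reduce_vecM X v : reduce_vec (X *m v) = mul_vec (reduce_mx X) (reduce_vec v).
Proof.
apply/ffunP => i; rewrite !ffunE mxE residue_sum; apply: eq_bigr => j _.
by rewrite residueM !mxE ffunE.
Qed.

Lemma reduce_vec_surj (w : V) : exists v, reduce_vec v = w.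
Proof.
exists (\col_i (w i : nat)%:R); apply/ffunP => i; rewrite ffunE mxE residue_nat.
by rewrite natr_Zp.
Qed.

Lemma reduce_vec_eq0 v : reduce_vec v = 0 -> exists u, v = u *+ q.
Proof.
move=> /ffunP v0.
have /choice[b bE] : forall i, exists b, v i 0 = b *+ q.
  by move=> i; apply: padic_divisible; have := v0 i; rewrite !ffunE.
exists (\col_i b i); apply/matrixP => i j; rewrite (ord1 j) bE.
have MnE (u : 'cV[padic p]_n) m : (u *+ m) i 0 = u i 0 *+ m.
  by elim: m => [|m IH]; rewrite ?mulr0n ?mxE // !mulrS mxE IH.
by rewrite MnE mxE.
Qed.

(** The kernel of the reduction consists of multiples of [q], which kills [G], so
    an additive map to [G] factors through the reduction. *)
Lemma coker_iso_reduce X : coker_isog X G -> isos (mx_coker (reduce_mx X)) G != set0.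
Proof.
case=> f /[dup] bijf [f' ff' f'f]; pose phi (v : 'cV[padic p]_n) : G := f (\pi_(coker X)%qT v).
have phiD u v : phi (u + v) = phi u + phi v by rewrite /phi !raddfD.
have phi0 : phi 0 = 0 by apply: (addrI (phi 0)); rewrite -phiD !addr0.
have phiMn u m : phi (u *+ m) = phi u *+ m.
  by elim: m => [|m IH]; rewrite ?mulr0n // !mulrS phiD IH.
have phi_red u v : reduce_vec u = reduce_vec v -> phi u = phi v.
  move=> uv; have [w hw] : exists w, u - v = w *+ q.
    apply: reduce_vec_eq0; apply/ffunP => i; have /ffunP/(_ i) := uv.
    by rewrite !ffunE !mxE residueB => ->; rewrite subrr.
  by rewrite -(subrK v u) phiD hw phiMn Gq add0r.
have phi_ker u : phi u = 0 -> exists w, u = X *m w.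
  rewrite /phi => h; have : \pi_(coker X)%qT u = \pi_(coker X)%qT 0.
    by apply: (can_inj ff'); rewrite h raddf0 raddf0.
  move/eqP; rewrite -(Quotient.idealrBE (mx_image X)) subr0 => /asboolP. exact.
have phi_im w : phi (X *m w) = 0.
  rewrite /phi (_ : \pi_(coker X)%qT (X *m w) = 0) ?raddf0 //.
  rewrite -(raddf0 (\pi_(coker X)%qT)); apply/eqP.
  rewrite -(Quotient.idealrBE (mx_image X)) subr0; apply/asboolP; by exists w.
pose lift (w : V) : 'cV[padic p]_n := \col_i (w i : nat)%:R.
have liftK w : reduce_vec (lift w) = w.
  by apply/ffunP => i; rewrite ffunE mxE residue_nat natr_Zp.
have gP : is_hom [ffun w => phi (lift w)].
  by apply/is_homP => u v; rewrite !ffunE -phiD; apply: phi_red; rewrite reduce_vecD !liftK.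
pose g : zhom V G := Zhom gP.
have gE w : g w = phi (lift w) by rewrite /= ffunE.
have g_red v : g (reduce_vec v) = phi v by rewrite gE; apply: phi_red; rewrite liftK.
have gI : {in image_group (reduce_mx X), forall w, g w = 0}.
  move=> _ /imsetP[w _ ->]; have [v <-] := reduce_vec_surj w.
  by rewrite -reduce_vecM g_red phi_im.
have [h hg] := quot_factor gI; apply/set0Pn; exists h; rewrite inE; apply/andP; split.
  rewrite -quot_comp_surj hg; apply/sursP => y.
  exists (reduce_vec (generic_quotient.repr (f' y : coker X))); rewrite g_red /phi.
  by rewrite reprK f'f.
apply/injectiveP => y y' yy'; apply/eqP; rewrite -subr_eq0.
have : h (y - y') = 0 by rewrite zhomD zhomN yy' subrr.
have [w <-] := quot_hom_surj (y - y'); rewrite -quot_compE hg quot_hom_eq0.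
have [v <-] := reduce_vec_surj w; rewrite g_red => /phi_ker[u ->].
by rewrite reduce_vecM imset_f.
Qed.

(** The determinant is [1] mod [p], hence a unit. *)
Lemma one_sub_p_inv (Z : 'M[padic p]_n) : exists N, (1%:M - Z *+ p) *m N = 1%:M.
Proof.
have [b hb] : exists b, \det (1%:M - Z *+ p) * b = 1.
  apply: padic_unit; rewrite /determinant.
  have MnE (u : 'M[padic p]_n) m i j : (u *+ m) i j = u i j *+ m.
    by elim: m => [|m IH]; rewrite ?mulr0n ?mxE // !mulrS mxE IH.
  have p0 (x : 'Z_(p ^ 1)) : x *+ p = 0.
    by rewrite -mulr_natr -[p in X in _ * X]/(p ^ 1)%N pchar_Zp ?mulr0.
  have -> : residue 0 (\sum_(s : 'S_n) (-1) ^+ s * \prod_i (1%:M - Z *+ p) i (s i)) =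
     \det (1%:M : 'M['Z_(p ^ 1)]_n).
    rewrite residue_sum; apply: eq_bigr => s _; rewrite residueM.
    have residueX x m : residue 0 (x ^+ m) = residue 0 x ^+ m.
      by elim: m => [|m IH]; rewrite ?expr0 ?residue1 // !exprS residueM IH.
    rewrite residueX residueN residue1; congr (_ * _).
    rewrite (big_morph (residue 0) (residueM 0) (residue1 0)); apply: eq_bigr => i _.
    rewrite mxE residueD [X in _ + residue 0 X]mxE residueN MnE residueMn p0 subr0 !mxE.
    by rewrite residueMn residue1.
  by rewrite det1 oner_eq0.
exists (b *: \adj (1%:M - Z *+ p)); rewrite -scalemxAr mul_mx_adj.
by rewrite scale_scalar_mx mulrC hb.
Qed.

(** Since [p^k] kills the reduced cokernel, [p^k I = X U + p^(k+1) Z], so that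
    [p^k (I - p Z) = X U] with [I - p Z] invertible: multiples of [p^k] lie in
    the image of [X], and the cokernel does not change under reduction. *)
Lemma coker_iso_lift X : isos (mx_coker (reduce_mx X)) G != set0 -> coker_isog X G.
Proof.
case/set0Pn => h; rewrite inE => /andP[/sursP surh /injectiveP injh].
pose phi (v : 'cV[padic p]_n) : G := quot_comp h (reduce_vec v).
have phiD u v : phi (u + v) = phi u + phi v by rewrite /phi reduce_vecD zhomD.
have phi0 : phi 0 = 0 by apply: (addrI (phi 0)); rewrite -phiD !addr0.
have phiMn u m : phi (u *+ m) = phi u *+ m.
  by elim: m => [|m IH]; rewrite ?mulr0n // !mulrS phiD IH.
have phi_im w : phi (X *m w) = 0.
  rewrite /phi quot_compE reduce_vecM.
  have /eqP -> : quot_hom (image_group (reduce_mx X)) (mul_vec (reduce_mx X) (reduce_vec w)) == 0.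
    by rewrite quot_hom_eq0 imset_f.
  exact: zhom0.
have phi_ker0 v : phi v = 0 -> exists u w, v = X *m u + w *+ q.
  rewrite /phi quot_compE -(zhom0 h) => /injh/eqP; rewrite quot_hom_eq0.
  case/imsetP => w0 _; have [u <-] := reduce_vec_surj w0; rewrite -reduce_vecM => hu.
  have [w hw] : exists w, v - X *m u = w *+ q.
    apply: reduce_vec_eq0; apply/ffunP => i; have /ffunP/(_ i) := hu.
    by rewrite !ffunE !mxE residueB => ->; rewrite subrr.
  by exists u, w; rewrite addrC -hw subrK.
have [U [Z UZ]] : exists U Z : 'M[padic p]_n, 1%:M *+ p ^ k = X *m U + Z *+ q.
  have /choice[uw uwE] : forall j : 'I_n, exists uw : 'cV[padic p]_n * 'cV[padic p]_n,
      col j 1%:M *+ p ^ k = X *m uw.1 + uw.2 *+ q.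
    move=> j; have [|u [w e]] := phi_ker0 (col j 1%:M *+ p ^ k).
      by rewrite phiMn Gk.
    by exists (u, w).
  exists (\matrix_(i, j) (uw j).1 i 0), (\matrix_(i, j) (uw j).2 i 0).
  apply/matrixP => i j; have /matrixP/(_ i 0) := uwE j.
  have MnE m1 m2 (u : 'M[padic p]_(m1, m2)) m i1 j1 : (u *+ m) i1 j1 = u i1 j1 *+ m.
    by elim: m => [|m IH]; rewrite ?mulr0n ?mxE // !mulrS mxE IH.
  rewrite !mxE !MnE !mxE => ->; congr (_ + _).
  by apply: eq_bigr => l _; rewrite mxE.
have [N hN] := one_sub_p_inv Z.
have pk_im (v : 'cV[padic p]_n) : exists u, v *+ p ^ k = X *m u.
  exists (U *m N *m v).
  have e : X *m U = (1%:M - Z *+ p) *+ p ^ k.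
    by rewrite mulrnBl -mulrnA -expnS UZ addrK.
  rewrite !mulmxA e -!mulmxA.
  have MnM (A : 'M[padic p]_n) (u : 'cV[padic p]_n) m : (A *+ m) *m u = (A *m u) *+ m.
    by elim: m => [|m IH]; rewrite ?mulr0n ?mul0mx // !mulrS mulmxDl IH.
  by rewrite MnM mulmxA hN mul1mx.
have phi_ker v : phi v = 0 -> exists u, v = X *m u.
  move=> /phi_ker0[u [w ->]]; have [w' hw'] := pk_im (w *+ p).
  by exists (u + w'); rewrite mulmxDr -hw' -mulrnA -expnS.
have phi_surj (y : G) : exists v, phi v = y.
  have [x <-] := surh y; have [w <-] := quot_hom_surj x; have [v <-] := reduce_vec_surj w.
  by exists v; rewrite /phi quot_compE.
have phi_pi u v : (phi u == phi v) = (\pi_(coker X)%qT u == \pi_(coker X)%qT v).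
  rewrite -(Quotient.idealrBE (mx_image X)).
  have phiB : phi (u - v) = phi u - phi v.
    by apply: (addIr (phi v)); rewrite -phiD !subrK.
  rewrite -subr_eq0 -phiB; apply/eqP/asboolP => [/phi_ker//|[w ->]]; exact: phi_im.
pose f (y : coker X) : G := phi (generic_quotient.repr y).
have fpi v : f (\pi_(coker X)%qT v) = phi v.
  by apply/eqP; rewrite /f phi_pi reprK.
have fB : {morph f : u v / u - v}.
  move=> x y; rewrite -[x]reprK -[y]reprK -raddfB !fpi.
  by apply: (addIr (phi (generic_quotient.repr y))); rewrite -phiD !subrK.
have fM : zmod_morphism f by move=> x y; exact: fB.
pose fa : {additive coker X -> G} := HB.pack f (GRing.isZmodMorphism.Build _ _ f fM).
exists fa; have /choice[f' f'P] : forall y : G, exists u, f u = y.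
  by move=> y; have [v <-] := phi_surj y; exists (\pi_(coker X)%qT v); rewrite fpi.
exists f' => [x|y] /=; last exact: f'P.
rewrite -[LHS]reprK -[RHS]reprK; apply/eqP; rewrite -phi_pi.
by apply/eqP; exact: f'P.
Qed.

End Padic.

(** * The law of the reduced matrix *)

Section FiniteLaw.
Variables (R : realType) (d : measure_display) (T : measurableType d).
Variables (P : probability T R) (F : finType) (Y : T -> F).
Local Open Scope classical_set_scope.
Hypothesis mY : forall y, measurable [set w | Y w = y].

Definition mass y : R := fine (P [set w | Y w = y]).

Lemma massE y : P [set w | Y w = y] = (mass y)%:E.
Proof. by rewrite /mass fineK // fin_num_measure. Qed.

Lemma mass_ge0 y : 0 <= mass y.
Proof. by apply: fine_ge0; exact: measure_ge0. Qed.

Lemma prob_seq (s : seq F) : uniq s ->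
  measurable [set w | Y w \in s] /\
  P [set w | Y w \in s] = (\sum_(y <- s) mass y)%:E.
Proof.
elim: s => [_|y s IH /= /andP[ys /IH[mS PS]]].
  have -> : [set w | Y w \in [::]] = classical_sets.set0 by apply/seteqP; split.
  by rewrite big_nil measure0; split => //; exact: measurable0.
have -> : [set w | Y w \in y :: s] = [set w | Y w = y] `|` [set w | Y w \in s].
  apply/seteqP; split=> w /=; first by rewrite inE => /orP[/eqP|]; [left|right].
  by rewrite inE => -[->|->]; rewrite ?eqxx ?orbT.
split; first exact: measurableU.
transitivity (P [set w | Y w = y] + P [set w | Y w \in s])%E; last first.
  by rewrite massE PS big_cons.
apply: measureU => //.
by apply/seteqP; split => // w /= [-> ]; rewrite (negPf ys).
Qed.

Lemma prob_pred (Q : pred F) :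
  P [set w | Q (Y w)] = (\sum_(y | Q y) mass y)%:E.
Proof.
have [_] := prob_seq (enum_uniq Q); rewrite big_enum_cond /= => hs.
rewrite -[RHS](_ : P [set w | Y w \in enum Q] = _).
  by congr (P _); apply/seteqP; split=> w /=; rewrite mem_enum.
by rewrite hs; congr (_%:E); apply: eq_bigl => y; rewrite andbT.
Qed.

Lemma mass_sum1 : \sum_y mass y = 1.
Proof.
have := prob_pred xpredT; rewrite (_ : [set w | _] = classical_sets.setT) ?probability_setT => [[]//|].
by apply/seteqP; split.
Qed.

End FiniteLaw.

Section PIdeal.
Variable p : nat.
Hypothesis p_pr : prime p.

Definition p_ideal : {pred padic p} := fun x => residue 0 x == 0.

Lemma p_ideal_closed : idealr_closed p_ideal.
Proof.
split=> [||a u v]; rewrite !unfold_in ?residue0 ?residue1 ?oner_eq0 //.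
by rewrite residueD residueM => /eqP -> /eqP ->; rewrite mulr0 addr0.
Qed.

HB.instance Definition _ := isIdealr.Build (padic p) p_ideal p_ideal_closed.

Lemma p_ideal_maximal : maximal_ideal p_ideal.
Proof.
move=> J IJ x xJ; apply: contraT => xI.
have [y xy] := padic_unit p_pr xI.
have : 1 \in J by rewrite -xy mulrC idealMr.
by rewrite idealr1.
Qed.

(** The residue classes modulo the maximal ideal are those mod [p], so that being
    balanced bounds the law of the reduction to [F_p]. *)
Lemma padic_modp_ideal (x a : padic p) :
  (\pi_({ideal_quot p_ideal})%qT x == \pi_({ideal_quot p_ideal})%qT a) =
  (padic_modp x == padic_modp a).
Proof.
rewrite -(Quotient.idealrBE p_ideal) unfold_in residueB subr_eq0 /padic_modp.
apply/eqP/eqP => [xa|]; first by rewrite -/(residue 0 x) xa.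
move/(congr1 (@nat_of_ord _)); rewrite !val_Fp_nat // => h; apply/val_inj.
have lt_p (u : padic p) : (residue 0 u < p)%N.
  have := ltn_ord (residue 0 u); rewrite [X in (_ < X)%N]Zp_cast //.
  exact: prime_expS_gt1.
by move: h; rewrite !modn_small ?lt_p.
Qed.

End PIdeal.

Section Law.
Variables (R : realType) (p k n : nat) (eps : R).
Variables (d : measure_display) (T : measurableType d) (P : probability T R).
Variables (C : 'M[padic p]_n) (X : T -> 'M[padic p]_n).
Local Notation q := (p ^ k.+1)%N.
Local Open Scope classical_set_scope.
Hypothesis p_pr : prime p.
Hypothesis X_symm : forall w, symmetric_mx_for C (X w).
Hypothesis X_meas : forall i j, measurable_fun [set: T] (fun w => X w i j).
Hypothesis X_indep : mutually_independent P
  [pred ij : 'I_n * 'I_n | (ij.1 <= ij.2)%N] (fun ij w => X w ij.1 ij.2).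
Hypothesis X_bal : forall i j : 'I_n, (i <= j)%N -> balanced P eps (fun w => X w i j).

Let q1 : (1 < q)%N := prime_expS_gt1 k p_pr.

Lemma measurable_residue (i : nat) (y : 'Z_(p ^ i.+1)) :
  measurable [set x : padic p | residue i x = y].
Proof. by apply: sub_sigma_algebra; exists i, y. Qed.

Lemma measurable_entry (i j : 'I_n) l (y : 'Z_(p ^ l.+1)) :
  measurable [set w | residue l (X w i j) = y].
Proof.
have := X_meas i j measurableT (measurable_residue y).
by rewrite classical_sets.setTI.
Qed.

(** The entries below the diagonal get a point mass, so that the law of the
    reduced entries is a product over all pairs of indices. *)
Definition entry_mass (ij : 'I_n * 'I_n) (y : 'Z_q) : R :=
  if (ij.1 <= ij.2)%N then mass P (fun w => residue k (X w ij.1 ij.2)) y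
  else (y == 0)%:R.

Definition upper_entries (w : T) : {ffun 'I_n * 'I_n -> 'Z_q} :=
  [ffun ij : 'I_n * 'I_n => if (ij.1 <= ij.2)%N then residue k (X w ij.1 ij.2) else 0].

Lemma reduce_upper_entries w :
  symm_mx (reduce_mx k C) (upper_entries w) = reduce_mx k (X w).
Proof.
apply/matrixP => i j; rewrite !mxE !ffunE /=; case: leqP => // ji.
rewrite (ltnW ji) -residueD; congr residue.
have /matrixP/(_ i j) := X_symm w; rewrite !mxE => <-.
by rewrite addrCA subrr addr0.
Qed.

Lemma upper_entriesE (c : {ffun 'I_n * 'I_n -> 'Z_q}) :
  (forall ij : 'I_n * 'I_n, ~~ (ij.1 <= ij.2)%N -> c ij = 0) ->
  [set w | upper_entries w = c] =
  \bigcap_(ij in [set` finset (fun ij : 'I_n * 'I_n => (ij.1 <= ij.2)%N)])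
    ((fun w => X w ij.1 ij.2) @^-1` [set x | residue k x = c ij]).
Proof.
move=> c0; apply/seteqP; split=> w /=.
  by move=> <- ij /=; rewrite inE => ij_le; rewrite ffunE ij_le.
move=> h; apply/ffunP => ij; rewrite ffunE; case: ifPn => [ij_le|/c0 -> //].
by apply: h; rewrite /= inE.
Qed.

Lemma upper_entries_empty (c : {ffun 'I_n * 'I_n -> 'Z_q}) (ij : 'I_n * 'I_n) :
  ~~ (ij.1 <= ij.2)%N -> c ij != 0 -> [set w | upper_entries w = c] = classical_sets.set0.
Proof.
move=> nle cij; apply/seteqP; split=> w //= h.
by move: cij; rewrite -h ffunE (negPf nle) eqxx.
Qed.

Lemma measurable_upper_entries c : measurable [set w | upper_entries w = c].
Proof.
have [/forallP c0|] := boolP [forall ij : 'I_n * 'I_n, ~~ (ij.1 <= ij.2)%N ==> (c ij == 0)].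
  rewrite upper_entriesE => [|ij nle]; last by apply/eqP; exact: (implyP (c0 ij)).
  apply: fin_bigcap_measurable => [|ij _]; first exact: finite_finset.
  exact: measurable_entry.
rewrite negb_forall => /existsP[ij]; rewrite negb_imply => /andP[nle cij].
by rewrite (upper_entries_empty nle cij).
Qed.

Lemma mass_upper_entries c :
  mass P upper_entries c = \prod_ij entry_mass ij (c ij).
Proof.
rewrite /mass.
have [/forallP c0|] := boolP [forall ij : 'I_n * 'I_n, ~~ (ij.1 <= ij.2)%N ==> (c ij == 0)].
  rewrite upper_entriesE => [|ij nle]; last by apply/eqP; exact: (implyP (c0 ij)).
  rewrite X_indep => [|ij|ij]; last 2 first.
  - by rewrite inE.
  - exact: measurable_residue.
  rewrite (eq_bigr (fun ij => (entry_mass ij (c ij))%:E)) => [|ij]; last first.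
    rewrite inE /entry_mass => ->; rewrite -massE //.
    by move=> y; exact: measurable_entry.
  rewrite prodEFin /= [RHS](bigID (mem (finset (fun ij : 'I_n * 'I_n => (ij.1 <= ij.2)%N)))) /=.
  rewrite [X in _ = _ * X]big1 ?mulr1 // => ij; rewrite inE /entry_mass => nle.
  by rewrite (negPf nle) (eqP (implyP (c0 ij) nle)) eqxx.
rewrite negb_forall => /existsP[ij]; rewrite negb_imply => /andP[nle cij].
rewrite (upper_entries_empty nle cij) measure0 /= (bigD1 ij) //=.
by rewrite /entry_mass (negPf nle) (negPf cij) mul0r.
Qed.

Lemma entry_mass_ge0 ij y : 0 <= entry_mass ij y.
Proof. by rewrite /entry_mass; case: ifP => _; [exact: mass_ge0 | exact: ler0n]. Qed.

Lemma entry_mass_sum1 ij : \sum_y entry_mass ij y = 1.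
Proof.
rewrite /entry_mass; case: (ij.1 <= ij.2)%N.
  by apply: mass_sum1 => y; exact: measurable_entry.
by rewrite (bigD1 (0 : 'Z_q)) //= big1 ?addr0 // => y /negPf ->.
Qed.

Lemma zmodp_residue (x : padic p) : zmodp p (residue k x) = padic_modp x.
Proof.
apply/val_inj; rewrite [LHS](val_Fp_nat p_pr) [RHS](val_Fp_nat p_pr).
exact: (residue_coherent p_pr x (leq0n k)).
Qed.

Lemma entry_mass_balanced (i j : 'I_n) : (i <= j)%N -> balanced_mass eps (entry_mass (i, j)).
Proof.
move=> ij r; rewrite /entry_mass /= ij -lee_fin.
rewrite -(prob_pred P (measurable_entry i j (l := k)) (fun y => zmodp p y == r)).
pose a : padic p := (r : nat)%:R.
have pq : (p %| q)%N by rewrite expnS dvdn_mulr.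
have ra : padic_modp a = r by rewrite -zmodp_residue residue_nat zmodp_nat // natr_Zp.
have := X_bal ij (@p_ideal_maximal _ p_pr) (\pi_({ideal_quot (@p_ideal p)})%qT a).
congr (P _ <= _)%E; apply/seteqP; split=> w /=.
  by move=> /eqP; rewrite padic_modp_ideal // ra -zmodp_residue.
by move=> wr; apply/eqP; rewrite padic_modp_ideal // ra -zmodp_residue.
Qed.

Variable G : finZmodType.
Hypothesis Gk : forall x : G, x *+ (p ^ k) = 0.

Lemma prob_coker_isog : P [set w | coker_isog (X w) G] =
  (iso_prob G (reduce_mx k C) entry_mass)%:E.
Proof.
pose Q Y := isos (mx_coker (symm_mx (reduce_mx k C) Y)) G != finset.set0.
have -> : [set w | coker_isog (X w) G] = [set w | Q (upper_entries w)].
  apply/seteqP; split=> w /=; rewrite /Q reduce_upper_entries.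
    exact: coker_iso_reduce.
  exact: coker_iso_lift.
rewrite (prob_pred P measurable_upper_entries Q) /iso_prob /expect; congr (_%:E).
rewrite big_mkcond /=; apply: eq_bigr => Y _; rewrite mass_upper_entries -/(Q Y).
by case: (Q Y); rewrite ?mulr1 ?mulr0.
Qed.

Lemma admissible_entries : alternating_mx C ->
  admissible eps (reduce_mx k C) entry_mass.
Proof.
case=> C_anti C_diag; split; [|exact: entry_mass_ge0|exact: entry_mass_sum1|exact: entry_mass_balanced].
split=> [i j|i]; rewrite !mxE; last by rewrite C_diag residue0.
by have /matrixP/(_ j i) := C_anti; rewrite !mxE => ->; rewrite residueN.
Qed.

Lemma zmodp_reduce_mx :
  map_mx (@zmodp p q) (reduce_mx k C) = map_mx (@padic_modp p) C.
Proof. by apply/matrixP => i j; rewrite !mxE zmodp_residue. Qed.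

End Law.

(* From here on the unqualified set operations are those of classical sets. *)
Import classical_sets.
Local Open Scope classical_set_scope.
Local Open Scope ring_scope.

Theorem theorem1p2 (R : realType) (p : nat) (eps : R)
    (d : nat -> measure_display) (T : forall n, measurableType (d n))
    (P : forall n, probability (T n) R)
    (C : forall n, 'M[padic p]_n) (X : forall n, T n -> 'M[padic p]_n) :
  prime p -> 0 < eps ->
  (forall n, (0 < n)%N -> alternating_mx (C n)) ->
  (forall n, (0 < n)%N -> forall w, symmetric_mx_for (C n) (X n w)) ->
  (forall n, (0 < n)%N -> forall i j : 'I_n,
     measurable_fun setT (fun w => X n w i j)) ->
  (forall n, (0 < n)%N ->
     mutually_independent (P n) [pred ij : 'I_n * 'I_n | (ij.1 <= ij.2)%N]
       (fun ij w => X n w ij.1 ij.2)) ->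
  (forall n, (0 < n)%N -> forall i j : 'I_n, (i <= j)%N ->
     balanced (P n) eps (fun w => X n w i j)) ->
  \rank (map_mx (@padic_modp p) (C n)) @[n --> \oo] --> \oo ->
  forall G : finZmodType, (p.-group [set: G]%SET)%g ->
    P n [set w | coker_isog (X n w) G] @[n --> \oo] -->
      ((#|Aut [set: G]%SET|%:R)^-1 *
        limn (fun m => \prod_(1 <= k < m.+1) (1 - p%:R ^- k) : R))%:E.
Proof.
move=> p_pr eps_gt0 C_alt X_symm X_meas X_indep X_bal rankC G pG.
pose k := logn p #|[set: G]%SET|.
have Gk (x : G) : x *+ (p ^ k) = 0.
  by rewrite -(card_pgroup pG) -zmodXgE; apply: expg_cardG; rewrite inE.
pose r n := iso_prob G (reduce_mx k (C n)) (entry_mass (k := k) (P n) (X n)).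
have probE n : (0 < n)%N -> P n [set w | coker_isog (X n w) G] = (r n)%:E.
  move=> n0; apply: prob_coker_isog => //.
  - exact: X_symm.
  - exact: X_meas.
  - exact: X_indep.
apply: (@cvg_trans _ ((r n)%:E @[n --> \oo])).
  apply: near_eq_cvg; near=> n; rewrite probE //; near: n; exact: nbhs_infty_gt.
apply: cvg_EFin; first by near=> n.
apply/cvgrPdist_le => eta eta_gt0.
have [N hN] := iso_prob_near p_pr eps_gt0 Gk eta_gt0.
have rankN : \forall n \near \oo, (N <= \rank (map_mx (@padic_modp p) (C n)))%N.
  exact: (rankC _ (nbhs_infty_ge N)).
near=> n; rewrite distrC; apply: hN.
- have n0 : (0 < n)%N by near: n; exact: nbhs_infty_gt.
  apply: admissible_entries => //; [exact: X_meas | exact: X_bal | exact: C_alt].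
- by near: n; exact: nbhs_infty_ge.
- by rewrite zmodp_reduce_mx //; near: n.
Unshelve. all: by end_near.
Qed.
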